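(* Let $C$ be an algebraically closed field of characteristic zero and let $R$ be a complete local noetherian $C$-algebra with residue field $C$. The restriction functor $$\mathbf r_0:\mathbf{MC}_{\rm rs}(R[x^{\pm}]/R)\longrightarrow\mathbf{MC}_{\rm rs}(R((x))/R),\qquad M\longmapsto R((x))\otimes_{R[x^\pm]}M,$$ is an equivalence of categories.
   Context: $R((x))=R[[x]][x^{-1}]$, $R[x^\pm]=R[x,x^{-1}]$, and $\vartheta=x\frac{d}{dx}$ is the $R$-linear derivation $\vartheta(\sum a_nx^n)=\sum na_nx^n$ on $R[[x]]$, $R((x))$, $R[x]$, $R[x^\pm]$. $\mathbb P_R$ is the projective line over $R$ obtained by gluing $\mathbb A_0=\mathrm{Spec}\,R[x]$ and $\mathbb A_\infty=\mathrm{Spec}\,R[y]$ along $x=y^{-1}$; $\mathbb P_R\smallsetminus\{0,\infty\}=\mathrm{Spec}\,R[x^\pm]$, and $\vartheta$ extends to a global vector field on $\mathbb P_R$ (with $\vartheta(y)=-y$). $\mathbf{MC}(R[x^\pm]/R)$ (resp. $\mathbf{MC}(R((x))/R)$) is the category of pairs $(M,\nabla)$ with $M$ a finitely generated $R[x^\pm]$-module (resp. $R((x))$-module) and $\nabla:M\to M$ an $R$-linear map with $\nabla(fm)=\vartheta(f)m+f\nabla(m)$; arrows are the linear maps commuting with the $\nabla$'s. $\mathbf{MC}_{\log}(\mathbb P_R/R)$ is the category of pairs $(\mathcal M,\nabla)$ with $\mathcal M$ a coherent $\mathcal O_{\mathbb P_R}$-module and $\nabla:\mathcal M\to\mathcal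 M$ an $R$-linear map satisfying the same Leibniz rule on all open subsets. $\mathbf{MC}_{\log}(R[[x]]/R)$ is the category of pairs $(\mathcal M,\nabla)$ with $\mathcal M$ a finitely generated $R[[x]]$-module and $\nabla$ an $R$-linear map satisfying the same Leibniz rule. $\mathbf{MC}_{\rm rs}(R[x^\pm]/R)$ is the full subcategory of $\mathbf{MC}(R[x^\pm]/R)$ of objects isomorphic to the restriction to $\mathbb P_R\smallsetminus\{0,\infty\}$ of some object of $\mathbf{MC}_{\log}(\mathbb P_R/R)$. $\mathbf{MC}_{\rm rs}(R((x))/R)$ is the full subcategory of $\mathbf{MC}(R((x))/R)$ of objects isomorphic to $\mathcal M[x^{-1}]$ for some $\mathcal M\in\mathbf{MC}_{\log}(R[[x]]/R)$. The module $R((x))\otimes_{R[x^\pm]}M$ carries the derivation $f\otimes m\mapsto\vartheta(f)\otimes m+f\otimes\nabla(m)$. *)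

(* Defs.v *)
From HB Require Import structures.
From mathcomp Require Import all_boot all_order all_algebra.
From mathcomp Require Import mathcomp_extra boolp classical_sets functions
  cardinality fsbigop.
From mathcomp Require Import zify.
Set Implicit Arguments.
Unset Strict Implicit.
Unset Printing Implicit Defensive.
Import Order.TTheory GRing.Theory Num.Theory.
Local Open Scope ring_scope.
Local Open Scope classical_set_scope.
Local Open Scope quotient_scope.

Section Laurent.
Variable R : comNzRingType.

(* R((x)): the families (f n) of coefficients, f n being that of x ^ n, with
   f n = 0 for n << 0. *)
Definition laurent_pred : {pred int -> R} :=
  fun f => `[< exists N : int, forall n, n < N -> f n = 0 >].

Lemma laurent_predP (f : int -> R) :
  reflect (exists N : int, forall n, n < N -> f n = 0) (f \in laurent_pred).
Proof. exact: asboolP. Qed.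

Fact laurent_zmod_closed : zmod_closed laurent_pred.
Proof.
split; first by apply/laurent_predP; exists 0.
move=> f g /laurent_predP[a fa] /laurent_predP[b gb]; apply/laurent_predP.
exists (Num.min a b) => n; rewrite lt_min => /andP[na nb].
by rewrite !fctE fa // gb // subr0.
Qed.
HB.instance Definition _ :=
  GRing.isZmodClosed.Build (int -> R) laurent_pred laurent_zmod_closed.

Record laurent := Laurent {lcoef :> int -> R; _ : lcoef \in laurent_pred}.
HB.instance Definition _ := [isSub for lcoef].
HB.instance Definition _ := [Choice of laurent by <:].
HB.instance Definition _ := [SubChoice_isSubZmodule of laurent by <:].

Lemma lcoefP (f g : laurent) : (forall n, f n = g n) -> f = g.
Proof. by move=> fg; apply/val_inj/funext. Qed.

Lemma lbound (f : laurent) : exists N : int, forall n, n < N -> f n = 0.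
Proof. by case: f => f /= /laurent_predP. Qed.

Lemma lcoefD (f g : laurent) n : (f + g) n = f n + g n. Proof. by []. Qed.

Fact laurent_scale_subproof c (f : laurent) :
  (fun n => c * f n) \in laurent_pred.
Proof.
have [a fa] := lbound f; apply/laurent_predP.
by exists a => n na; rewrite fa // mulr0.
Qed.
Definition laurent_scale c f := Laurent (laurent_scale_subproof c f).

Fact laurent_scaleA c d f :
  laurent_scale c (laurent_scale d f) = laurent_scale (c * d) f.
Proof. by apply: lcoefP => n /=; rewrite mulrA. Qed.
Fact laurent_scale1 : left_id 1 laurent_scale.
Proof. by move=> f; apply: lcoefP => n /=; rewrite mul1r. Qed.
Fact laurent_scaleDr : right_distributive laurent_scale +%R.
Proof. by move=> c f g; apply: lcoefP => n; rewrite /= mulrDr. Qed.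
Fact laurent_scaleDl f : {morph laurent_scale^~ f : c d / c + d}.
Proof. by move=> c d; apply: lcoefP => n; rewrite /= mulrDl. Qed.
HB.instance Definition _ := GRing.Zmodule_isLmodule.Build R laurent
  laurent_scaleA laurent_scale1 laurent_scaleDr laurent_scaleDl.

Lemma lcoefZ c (f : laurent) n : (c *: f) n = c * f n. Proof. by []. Qed.

(* Finite sum, since [f] and [g] both have finitely many terms of negative
   degree. *)
Definition laurent_mul_fun (f g : int -> R) (n : int) : R :=
  \sum_(i \in setT) f i * g (n - i).

Let trunc (a : int) m (f : int -> R) : {poly R} := \poly_(i < m) f (a + i%:Z).

Lemma laurent_mul_fun0 (a b : int) (f g : int -> R) n :
  (forall n, n < a -> f n = 0) -> (forall n, n < b -> g n = 0) ->
  n < a + b -> laurent_mul_fun f g n = 0.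
Proof.
move=> fa gb nab; apply: fsbig1 => i _.
have [/fa->|ai] := ltP i a; first by rewrite mul0r.
by rewrite gb ?mulr0 //; lia.
Qed.

Lemma laurent_mul_funE (a b : int) (f g : int -> R) k m :
  (forall n, n < a -> f n = 0) -> (forall n, n < b -> g n = 0) ->
  (k < m)%N ->
  laurent_mul_fun f g (a + b + k%:Z) = (trunc a m f * trunc b m g)`_k.
Proof.
move=> fa gb km; rewrite coefM /laurent_mul_fun.
rewrite (fsbigE [seq a + j%:Z | j <- iota 0 k.+1]).
- rewrite (eq_bigl xpredT) => [|i]; last by rewrite in_setT.
  rewrite big_map -{1}[k.+1]subn0 -/(index_iota 0 k.+1) big_mkord.
  apply: eq_bigr => j _; rewrite !coef_poly.
  have jk := ltn_ord j; rewrite !ifT; [|lia|lia].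
  by congr (f _ * g _); lia.
- by rewrite map_inj_uniq ?iota_uniq // => i j; lia.
- by [].
- move=> i _ /mapP nfgi.
  have [/fa->|ai] := ltP i a; first by rewrite mul0r.
  have [/gb->|bi] := ltP (a + b + k%:Z - i) b; first by rewrite mulr0.
  by case: nfgi; exists `|i - a|%N; rewrite ?mem_iota; lia.
Qed.

Fact laurent_mul_subproof (f g : laurent) :
  laurent_mul_fun f g \in laurent_pred.
Proof.
have [[a fa] [b gb]] := (lbound f, lbound g); apply/laurent_predP.
by exists (a + b) => n; apply: laurent_mul_fun0.
Qed.
Definition laurent_mul (f g : laurent) := Laurent (laurent_mul_subproof f g).

Fact lmonom_subproof (d : int) :
  (fun n => if n == d then 1 else 0 : R) \in laurent_pred.
Proof. by apply/laurent_predP; exists d => n; case: eqP => // ->; lia. Qed.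
(* x ^ d *)
Definition lmonom d := Laurent (lmonom_subproof d).

Lemma le_bound (a a' : int) (f : int -> R) :
  (forall n, n < a -> f n = 0) -> a' <= a -> forall n, n < a' -> f n = 0.
Proof. by move=> fa aa' n na; apply: fa; apply: lt_le_trans aa'. Qed.

Lemma lt_nat (N n : int) : n < N \/ exists k : nat, n = N + k%:Z.
Proof. by have [?|?] := ltP n N; [left|right; exists `|n - N|%N; lia]. Qed.

Fact laurent_mulC : commutative laurent_mul.
Proof.
move=> f g; have [[a fa] [b gb]] := (lbound f, lbound g).
apply: lcoefP => n /=; have [nab|[k ->]] := lt_nat (a + b) n.
  have nba : n < b + a by rewrite addrC.
  by rewrite (laurent_mul_fun0 fa gb nab) (laurent_mul_fun0 gb fa nba).
rewrite (laurent_mul_funE fa gb (ltnSn k)) mulrC [a + b]addrC.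
by rewrite -(laurent_mul_funE gb fa (ltnSn k)).
Qed.

Fact laurent_mulA : associative laurent_mul.
Proof.
move=> f g h; have [a fa] := lbound f; have [b gb] := lbound g.
have [c hc] := lbound h.
have fgab n : n < a + b -> laurent_mul f g n = 0 by apply: laurent_mul_fun0.
have ghbc n : n < b + c -> laurent_mul g h n = 0 by apply: laurent_mul_fun0.
apply: lcoefP => n /=; have [nab|[k ->]] := lt_nat (a + b + c) n.
  rewrite (@laurent_mul_fun0 a (b + c)) ?addrA //.
  by rewrite (@laurent_mul_fun0 (a + b) c).
rewrite [RHS](laurent_mul_funE fgab hc (ltnSn k)) -[a + b + c]addrA.
rewrite [LHS](laurent_mul_funE fa ghbc (ltnSn k)).
transitivity ((trunc a k.+1 f * (trunc b k.+1 g * trunc c k.+1 h))`_k).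
  rewrite !coefM; apply: eq_bigr => i _; congr (_ * _).
  by rewrite {1}/trunc coef_poly ifT ?ltnS ?leq_subr //;
    apply: laurent_mul_funE; rewrite // ltnS leq_subr.
rewrite mulrA !coefM; apply: eq_bigr => i _; congr (_ * _).
by rewrite [in RHS]/trunc coef_poly ifT //; apply/esym/laurent_mul_funE.
Qed.

Fact laurent_mul1 : left_id (lmonom 0) laurent_mul.
Proof.
move=> f; apply: lcoefP => n /=; rewrite /laurent_mul_fun.
rewrite (fsbigE [:: 0]) //=; last first.
  by move=> i _; rewrite inE => /negPf->; rewrite mul0r.
by rewrite big_cons big_nil in_setT addr0 eqxx mul1r subr0.
Qed.

Fact laurent_mulDl : left_distributive laurent_mul +%R.
Proof.
move=> f g h; have [a fa] := lbound f; have [b gb] := lbound g.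
have [c hc] := lbound h; pose d := Num.min a b.
have fd : forall n, n < d -> f n = 0.
  by apply: le_bound fa _; rewrite ge_min lexx.
have gd : forall n, n < d -> g n = 0.
  by apply: le_bound gb _; rewrite ge_min lexx orbT.
have fgd n : n < d -> (f + g) n = 0.
  by move=> nd; rewrite lcoefD fd // gd // addr0.
apply: lcoefP => n; rewrite lcoefD /=; have [nab|[k ->]] := lt_nat (d + c) n.
  by rewrite !(@laurent_mul_fun0 d c) // addr0.
rewrite !(@laurent_mul_funE d c _ _ k k.+1) // -coefD -mulrDl.
congr ((_ * _ : {poly R})`_ _).
by apply/polyP => i; rewrite coefD !coef_poly; case: ifP => // _; rewrite addr0.
Qed.

Fact laurent_1_neq0 : lmonom 0 != 0.
Proof.
apply/eqP => /(congr1 (fun f : laurent => f 0)) /eqP.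
by rewrite /= oner_eq0.
Qed.

HB.instance Definition _ := GRing.Zmodule_isComNzRing.Build laurent
  laurent_mulA laurent_mulC laurent_mul1 laurent_mulDl laurent_1_neq0.

Lemma lcoefM (f g : laurent) n : (f * g) n = \sum_(i \in setT) f i * g (n - i).
Proof. by []. Qed.

Fact laurent_scalerAl (c : R) (f g : laurent) : c *: (f * g) = c *: f * g.
Proof.
have [[a fa] [b gb]] := (lbound f, lbound g).
have cfa n : n < a -> (c *: f) n = 0 by move=> na; rewrite lcoefZ fa // mulr0.
apply: lcoefP => n; rewrite lcoefZ /=; have [nab|[k ->]] := lt_nat (a + b) n.
  by rewrite !(@laurent_mul_fun0 a b) // mulr0.
rewrite !(@laurent_mul_funE a b _ _ k k.+1) // -coefZ scalerAl.
congr ((_ * _ : {poly R})`_ _).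
by apply/polyP => i; rewrite coefZ !coef_poly; case: ifP => // _; rewrite mulr0.
Qed.
HB.instance Definition _ := GRing.Lmodule_isLalgebra.Build R laurent
  laurent_scalerAl.
HB.instance Definition _ := GRing.Lalgebra_isComAlgebra.Build R laurent.

Lemma lmonomME d (f : laurent) n : (lmonom d * f) n = f (n - d).
Proof.
rewrite lcoefM (fsbigE [:: d]) //=; last first.
  by move=> i _; rewrite inE => /negPf->; rewrite mul0r.
by rewrite big_cons big_nil in_setT addr0 eqxx mul1r.
Qed.

Lemma lmonomM d e : lmonom d * lmonom e = lmonom (d + e).
Proof.
by apply: lcoefP => n; rewrite lmonomME /= subr_eq addrC.
Qed.

Fact laurent_theta_subproof (f : laurent) :
  (fun n => f n *~ n) \in laurent_pred.
Proof.
have [a fa] := lbound f; apply/laurent_predP.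
by exists a => n na; rewrite fa // mul0rz.
Qed.
(* x d/dx *)
Definition laurent_theta (f : laurent) := Laurent (laurent_theta_subproof f).

Lemma laurent_thetaE f n : laurent_theta f n = f n *~ n. Proof. by []. Qed.

Fact laurent_theta_linear : linear laurent_theta.
Proof.
move=> c f g; apply: lcoefP => n.
by rewrite lcoefD lcoefZ !laurent_thetaE lcoefD lcoefZ mulrzDl mulrzAr.
Qed.

Fact laurent_thetaM f g :
  laurent_theta (f * g) = laurent_theta f * g + f * laurent_theta g.
Proof.
have [[a fa] [b gb]] := (lbound f, lbound g).
have tfa n : n < a -> laurent_theta f n = 0.
  by move=> na; rewrite laurent_thetaE fa // mul0rz.
have tgb n : n < b -> laurent_theta g n = 0.
  by move=> nb; rewrite laurent_thetaE gb // mul0rz.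
apply: lcoefP => n; rewrite lcoefD laurent_thetaE /=.
have [nab|[k ->]] := lt_nat (a + b) n.
  by rewrite !(@laurent_mul_fun0 a b) // mul0rz addr0.
rewrite !(@laurent_mul_funE a b _ _ k k.+1) // !coefM -big_split /= mulrz_suml.
apply: eq_bigr => i _; rewrite !coef_poly ltn_ord ltnS leq_subr.
rewrite mulrzAl mulrzAr -mulrzDr; congr (_ *~ _).
by have := ltn_ord i; lia.
Qed.

End Laurent.

Section PowerSeries.
Variable R : comNzRingType.

(* R[[x]], as a subalgebra of R((x)) *)
Definition pseries_pred : {pred laurent R} :=
  fun f => `[< forall n : int, n < 0 -> f n = 0 >].

Lemma pseries_predP (f : laurent R) :
  reflect (forall n : int, n < 0 -> f n = 0) (f \in pseries_pred).
Proof. exact: asboolP. Qed.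

Fact pseries_subalg_closed : subalg_closed pseries_pred.
Proof.
split.
- by apply/pseries_predP => -[].
- move=> c f g /pseries_predP fP /pseries_predP gP; apply/pseries_predP => n n0.
  by rewrite lcoefD lcoefZ fP // gP // mulr0 addr0.
- move=> f g /pseries_predP fP /pseries_predP gP; apply/pseries_predP => n n0.
  exact: (@laurent_mul_fun0 _ 0 0).
Qed.
HB.instance Definition _ := GRing.isSubalgClosed.Build R (laurent R)
  pseries_pred pseries_subalg_closed.

Record pseries :=
  PSeries {pseries_val :> laurent R; _ : pseries_val \in pseries_pred}.
HB.instance Definition _ := [isSub for pseries_val].
HB.instance Definition _ := [Choice of pseries by <:].
HB.instance Definition _ := [SubChoice_isSubAlgebra of pseries by <:].
HB.instance Definition _ := [SubNzRing_isSubComNzRing of pseries by <:].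

Fact psX_subproof : lmonom R 1 \in pseries_pred.
Proof. by apply/pseries_predP => -[]. Qed.
Definition psX := PSeries psX_subproof.

Fact pseries_theta_subproof (f : pseries) : laurent_theta f \in pseries_pred.
Proof.
apply/pseries_predP => n n0.
by case: f => f /= /pseries_predP fP; rewrite fP // mul0rz.
Qed.
Definition pseries_theta (f : pseries) := PSeries (pseries_theta_subproof f).

Fact pseries_theta_linear : linear pseries_theta.
Proof. by move=> c f g; apply/val_inj/laurent_theta_linear. Qed.

Fact pseries_thetaM f g :
  pseries_theta (f * g) = pseries_theta f * g + f * pseries_theta g.
Proof. exact/val_inj/laurent_thetaM. Qed.

End PowerSeries.

Section LaurentPolynomials.
Variable R : comNzRingType.

(* R[x, x^-1], as a subalgebra of R((x)) *)
Definition lpoly_pred : {pred laurent R} :=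
  fun f => `[< exists N : int, forall n, N < n -> f n = 0 >].

Lemma lpoly_predP (f : laurent R) :
  reflect (exists N : int, forall n, N < n -> f n = 0) (f \in lpoly_pred).
Proof. exact: asboolP. Qed.

Fact lpoly_subalg_closed : subalg_closed lpoly_pred.
Proof.
split.
- by apply/lpoly_predP; exists 0 => -[[]|].
- move=> c f g /lpoly_predP[a fP] /lpoly_predP[b gP]; apply/lpoly_predP.
  exists (Num.max a b) => n; rewrite gt_max => /andP[na nb].
  by rewrite lcoefD lcoefZ fP // gP // mulr0 addr0.
- move=> f g /lpoly_predP[a fP] /lpoly_predP[b gP]; apply/lpoly_predP.
  exists (a + b) => n nab; apply: fsbig1 => i _.
  have [/fP->|ai] := ltP a i; first by rewrite mul0r.
  by rewrite gP ?mulr0 //; lia.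
Qed.
HB.instance Definition _ := GRing.isSubalgClosed.Build R (laurent R)
  lpoly_pred lpoly_subalg_closed.

Record lpoly := LPoly {lpoly_val :> laurent R; _ : lpoly_val \in lpoly_pred}.
HB.instance Definition _ := [isSub for lpoly_val].
HB.instance Definition _ := [Choice of lpoly by <:].
HB.instance Definition _ := [SubChoice_isSubAlgebra of lpoly by <:].
HB.instance Definition _ := [SubNzRing_isSubComNzRing of lpoly by <:].

Fact lpXn_subproof (d : int) : lmonom R d \in lpoly_pred.
Proof. by apply/lpoly_predP; exists d => n dn /=; rewrite gt_eqF. Qed.
(* x ^ d in R[x, x^-1] *)
Definition lpXn (d : int) := LPoly (lpXn_subproof d).

Fact lpoly_theta_subproof (f : lpoly) : laurent_theta f \in lpoly_pred.
Proof.
apply/lpoly_predP; case: f => f /= /lpoly_predP[N fN].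
by exists N => n Nn; rewrite fN // mul0rz.
Qed.
Definition lpoly_theta (f : lpoly) := LPoly (lpoly_theta_subproof f).

Fact lpoly_theta_linear : linear lpoly_theta.
Proof. by move=> c f g; apply/val_inj/laurent_theta_linear. Qed.

Fact lpoly_thetaM f g :
  lpoly_theta (f * g) = lpoly_theta f * g + f * lpoly_theta g.
Proof. exact/val_inj/laurent_thetaM. Qed.

End LaurentPolynomials.

Section Tensor.
Variables (A B : comNzRingType) (phi : {rmorphism A -> B}) (M : lmodType A).

(* The presentation of B (x)_A M: a list of pairs stands for the formal sum of
   its entries, and [tens_eq] is the least congruence that makes (b, m)
   biadditive and A-balanced. *)
Inductive tens_eq : seq (B * M) -> seq (B * M) -> Prop :=
| tens_refl s : tens_eq s s
| tens_sym s t : tens_eq s t -> tens_eq t s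
| tens_trans s t u : tens_eq s t -> tens_eq t u -> tens_eq s u
| tens_cat s s' t t' :
    tens_eq s s' -> tens_eq t t' -> tens_eq (s ++ t) (s' ++ t')
| tens_catC s t : tens_eq (s ++ t) (t ++ s)
| tens_Dl b b' m : tens_eq [:: (b + b', m)] [:: (b, m); (b', m)]
| tens_Dr b m m' : tens_eq [:: (b, m + m')] [:: (b, m); (b, m')]
| tens_0l m : tens_eq [:: (0, m)] [::]
| tens_bal b a m : tens_eq [:: (b * phi a, m)] [:: (b, a *: m)].

Definition tens_rel : rel (seq (B * M)) := fun s t => `[< tens_eq s t >].

Fact tens_rel_refl : reflexive tens_rel.
Proof. by move=> s; apply/asboolP/tens_refl. Qed.
Fact tens_rel_sym : symmetric tens_rel.
Proof. by move=> s t; apply/asboolP/asboolP => /tens_sym. Qed.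
Fact tens_rel_trans : transitive tens_rel.
Proof.
by move=> t s u /asboolP st /asboolP tu; apply/asboolP; apply: tens_trans tu.
Qed.
Definition tens_equiv :=
  EquivRel tens_rel tens_rel_refl tens_rel_sym tens_rel_trans.

Definition tensor := {eq_quot tens_equiv}.
HB.instance Definition _ := Choice.on tensor.
HB.instance Definition _ := EqQuotient.on tensor.

Lemma tens_eqP s t : \pi_tensor s = \pi_tensor t <-> tens_eq s t.
Proof. by split=> [/eqquotP/asboolP|st]; last exact/eqquotP/asboolP. Qed.

Definition tens_add (x y : tensor) : tensor := \pi_tensor (repr x ++ repr y).
Definition tens_opp (x : tensor) : tensor :=
  \pi_tensor [seq (- p.1, p.2) | p <- repr x].

Lemma tens_reprK s : tens_eq (repr (\pi_tensor s)) s.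
Proof. by apply/tens_eqP; rewrite reprK. Qed.

Lemma tens_addE s t :
  tens_add (\pi_tensor s) (\pi_tensor t) = \pi_tensor (s ++ t).
Proof. by apply/tens_eqP/tens_cat; apply: tens_reprK. Qed.

Fact tens_addA : associative tens_add.
Proof.
move=> x y z; rewrite -(reprK x) -(reprK y) -(reprK z).
move: (repr x) (repr y) (repr z) => s t u.
rewrite (tens_addE t u) (tens_addE s t) (tens_addE s) (tens_addE (s ++ t)).
by rewrite catA.
Qed.

Fact tens_addC : commutative tens_add.
Proof.
move=> x y; rewrite -(reprK x) -(reprK y).
rewrite (tens_addE (repr x)) (tens_addE (repr y)).
exact/tens_eqP/tens_catC.
Qed.

Fact tens_add0 : left_id (\pi_tensor [::]) tens_add.
Proof. by move=> x; rewrite -(reprK x) (tens_addE [::]). Qed.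

Fact tens_addN : left_inverse (\pi_tensor [::]) tens_opp tens_add.
Proof.
move=> x; rewrite -[in X in tens_add _ X](reprK x) tens_addE; apply/tens_eqP.
elim: (repr x) => [|[b m] s IHs] /=; first exact: tens_refl.
have -> : (- b, m) :: [seq (- p.1, p.2) | p <- s] ++ (b, m) :: s =
  [:: (- b, m)] ++ (([seq (- p.1, p.2) | p <- s] ++ [:: (b, m)]) ++ s).
  by rewrite -catA.
apply: (@tens_trans _ ([:: (- b, m)] ++
  (([:: (b, m)] ++ [seq (- p.1, p.2) | p <- s]) ++ s))).
  apply: tens_cat (tens_refl _) _; apply: tens_cat (tens_refl _).
  exact: tens_catC.
rewrite -catA (catA [:: (- b, m)] [:: (b, m)]).
apply: (@tens_trans _ ([::] ++ [::])); last exact: tens_refl.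
apply: tens_cat IHs.
apply: tens_trans (tens_sym (tens_Dl _ _ _)) _.
by rewrite addNr; apply: tens_0l.
Qed.

HB.instance Definition _ := GRing.isZmodule.Build tensor
  tens_addA tens_addC tens_add0 tens_addN.

Definition tens (b : B) (m : M) : tensor := \pi_tensor [:: (b, m)].

Lemma tensDl b b' m : tens (b + b') m = tens b m + tens b' m.
Proof. by rewrite /tens [RHS]tens_addE; apply/tens_eqP/tens_Dl. Qed.
Lemma tensDr b m m' : tens b (m + m') = tens b m + tens b m'.
Proof. by rewrite /tens [RHS]tens_addE; apply/tens_eqP/tens_Dr. Qed.
Lemma tensZ b a m : tens b (a *: m) = tens (b * phi a) m.
Proof. by apply/tens_eqP/tens_sym/tens_bal. Qed.
Lemma tens0l m : tens 0 m = 0.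
Proof. exact/tens_eqP/tens_0l. Qed.
Lemma tens0r b : tens b 0 = 0.
Proof. by rewrite -(scale0r 0) tensZ rmorph0 mulr0 tens0l. Qed.

Lemma tens_piE s : \pi_tensor s = \sum_(p <- s) tens p.1 p.2.
Proof.
elim: s => [|[b m] s IHs]; first by rewrite big_nil.
by rewrite big_cons -IHs [RHS]tens_addE.
Qed.

Lemma tens_ind (P : tensor -> Prop) :
  P 0 -> (forall b m, P (tens b m)) -> (forall x y, P x -> P y -> P (x + y)) ->
  forall x, P x.
Proof.
move=> P0 Pt PD; move=> x; rewrite -(reprK x) tens_piE.
by apply: (big_ind P) => // -[b m] _.
Qed.

Section Lift.
Variables (N : zmodType) (f : B -> M -> N).

Definition balanced :=
  [/\ forall b b' m, f (b + b') m = f b m + f b' m,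
      forall b m m', f b (m + m') = f b m + f b m' &
      forall b a m, f (b * phi a) m = f b (a *: m)].

(* The additive map sending [tens b m] to [f b m], when [f] is balanced. *)
Definition tens_lift (x : tensor) : N := \sum_(p <- repr x) f p.1 p.2.

Hypothesis f_bal : balanced.
Let fDl := let: And3 h _ _ := f_bal in h.
Let fDr := let: And3 _ h _ := f_bal in h.
Let fbal := let: And3 _ _ h := f_bal in h.

Let lift_eq s t : tens_eq s t ->
  \sum_(p <- s) f p.1 p.2 = \sum_(p <- t) f p.1 p.2.
Proof.
elim=> //=.
- by move=> {}s {}t u _ -> _ ->.
- by move=> {}s s' {}t t' _ es _ et; rewrite !big_cat es et.
- by move=> {}s {}t; rewrite !big_cat /= addrC.
- by move=> b b' m; rewrite !big_cons !big_nil !addr0 fDl.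
- by move=> b m m'; rewrite !big_cons !big_nil !addr0 fDr.
- move=> m; rewrite big_seq1 big_nil; apply: (addrI (f 0 m)).
  by rewrite -fDl !addr0.
- by move=> b a m; rewrite !big_seq1 fbal.
Qed.

Lemma tens_liftE b m : tens_lift (tens b m) = f b m.
Proof. by rewrite /tens_lift (lift_eq (tens_reprK _)) big_seq1. Qed.

Lemma tens_liftD : {morph tens_lift : x y / x + y}.
Proof.
by move=> x y; rewrite /tens_lift (lift_eq (tens_reprK _)) big_cat.
Qed.

Lemma tens_lift0 : tens_lift 0 = 0.
Proof. by apply: (addrI (tens_lift 0)); rewrite -tens_liftD !addr0. Qed.

End Lift.

Lemma tens_ext (N : zmodType) (f g : tensor -> N) :
  {morph f : x y / x + y} -> {morph g : x y / x + y} ->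
  (forall b m, f (tens b m) = g (tens b m)) -> f =1 g.
Proof.
move=> fD gD fg; apply: tens_ind => // [|x y fx fy]; last first.
  by rewrite fD gD fx fy.
have [f0 g0] : f 0 = 0 /\ g 0 = 0.
  by split; [apply: (addrI (f 0))|apply: (addrI (g 0))];
    rewrite -?fD -?gD !addr0.
by rewrite f0 g0.
Qed.

Fact tens_scale_bal (c : B) : balanced (fun b m => tens (c * b) m).
Proof.
split=> *; first by rewrite mulrDr tensDl.
  by rewrite tensDr.
by rewrite tensZ mulrA.
Qed.
Definition tens_scale (c : B) := tens_lift (fun b m => tens (c * b) m).

Lemma tens_scaleE c b m : tens_scale c (tens b m) = tens (c * b) m.
Proof. exact: tens_liftE (tens_scale_bal c) _ _. Qed.

Fact tens_scaleDr : right_distributive tens_scale +%R.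
Proof. by move=> c; apply: tens_liftD (tens_scale_bal c). Qed.

Fact tens_scaleA c d x : tens_scale c (tens_scale d x) = tens_scale (c * d) x.
Proof.
move: x; apply: tens_ext => [x y|x y|b m]; rewrite ?tens_scaleDr //.
by rewrite !tens_scaleE mulrA.
Qed.

Fact tens_scale1 : left_id 1 tens_scale.
Proof.
by apply: tens_ext => [x y|x y|b m]; rewrite ?tens_scaleDr ?tens_scaleE ?mul1r.
Qed.

Fact tens_scaleDl x : {morph tens_scale^~ x : c d / c + d}.
Proof.
move=> c d; move: x; apply: tens_ind => [|b m|x y xE yE].
- have scale0 e : tens_scale e 0 = 0 by apply: tens_lift0 (tens_scale_bal e).
  by rewrite !scale0 addr0.
- by rewrite !tens_scaleE mulrDl tensDl.
- by rewrite !tens_scaleDr xE yE addrACA.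
Qed.

HB.instance Definition _ := GRing.Zmodule_isLmodule.Build B tensor
  tens_scaleA tens_scale1 tens_scaleDr tens_scaleDl.

Lemma scale_tens c b m : c *: tens b m = tens (c * b) m.
Proof. exact: tens_scaleE. Qed.

End Tensor.

Definition fg_module (A : comNzRingType) (M : lmodType A) : Prop :=
  exists n (e : 'I_n -> M), forall m, exists c : 'I_n -> A,
    m = \sum_(i < n) c i *: e i.

Lemma fg_tensor (A B : comNzRingType) (phi : {rmorphism A -> B})
  (M : lmodType A) : fg_module M -> fg_module (tensor phi M).
Proof.
move=> [n [e eM]]; exists n, (fun i => tens phi 1 (e i)).
apply: tens_ind => [|b m|x y [c ->] [d ->]].
- by exists (fun=> 0); rewrite big1 // => i _; rewrite scale0r.
- have [c ->] := eM m; exists (fun i => b * phi (c i)).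
  rewrite (big_morph _ (tensDr phi b) (tens0r phi M b)).
  by apply: eq_bigr => i _; rewrite scale_tens mulr1 tensZ.
- exists (fun i => c i + d i); rewrite -big_split.
  by apply: eq_bigr => i _; rewrite scalerDl.
Qed.

Record category := Category {
  ob :> Type;
  mor : ob -> ob -> Type;
  idmor : forall X, mor X X;
  compm : forall X Y Z, mor Y Z -> mor X Y -> mor X Z;
  comp1m : forall X Y (f : mor X Y), compm (idmor Y) f = f;
  compm1 : forall X Y (f : mor X Y), compm f (idmor X) = f;
  compmA : forall X Y Z T (h : mor Z T) (g : mor Y Z) (f : mor X Y),
    compm h (compm g f) = compm (compm h g) f }.
Arguments idmor {c} X.
Arguments compm {c X Y Z}.

Record iso (C : category) (X Y : C) := Iso {
  iso_fwd : mor X Y;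
  iso_bwd : mor Y X;
  iso_bwdK : compm iso_bwd iso_fwd = idmor X;
  iso_fwdK : compm iso_fwd iso_bwd = idmor Y }.

Definition isomorphic (C : category) (X Y : C) : Prop := inhabited (iso X Y).

Record functor (C D : category) := Functor {
  fob :> C -> D;
  fmap : forall X Y, mor X Y -> mor (fob X) (fob Y);
  fmap1 : forall X, fmap (idmor X) = idmor (fob X);
  fmapM : forall X Y Z (g : mor Y Z) (f : mor X Y),
    fmap (compm g f) = compm (fmap g) (fmap f) }.
Arguments fmap {C D} F {X Y} f : rename.

Section FunctorOps.
Variables C D E : category.

Definition id_functor : functor C C :=
  @Functor C C id (fun _ _ f => f) (fun _ => erefl) (fun _ _ _ _ _ => erefl).

Variables (G : functor D E) (F : functor C D).
Fact comp_functor1 X : fmap G (fmap F (idmor X)) = idmor (G (F X)).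
Proof. by rewrite !fmap1. Qed.
Fact comp_functorM X Y Z (g : mor Y Z) (f : mor X Y) :
  fmap G (fmap F (compm g f)) = compm (fmap G (fmap F g)) (fmap G (fmap F f)).
Proof. by rewrite !fmapM. Qed.
Definition comp_functor : functor C E :=
  @Functor C E (fun X => G (F X)) (fun _ _ f => fmap G (fmap F f))
    comp_functor1 comp_functorM.

Definition naturally_isomorphic (F1 F2 : functor C D) : Prop :=
  exists (u : forall X, mor (F1 X) (F2 X)) (v : forall X, mor (F2 X) (F1 X)),
    [/\ forall X, compm (v X) (u X) = idmor (F1 X),
        forall X, compm (u X) (v X) = idmor (F2 X) &
        forall X Y (f : mor X Y),
          compm (u Y) (fmap F1 f) = compm (fmap F2 f) (u X)].
End FunctorOps.

Definition is_equivalence (C D : category) (F : functor C D) : Prop :=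
  exists G : functor D C,
    naturally_isomorphic (comp_functor G F) (id_functor C) /\
    naturally_isomorphic (comp_functor F G) (id_functor D).

Lemma functor_isomorphic (C D : category) (F : functor C D) (X Y : C) :
  isomorphic X Y -> isomorphic (F X) (F Y).
Proof.
move=> [[f g gf fg]]; split; exists (fmap F f) (fmap F g);
  by rewrite -fmapM ?gf ?fg fmap1.
Qed.

Lemma isomorphic_sym (C : category) (X Y : C) :
  isomorphic X Y -> isomorphic Y X.
Proof. by move=> [[f g gf fg]]; split; exists g f. Qed.

Lemma isomorphic_trans (C : category) (Y X Z : C) :
  isomorphic X Y -> isomorphic Y Z -> isomorphic X Z.
Proof.
move=> [[f f' f'f ff']] [[g g' g'g gg']]; split.
exists (compm g f) (compm f' g').
  by rewrite -compmA [compm g' _]compmA g'g comp1m.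
by rewrite -compmA [compm f _]compmA ff' comp1m.
Qed.

Definition full_subcategory (C : category) (P : C -> Prop) : category :=
  @Category {X : C | P X} (fun X Y => mor (sval X) (sval Y))
    (fun X => idmor (sval X)) (fun _ _ _ g f => compm g f)
    (fun _ _ => @comp1m C _ _) (fun _ _ => @compm1 C _ _)
    (fun _ _ _ _ => @compmA C _ _ _ _).

Definition restrict_functor (C D : category) (P : C -> Prop) (Q : D -> Prop)
    (F : functor C D) (PQ : forall X, P X -> Q (F X)) :
    functor (full_subcategory P) (full_subcategory Q) :=
  @Functor (full_subcategory P) (full_subcategory Q)
    (fun X => exist Q (F (sval X)) (PQ _ (svalP X))) (fun _ _ f => fmap F f)
    (fun X => fmap1 F (sval X)) (fun _ _ _ g f => fmapM F g f).

(* A commutative R-algebra with an R-linear derivation *)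
Record diff_alg (R : comNzRingType) := DiffAlg {
  da_alg :> comAlgType R;
  der : da_alg -> da_alg;
  der_linear : linear der;
  derM : forall f g, der (f * g) = der f * g + f * der g }.
Arguments der {R d}.

Record diff_mor (R : comNzRingType) (A B : diff_alg R) := DiffMor {
  dm_fun :> {rmorphism A -> B};
  dm_alg : forall c : R, dm_fun c%:A = c%:A;
  dm_der : forall f, dm_fun (der f) = der (dm_fun f) }.

Section DiffAlgTheory.
Variables (R : comNzRingType) (D : diff_alg R).

Lemma derD : {morph @der R D : f g / f + g}.
Proof. by move=> f g; have := der_linear 1 f g; rewrite !scale1r. Qed.

Lemma der0 : der (0 : D) = 0.
Proof. by apply: (addrI (der 0)); rewrite -derD !addr0. Qed.

Lemma derZ c (f : D) : der (c *: f) = c *: der f.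
Proof. by have := der_linear c f 0; rewrite !addr0 der0 addr0. Qed.

Lemma der1 : der (1 : D) = 0.
Proof.
by apply: (addrI (der 1)); rewrite -{3}[1]mulr1 derM mulr1 mul1r addr0.
Qed.
End DiffAlgTheory.

Section Connections.
Variable R : comNzRingType.

Record conn (A : diff_alg R) := Conn {
  conn_mod :> lmodType A;
  conn_fg : fg_module conn_mod;
  nabla : conn_mod -> conn_mod;
  nablaD : {morph nabla : m n / m + n};
  nablaZ : forall (c : R) m, nabla (c%:A *: m) = c%:A *: nabla m;
  nabla_leibniz : forall (f : A) m,
    nabla (f *: m) = der f *: m + f *: nabla m }.
Arguments nabla {A M} m : rename.

Record conn_hom (A : diff_alg R) (M N : conn A) := ConnHom {
  chom_fun :> M -> N;
  chom_linear : linear chom_fun;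
  chom_nabla : forall m, chom_fun (nabla m) = nabla (chom_fun m) }.

Lemma chom_ext (A : diff_alg R) (M N : conn A) (f g : conn_hom M N) :
  f =1 g -> f = g.
Proof.
case: f g => f fl fn [g gl gn] /= /funext fg; subst g.
by congr ConnHom; apply: Prop_irrelevance.
Qed.

Section Category.
Variable A : diff_alg R.
Definition chom_id (M : conn A) : conn_hom M M :=
  @ConnHom A M M id (fun _ _ _ => erefl) (fun _ => erefl).

Section Comp.
Variables (M N P : conn A) (g : conn_hom N P) (f : conn_hom M N).
Fact chom_comp_linear : linear (g \o f).
Proof. by move=> a m n; rewrite /= !chom_linear. Qed.
Fact chom_comp_nabla m : (g \o f) (nabla m) = nabla ((g \o f) m).
Proof. by rewrite /= !chom_nabla. Qed.
Definition chom_comp : conn_hom M P :=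
  ConnHom chom_comp_linear chom_comp_nabla.
End Comp.

Fact chom_comp1m (M N : conn A) (f : conn_hom M N) :
  chom_comp (chom_id N) f = f.
Proof. exact: chom_ext. Qed.
Fact chom_compm1 (M N : conn A) (f : conn_hom M N) :
  chom_comp f (chom_id M) = f.
Proof. exact: chom_ext. Qed.
Fact chom_compA (M N P Q : conn A) (h : conn_hom P Q) (g : conn_hom N P)
  (f : conn_hom M N) :
  chom_comp h (chom_comp g f) = chom_comp (chom_comp h g) f.
Proof. exact: chom_ext. Qed.

Definition MC : category := @Category (conn A) (@conn_hom A) chom_id chom_comp
  chom_comp1m chom_compm1 chom_compA.
End Category.

Lemma conn_nabla0 (A : diff_alg R) (M : conn A) : nabla (0 : M) = 0.
Proof. by apply: (addrI (nabla 0)); rewrite -nablaD !addr0. Qed.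

Lemma chomD (A : diff_alg R) (M N : conn A) (f : conn_hom M N) :
  {morph f : m n / m + n}.
Proof. by move=> m n; have := chom_linear f 1 m n; rewrite !scale1r. Qed.

Lemma chomZ (A : diff_alg R) (M N : conn A) (f : conn_hom M N) a m :
  f (a *: m) = a *: f m.
Proof.
have f0 : f 0 = 0 by apply: (addrI (f 0)); rewrite -chomD !addr0.
by have := chom_linear f a m 0; rewrite !addr0 f0 addr0.
Qed.

Section BaseChange.
Variables (A B : diff_alg R) (phi : diff_mor A B).

Section Object.
Variable M : conn A.

Definition bc_nabla : tensor phi M -> tensor phi M :=
  tens_lift (fun b m => tens phi (der b) m + tens phi b (nabla m)).

Fact bc_nabla_bal :
  balanced phi (fun b (m : M) => tens phi (der b) m + tens phi b (nabla m)).
Proof.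
split=> [b b' m|b m m'|b a m].
- by rewrite derD !tensDl addrACA.
- by rewrite nablaD !tensDr addrACA.
- rewrite nabla_leibniz derM -dm_der tensDl tensDr !tensZ -addrA.
  by congr (_ + _); rewrite mulrC [phi _ * _]mulrC.
Qed.

Lemma bc_nablaE b m :
  bc_nabla (tens phi b m) = tens phi (der b) m + tens phi b (nabla m).
Proof. exact: tens_liftE bc_nabla_bal _ _. Qed.

Fact bc_nablaD : {morph bc_nabla : x y / x + y}.
Proof. exact: tens_liftD bc_nabla_bal. Qed.

Fact bc_nabla_leibniz (f : B) x :
  bc_nabla (f *: x) = der f *: x + f *: bc_nabla x.
Proof.
move: x; apply: tens_ext => [x y|x y|b m].
- by rewrite scalerDr bc_nablaD.
- by rewrite bc_nablaD !scalerDr addrACA.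
- rewrite bc_nablaE !scale_tens bc_nablaE derM tensDl scalerDr !scale_tens.
  by rewrite addrA.
Qed.

Fact bc_nablaZ (c : R) x : bc_nabla (c%:A *: x) = c%:A *: bc_nabla x.
Proof.
rewrite bc_nabla_leibniz derZ der1.
by rewrite scaler0 scale0r add0r.
Qed.

Definition bc_ob : conn B := @Conn B (tensor phi M)
  (fg_tensor phi (conn_fg M)) bc_nabla bc_nablaD bc_nablaZ bc_nabla_leibniz.

Lemma nabla_bcE b m : nabla (tens phi b m : bc_ob) =
  tens phi (der b) m + tens phi b (nabla m) :> tensor phi M.
Proof. exact: bc_nablaE. Qed.
End Object.

Section Morphism.
Variables (M N : conn A) (g : conn_hom M N).

Definition bc_fun : bc_ob M -> bc_ob N :=
  tens_lift (fun b m => tens phi b (g m)).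

Fact bc_fun_bal : balanced phi (fun b m => tens phi b (g m)).
Proof.
split=> [b b' m|b m m'|b a m]; first by rewrite tensDl.
  by rewrite chomD tensDr.
by rewrite chomZ tensZ.
Qed.

Lemma bc_funE b m : bc_fun (tens phi b m) = tens phi b (g m).
Proof. exact: tens_liftE bc_fun_bal _ _. Qed.

Fact bc_funD : {morph bc_fun : x y / x + y}.
Proof. exact: tens_liftD bc_fun_bal. Qed.

Fact bc_fun_linear : linear bc_fun.
Proof.
move=> c x y; rewrite bc_funD; congr (_ + _).
move: x; apply: tens_ext => [x x'|x x'|b m].
- by rewrite scalerDr bc_funD.
- by rewrite bc_funD scalerDr.
- by rewrite bc_funE scale_tens bc_funE scale_tens.
Qed.

Fact bc_fun_nabla x : bc_fun (nabla x) = nabla (bc_fun x).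
Proof.
move: x; apply: tens_ext => [x x'|x x'|b m].
- by rewrite nablaD bc_funD.
- by rewrite bc_funD nablaD.
- rewrite bc_funE !nabla_bcE -chom_nabla.
  by rewrite (bc_funD (tens phi (der b) m)) !bc_funE.
Qed.

Definition bc_hom : conn_hom (bc_ob M) (bc_ob N) :=
  ConnHom bc_fun_linear bc_fun_nabla.
End Morphism.

Fact bc_hom1 (M : MC A) : bc_hom (idmor M) = idmor (bc_ob M : MC B).
Proof.
by apply: chom_ext; apply: tens_ext => [x y|x y|b m] //;
  rewrite ?chomD //= bc_funE.
Qed.

Fact bc_homM (M N P : MC A) (g : mor N P) (f : mor M N) :
  bc_hom (compm g f) = compm (bc_hom g : @mor (MC B) _ _) (bc_hom f).
Proof.
by apply: chom_ext; apply: tens_ext => [x y|x y|b m];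
  rewrite ?chomD //= !bc_funE.
Qed.

Definition base_change : functor (MC A) (MC B) :=
  @Functor (MC A) (MC B) bc_ob (@bc_hom) bc_hom1 bc_homM.
End BaseChange.

Lemma base_change_comp (A B C : diff_alg R) (i : diff_mor A B)
    (j : diff_mor B C) (k : diff_mor A C) (M : MC A) :
  (forall a, j (i a) = k a) ->
  isomorphic (base_change j (base_change i M)) (base_change k M).
Proof.
move=> jik.
pose f0 c := tens_lift (fun b (m : M) => tens k (c * j b) m) : tensor i M -> _.
have f0bal c : balanced i (fun b (m : M) => tens k (c * j b) m).
  split=> [b b' m|b m m'|b a m]; rewrite ?rmorphD ?mulrDr ?tensDl ?tensDr //.
  by rewrite tensZ rmorphM mulrA; congr (tens k (_ * _) _); apply: jik.
have f0E c b m : f0 c (tens i b m) = tens k (c * j b) m.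
  exact: tens_liftE (f0bal c) _ _.
have f0D c : {morph f0 c : x y / x + y} by apply: tens_liftD (f0bal c).
have fbal : balanced j (fun c (x : tensor i M) => f0 c x).
  split=> [c c'|c x y|c b]; last 1 first.
  - apply: tens_ext => [x y|x y|b' m]; rewrite ?f0D ?scalerDr ?f0D //.
    by rewrite scale_tens !f0E rmorphM mulrA.
  - apply: tens_ext => [x y|x y|b m]; rewrite ?f0D //; first by rewrite addrACA.
    by rewrite !f0E mulrDl tensDl.
  - exact: f0D.
pose f := tens_lift f0 : tensor j (tensor i M) -> tensor k M.
have fE c b m : f (tens j c (tens i b m)) = tens k (c * j b) m.
  by rewrite /f (tens_liftE fbal).
have fD : {morph f : x y / x + y} by apply: tens_liftD fbal.
have gbal : balanced k (fun c (m : M) => tens j c (tens i 1 m)).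
  split=> [c c' m|c m m'|c a m]; rewrite ?tensDl ?tensDr //.
  rewrite tensZ [1 * _]mulrC -(scale_tens i) tensZ.
  by congr (tens j (_ * _) _); apply/esym/jik.
pose g := tens_lift (fun c (m : M) => tens j c (tens i 1 m)) :
  tensor k M -> tensor j (tensor i M).
have gE c m : g (tens k c m) = tens j c (tens i 1 m).
  exact: tens_liftE gbal _ _.
have gD : {morph g : x y / x + y} by apply: tens_liftD gbal.
have ext2 (N : zmodType) (h h' : tensor j (tensor i M) -> N) :
    {morph h : x y / x + y} -> {morph h' : x y / x + y} ->
    (forall c b m, h (tens j c (tens i b m)) = h' (tens j c (tens i b m))) ->
    h =1 h'.
  move=> hD h'D hh'; apply: tens_ext => // c.
  apply: (@tens_ext _ _ _ _ _ (fun x => h (tens j c x))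
    (fun x => h' (tens j c x))) => [x y|x y|] //; by rewrite tensDr ?hD ?h'D.
have flin : linear (f : base_change j (base_change i M) -> base_change k M).
  move=> d x y; rewrite fD; congr (_ + _); move: x.
  apply: ext2 => [x x'|x x'|c b m]; rewrite ?scalerDr ?fD ?scalerDr //.
  by rewrite scale_tens !fE scale_tens mulrA.
have glin : linear (g : base_change k M -> base_change j (base_change i M)).
  move=> d x y; rewrite gD; congr (_ + _); move: x.
  apply: tens_ext => [x x'|x x'|c m]; rewrite ?scalerDr ?gD ?scalerDr //.
  by rewrite scale_tens !gE scale_tens.
have fN (x : base_change j (base_change i M)) :
    f (nabla x) = nabla (f x : base_change k M).
  move: x; apply: ext2 => [x x'|x x'|c b m].
  - by rewrite nablaD fD.
  - by rewrite fD [LHS]nablaD.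
  - rewrite nabla_bcE nabla_bcE tensDr !fD !fE.
    by rewrite nabla_bcE derM dm_der tensDl addrA.
have gN (x : base_change k M) :
    g (nabla x) = nabla (g x : base_change j (base_change i M)).
  move: x; apply: tens_ext => [x x'|x x'|c m].
  - by rewrite nablaD gD.
  - by rewrite gD [LHS]nablaD.
  - rewrite nabla_bcE gD !gE nabla_bcE nabla_bcE.
    by rewrite der1 tens0l add0r.
split; exists (ConnHom flin fN) (ConnHom glin gN); apply: chom_ext => /=.
- apply: ext2 => [x y|x y|c b m] //=; first by rewrite fD gD.
  by rewrite fE gE -tensZ scale_tens mulr1.
- apply: tens_ext => [x y|x y|c m] //=; first by rewrite gD fD.
  by rewrite gE fE rmorph1 mulr1.
Qed.

End Connections.

Section ProjectiveLine.
Variable R : comNzRingType.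

Definition poly_theta (p : {poly R}) := 'X * p^`().

Fact poly_theta_linear : linear poly_theta.
Proof.
by move=> c p q; rewrite /poly_theta derivD derivZ mulrDr scalerAr.
Qed.

Fact poly_thetaM p q :
  poly_theta (p * q) = poly_theta p * q + p * poly_theta q.
Proof. by rewrite /poly_theta derivM mulrDr mulrA mulrCA. Qed.

Fact poly_thetaN_linear : linear (fun p => - poly_theta p).
Proof. by move=> c p q; rewrite poly_theta_linear opprD scalerN. Qed.

Fact poly_thetaNM p q :
  - poly_theta (p * q) = - poly_theta p * q + p * - poly_theta q.
Proof. by rewrite poly_thetaM opprD mulNr mulrN. Qed.

Definition diff_poly0 : diff_alg R := DiffAlg poly_theta_linear poly_thetaM.
(* R[y] with y = x^-1, so that theta y = - y *)
Definition diff_polyinf : diff_alg R := DiffAlg poly_thetaN_linear poly_thetaNM.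
Definition diff_lpoly : diff_alg R :=
  DiffAlg (@lpoly_theta_linear R) (@lpoly_thetaM R).
Definition diff_pseries : diff_alg R :=
  DiffAlg (@pseries_theta_linear R) (@pseries_thetaM R).
Definition diff_laurent : diff_alg R :=
  DiffAlg (@laurent_theta_linear R) (@laurent_thetaM R).

Lemma horner_alg_der (A : diff_alg R) (x : A) (d : {poly R} -> {poly R}) :
  linear d -> (forall p q, d (p * q) = d p * q + p * d q) ->
  horner_alg x (d 'X) = der x ->
  forall p, horner_alg x (d p) = der (horner_alg x p).
Proof.
move=> dl dM dX; pose P : diff_alg R := DiffAlg dl dM.
elim/poly_ind => [|p c IHp].
  by have /= -> := der0 P; rewrite rmorph0 der0.
have dD : {morph d : p q / p + q} := @derD _ P.
have dC : d c%:P = 0.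
  rewrite -[c%:P]mulr1 mul_polyC; have /= -> := @derZ _ P c 1.
  by have /= -> := der1 P; rewrite scaler0.
rewrite dD dC addr0 dM !rmorphD !rmorphM /= IHp dX horner_algX horner_algC.
by rewrite derD derM derZ der1 scaler0 addr0.
Qed.

Fact lpoly_theta_X d : lpoly_theta (lpXn R d) = lpXn R d *~ d.
Proof.
apply/val_inj/lcoefP => n; rewrite rmorphMz /=.
rewrite -[lmonom R d *~ d]scaler_int lcoefZ /=.
by case: eqP => [->|_]; rewrite ?mul0rz ?mulr0 ?mulr1.
Qed.

Fact horner_alg_alg (A : comAlgType R) (x : A) c : horner_alg x c%:A = c%:A.
Proof. by rewrite alg_polyC horner_algC. Qed.

Fact poly0_lpoly_der p :
  horner_alg (lpXn R 1) (poly_theta p) = lpoly_theta (horner_alg (lpXn R 1) p).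
Proof.
apply: (@horner_alg_der diff_lpoly _ _ poly_theta_linear poly_thetaM).
by rewrite /poly_theta derivX mulr1 horner_algX [RHS]lpoly_theta_X.
Qed.
Definition poly0_lpoly : diff_mor diff_poly0 diff_lpoly :=
  @DiffMor R diff_poly0 diff_lpoly (horner_alg (lpXn R 1))
    (@horner_alg_alg (lpoly R) _) poly0_lpoly_der.

Fact polyinf_lpoly_der p : horner_alg (lpXn R (- 1)) (- poly_theta p) =
  lpoly_theta (horner_alg (lpXn R (- 1)) p).
Proof.
apply: (@horner_alg_der diff_lpoly _ _ poly_thetaN_linear poly_thetaNM).
rewrite /poly_theta derivX mulr1 rmorphN /= horner_algX [RHS]lpoly_theta_X.
by rewrite mulrN1z.
Qed.
Definition polyinf_lpoly : diff_mor diff_polyinf diff_lpoly :=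
  @DiffMor R diff_polyinf diff_lpoly (horner_alg (lpXn R (- 1)))
    (@horner_alg_alg (lpoly R) _) polyinf_lpoly_der.

Definition lpoly_laurent : diff_mor diff_lpoly diff_laurent :=
  @DiffMor R diff_lpoly diff_laurent (\val : lpoly R -> laurent R)
    (fun _ => erefl) (fun _ => erefl).
Definition pseries_laurent : diff_mor diff_pseries diff_laurent :=
  @DiffMor R diff_pseries diff_laurent (\val : pseries R -> laurent R)
    (fun _ => erefl) (fun _ => erefl).

Fact poly0_pseries_der p :
  horner_alg (psX R) (poly_theta p) = pseries_theta (horner_alg (psX R) p).
Proof.
apply: (@horner_alg_der diff_pseries _ _ poly_theta_linear poly_thetaM).
rewrite /poly_theta derivX mulr1 horner_algX.
apply/val_inj/lcoefP => n /=.
by case: eqP => [->|_]; rewrite ?mul0rz.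
Qed.
Definition poly0_pseries : diff_mor diff_poly0 diff_pseries :=
  @DiffMor R diff_poly0 diff_pseries (horner_alg (psX R))
   (@horner_alg_alg (pseries R) _) poly0_pseries_der.

Section DiffMorComp.
Variables (A B C : diff_alg R) (g : diff_mor B C) (f : diff_mor A B).
Fact diff_mor_comp_alg c : (g \o f) c%:A = c%:A.
Proof. by rewrite /= !dm_alg. Qed.
Fact diff_mor_comp_der a : (g \o f) (der a) = der ((g \o f) a).
Proof. by rewrite /= !dm_der. Qed.
Definition diff_mor_comp : diff_mor A C :=
  @DiffMor R A C (g \o f) diff_mor_comp_alg diff_mor_comp_der.
End DiffMorComp.

Lemma poly0_laurentE p :
  lpoly_laurent (poly0_lpoly p) = pseries_laurent (poly0_pseries p).
Proof.
elim/poly_ind: p => [|p c IHp]; first by rewrite !rmorph0.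
rewrite !rmorphD !rmorphM IHp -alg_polyC; congr (_ * _ + _).
  by rewrite /= !horner_algX; apply: lcoefP.
by rewrite /= !horner_alg_alg.
Qed.

(* Coherent modules with logarithmic connection on P^1_R, by gluing. P^1_R is
   the union of Spec R[x] and Spec R[y] along Spec R[x, x^-1] (y = x^-1), and on
   the spectrum of a noetherian ring A coherent modules are the finitely
   generated A-modules, restriction to an open affine being base change. So an
   object is a pair of such modules, each with its nabla, together with a
   horizontal isomorphism between their restrictions to Spec R[x, x^-1]. *)
Record MClog_P1 := MClogP1 {
  log0 : MC diff_poly0;
  loginf : MC diff_polyinf;
  log_glue :
    iso (base_change poly0_lpoly log0) (base_change polyinf_lpoly loginf) }.

(* restriction to P^1_R minus {0, oo} *)
Definition MClog_P1_restr (L : MClog_P1) : MC diff_lpoly :=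
  base_change poly0_lpoly (log0 L).

Definition rs_lpoly (M : MC diff_lpoly) : Prop :=
  exists L : MClog_P1, isomorphic M (MClog_P1_restr L).

(* base change along R[[x]] -> R((x)) is the localization L[x^-1] *)
Definition rs_laurent (M : MC diff_laurent) : Prop :=
  exists L : MC diff_pseries, isomorphic M (base_change pseries_laurent L).

Definition MCrs_lpoly : category := full_subcategory rs_lpoly.
Definition MCrs_laurent : category := full_subcategory rs_laurent.

Lemma rs_base_change (M : MC diff_lpoly) :
  rs_lpoly M -> rs_laurent (base_change lpoly_laurent M).
Proof.
move=> [L ML]; exists (base_change poly0_pseries (log0 L)).
apply: isomorphic_trans (functor_isomorphic (base_change lpoly_laurent) ML) _.
pose k := diff_mor_comp lpoly_laurent poly0_lpoly.
apply: isomorphic_trans (base_change_comp (k := k) _ _) _ => //.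
apply/isomorphic_sym/base_change_comp => p.
exact/esym/poly0_laurentE.
Qed.

Definition r0 : functor MCrs_lpoly MCrs_laurent :=
  restrict_functor (F := base_change lpoly_laurent) rs_base_change.

End ProjectiveLine.

Section Ideals.
Variable A : comNzRingType.

Definition is_ideal (I : set A) : Prop :=
  [/\ I 0, forall a b, I a -> I b -> I (a + b) & forall a b, I b -> I (a * b)].

Definition maximal_ideal (m : set A) : Prop :=
  [/\ is_ideal m, m <> setT &
      forall J, is_ideal J -> m `<=` J -> J = m \/ J = setT].

(* A is local with maximal ideal m *)
Definition local_ring (m : set A) : Prop :=
  maximal_ideal m /\ forall m', maximal_ideal m' -> m' = m.

Definition noetherian : Prop :=
  forall I, is_ideal I -> exists n (e : 'I_n -> A),
    I = [set a | exists c : 'I_n -> A, a = \sum_(i < n) c i * e i].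

Definition ideal_mul (I J : set A) : set A :=
  [set a | exists n (f g : 'I_n -> A),
     [/\ forall i, I (f i), forall i, J (g i) & a = \sum_(i < n) f i * g i]].

Definition ideal_exp (I : set A) (n : nat) : set A :=
  iter n (ideal_mul I) setT.

(* A -> lim A / I ^ n is bijective: a point of the limit is the class of a
   sequence u with u n.+1 = u n mod I ^ n. *)
Definition adic_complete (I : set A) : Prop :=
  forall u : nat -> A, (forall n, ideal_exp I n (u n.+1 - u n)) ->
    exists! a, forall n, ideal_exp I n (u n - a).

End Ideals.

(* C -> A -> A / m is bijective *)
Definition residue_field_eq (C : fieldType) (A : comAlgType C) (m : set A) :=
  forall a : A, exists! c : C, m (a - c%:A).

(* Main.v *)
Require Import Defs.
From HB Require Import structures.
From mathcomp Require Import all_boot all_order all_algebra.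
From mathcomp Require Import boolp classical_sets fsbigop.
From mathcomp Require Import zify ring.
Set Implicit Arguments.
Unset Strict Implicit.
Unset Printing Implicit Defensive.
Import Order.TTheory GRing.Theory Num.Theory.
Local Open Scope ring_scope.
Local Open Scope classical_set_scope.

(* Over a complete local base, Hensel's lemma splits every vector killed by a
   monic polynomial in nabla into generalized eigenvectors ("homogeneous"
   vectors), whose exponents are the roots in C of the reduced polynomial;
   multiplication by x shifts the exponent by 1.  A connection over R[x, 1/x] is
   regular singular if and only if all its vectors are of this kind (global
   sections over the projective line form finitely generated modules), and one
   over R((x)) is generated by such vectors.  So the quasi-inverse of r_0 sends
   M to its R[x, 1/x]-submodule of nabla-integral vectors.  The counit and unit
   are bijective because a relation between homogeneous vectors with Laurent
   series coefficients splits into its homogeneous components. *)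

(** * Noetherian modules *)

Section Noetherian.
Variable R : comNzRingType.
Hypothesis R_noetherian : noetherian R.

(** The modules need be neither free nor flat over [R], so bases give way to generating families and
    their relations. Two devices carry the weight. A homogeneous vector of exponent [a] that some
    monic polynomial, with reduction nonzero at [a], sends into a nabla-stable set [Z] already lies
    in [Z]. With [Z] equal to x^k times a lattice, only finitely many monomials of a series matter,
    and x-adic separation turns the congruences into equalities. Extreme coefficients of relations
    form submodules of R^n, finitely generated because [R] is noetherian; this yields both that
    separation and the finiteness of global sections. Characteristic zero makes the integers inject
    into [C]: distinct powers of x then shift an exponent by distinct amounts, and far shifts of a
    finite set of roots avoid the set. Integrality is preserved by every horizontal map, so the
    quasi-inverse acts on arrows by restriction, without a choice of lattice. *)

Definition subspace (V : lmodType R) (U : set V) : Prop :=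
  [/\ U 0, forall u v, U u -> U v -> U (u + v) & forall c u, U u -> U (c *: u)].

Lemma subspace_sum (V : lmodType R) (U : set V) (I : Type) (r : seq I)
    (P : pred I) (F : I -> V) :
  subspace U -> (forall i, P i -> U (F i)) -> U (\sum_(i <- r | P i) F i).
Proof. by move=> [U0 UD _] UF; apply: (big_ind U). Qed.

Lemma subspaceB (V : lmodType R) (U : set V) u v :
  subspace U -> U u -> U v -> U (u - v).
Proof.
by move=> [_ UD UZ] Uu Uv; apply: UD => //; rewrite -scaleN1r; apply: UZ.
Qed.

(** Induction on [n]: the first coordinates of [U] form an ideal. Lifts [w] of its generators,
    together with generators of the part of [U] with zero first coordinate, generate [U]. *)
Lemma rV_submodule_fg n (U : set 'rV[R]_n) : subspace U ->
  exists q (g : 'I_q -> 'rV[R]_n), (forall i, U (g i)) /\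
    forall u, U u -> exists r : 'I_q -> R, u = \sum_(i < q) r i *: g i.
Proof.
elim: n U => [|n IHn] U Usub; have [U0 UD UZ] := Usub.
  exists 0%N, (fun=> 0); split=> [[]//|u _]; exists (fun=> 0).
  by rewrite big_ord0; apply/rowP => -[].
pose I : set R := [set c | exists2 u, U u & u 0 0 = c].
have I_ideal : is_ideal I.
  split=> [|_ _ [u Uu <-] [v Uv <-]|a _ [u Uu <-]].
  - by exists 0 => //; rewrite mxE.
  - by exists (u + v); [exact: UD|rewrite mxE].
  - by exists (a *: u); [exact: UZ|rewrite mxE].
have [p [e eI]] := R_noetherian I_ideal.
have Ie i : I (e i).
  rewrite eI; exists (fun j => (j == i)%:R).
  rewrite (bigD1 i) //= eqxx mul1r big1 ?addr0 // => j /negPf->.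
  by rewrite mul0r.
have /choice[w wP] : forall i, exists u, U u /\ u 0 0 = e i.
  by move=> i; have [u] := Ie i; exists u.
pose U' : set 'rV[R]_n := [set v | U (row_mx (0 : 'rV_1) v)].
have [|q [g [gU gP]]] := IHn U'.
  split=> [|u v|c u]; rewrite /U' /=.
  - by rewrite row_mx0.
  - by move=> ? ?; rewrite -[0]addr0 -add_row_mx; apply: UD.
  - by move=> ?; rewrite -[0](scaler0 _ c) -scale_row_mx; apply: UZ.
exists (p + q)%N, (fun i : 'I_(p + q) => match fintype.split i with
  | inl i => w i | inr j => row_mx (0 : 'rV_1) (g j) end); split.
  by move=> i; case: fintype.split => j; [have [] := wP j|exact: gU].
move=> u Uu; have Iu : I (u 0 0) by exists u.
move: (Iu); rewrite eI => -[c cE].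
pose v := u - \sum_(i < p) c i *: w i.
have Uv : U v.
  apply: subspaceB => //; apply: subspace_sum => // i _.
  by apply: UZ; have [] := wP i.
have v0 : v 0 0 = 0.
  rewrite !mxE summxE cE -sumrB big1 // => i _; rewrite mxE.
  by have [_ ->] := wP i; rewrite subrr.
have lv0 : @lsubmx R 1 1 n v = 0.
  apply/rowP => i; rewrite [LHS]mxE [RHS]mxE !ord1 -[RHS]v0.
  have -> : lshift n (0 : 'I_1) = 0 :> 'I_n.+1 by exact: val_inj.
  by [].
have vE : v = row_mx (0 : 'rV_1) (@rsubmx R 1 1 n v).
  by rewrite -lv0 (@hsubmxK R 1 1 n).
have [|d dE] := gP (@rsubmx R 1 1 n v).
  by rewrite /U' /= -vE.
exists (fun i : 'I_(p + q) => match fintype.split i with inl i =>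
  c i | inr j => d j end).
rewrite big_split_ord /=.
rewrite (eq_bigr (fun i => c i *: w i)) => [|i _]; last first.
  by rewrite (unsplitK (inl i)).
rewrite [X in _ + X](eq_bigr (fun i => d i *: row_mx (0 : 'rV_1) (g i)));
  last by move=> i _; rewrite (unsplitK (inr i)).
apply/eqP; rewrite addrC -subr_eq -/v vE dE; apply/eqP.
have row_lin k (f : 'I_k -> 'rV[R]_n) : row_mx (0 : 'rV_1) (\sum_i f i) =
    \sum_i row_mx (0 : 'rV_1) (f i).
  elim/big_rec2: _ => [|i x y _ <-]; first by rewrite row_mx0.
  by rewrite add_row_mx addr0.
rewrite row_lin; apply: eq_bigr => i _.
by rewrite scale_row_mx scaler0.
Qed.

End Noetherian.

(** * Complete local rings *)

Section ResidueMorphism.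
Variables (C : closedFieldType) (R : comAlgType C) (m : set R).
Hypotheses (R_local : local_ring m) (R_residue : residue_field_eq m).

(** [red a] is the unique [c] with [a - c%:A] in [m], and uniqueness makes it a morphism. From here
    on the local structure enters only through [red]. *)
Lemma residue_morphism : exists red : {rmorphism R -> C},
  (forall c, red c%:A = c) /\ m = [set a | red a = 0].
Proof.
have [[[m0 mD mM] mT _] _] := R_local.
have m1 : ~ m 1.
  move=> m1; apply: mT; apply/seteqP; split=> // a _.
  by rewrite -[a]mulr1; apply: mM.
have mN a : m a -> m (- a) by rewrite -mulN1r; apply: mM.
have /choice[f fP] : forall a, exists c : C, m (a - c%:A).
  by move=> a; have [c [mc _]] := R_residue a; exists c.
have fE a c : m (a - c%:A) -> f a = c.
  by have [d [_ dU]] := R_residue a => mc; rewrite -(dU _ mc) (dU _ (fP a)).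
have fA c : f c%:A = c by apply: fE; rewrite subrr.
have f_add : zmod_morphism f.
  move=> a b; apply: fE.
  have -> : a - b - (f a - f b)%:A = a - (f a)%:A - (b - (f b)%:A).
    by rewrite scalerBl; ring.
  by apply: mD (fP _) (mN _ (fP _)).
have f_mul : monoid_morphism f.
  split=> [|a b]; first by apply: fE; rewrite scale1r subrr.
  apply: fE; have -> : a * b - (f a * f b)%:A =
      b * (a - (f a)%:A) + (f a)%:A * (b - (f b)%:A).
    by rewrite -[(f a * f b)%:A]scalerA -[f a *: _]mulr_algl; ring.
  by apply: mD; apply: mM.
pose fa := GRing.isZmodMorphism.Build R C f f_add.
pose fm := GRing.isMonoidMorphism.Build R C f f_mul.
pose F : {rmorphism R -> C} := HB.pack f fa fm.
exists F; split=> //; apply/seteqP; split=> a /=.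
  by move=> ma; apply: fE; rewrite scale0r subr0.
by move=> fa0; have := fP a; rewrite [f a]fa0 scale0r subr0.
Qed.
End ResidueMorphism.

(** * Comaximality and Hensel lifting *)

Section Resultant.
Variables (aR rR : comNzRingType) (f : {rmorphism aR -> rR}).
(** Leading coefficients that survive [f] keep the sizes, so both Sylvester matrices have the same
    shape. *)
Lemma rmorph_resultant (p q : {poly aR}) :
  f (lead_coef p) != 0 -> f (lead_coef q) != 0 ->
  f (resultant p q) = resultant (map_poly f p) (map_poly f q).
Proof.
move=> p0 q0; rewrite /resultant /Sylvester_mx !size_map_poly_id0 //.
rewrite -det_map_mx map_col_mx; congr (\det (col_mx _ _));
  by apply: map_lin1_mx => v; rewrite map_poly_rV rmorphM /= map_rVpoly.
Qed.
End Resultant.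

Lemma ltn_pred_add2r b a c : (0 < b)%N ->
  ((a + b).-1 < (c + b).-1)%N = (a < c)%N.
Proof. by lia. Qed.

Section CompleteLocal.
Variables (C : closedFieldType) (R : comAlgType C) (red : {rmorphism R -> C}).
Hypothesis red_alg : forall c, red c%:A = c.
Let m : set R := [set a | red a = 0].
Hypothesis R_complete : adic_complete m.

Let I := ideal_exp m.

Let I_ideal n : is_ideal (I n).
Proof.
case: n => [|n]; first by split.
split.
- exists 0%N, (fun=> 0), (fun=> 0).
  by split=> [[]|[]|] //; rewrite big_ord0.
- move=> _ _ [p [f [g [fm gI ->]]]] [q [f' [g' [fm' gI' ->]]]].
  exists (p + q)%N.
  exists (fun i : 'I_(p + q) => match fintype.split i with
    | inl i => f i | inr j => f' j end).
  exists (fun i : 'I_(p + q) => match fintype.split i with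
    | inl i => g i | inr j => g' j end).
  split=> [i|i|]; [by case: fintype.split..|].
  rewrite big_split_ord /=; congr (_ + _); apply: eq_bigr => i _.
    by rewrite (unsplitK (inl i)).
  by rewrite (unsplitK (inr i)).
- move=> a _ [p [f [g [fm gI ->]]]]; exists p, (fun i => a * f i), g.
  split=> // [i|]; first by rewrite /m /= rmorphM fm mulr0.
  by rewrite mulr_sumr; apply: eq_bigr => i _; rewrite mulrA.
Qed.

Let I0 n : I n 0. Proof. by have [] := I_ideal n. Qed.
Let ID n a b : I n a -> I n b -> I n (a + b).
Proof. by have [_ h _] := I_ideal n; apply: h. Qed.
Let IM n a b : I n b -> I n (a * b).
Proof. by have [_ _ h] := I_ideal n; apply: h. Qed.
Let IN n a : I n a -> I n (- a).
Proof. by rewrite -mulN1r; apply: IM. Qed.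
Let I_sum n (J : Type) (r : seq J) (P : pred J) (F : J -> R) :
  (forall i, P i -> I n (F i)) -> I n (\sum_(i <- r | P i) F i).
Proof. by move=> IF; apply: (big_ind (I n)) => //; apply: ID. Qed.

Let I_mul n a b : m a -> I n b -> I n.+1 (a * b).
Proof.
by move=> ma Ib; exists 1%N, (fun=> a), (fun=> b); rewrite big_ord1.
Qed.

Let I_decr n a : I n.+1 a -> I n a.
Proof.
elim: n a => [a _|n IHn _ [p [f [g [fm gI ->]]]]]; first exact: Logic.I.
apply: I_sum => i _.
by apply: I_mul; [exact: fm|apply/IHn/gI].
Qed.

Let I1 a : I 1 a <-> red a = 0.
Proof.
split=> [[p [f [g [fm _ ->]]]]|ma].
  by rewrite rmorph_sum big1 // => i _; rewrite rmorphM fm mul0r.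
by rewrite -[a]mulr1; apply: I_mul.
Qed.

(** The uniqueness half of completeness: the constant sequence [a] converges both to [a] and to
    0. *)
Let I_sep a : (forall n, I n a) -> a = 0.
Proof.
move=> Ia; have [|b [_ bU]] := @R_complete (fun=> a).
  by move=> n; rewrite subrr; apply: I0.
rewrite -(bU a) => [|n]; last by rewrite subrr; apply: I0.
by apply/esym; rewrite -(bU 0) // => n; rewrite subr0; apply: Ia.
Qed.

Let I_lim (u : nat -> R) : (forall n, I n (u n.+1 - u n)) ->
  exists a, forall n, I n (u n - a).
Proof. by move=> /R_complete[a [aP _]]; exists a. Qed.

(** Geometric series: [c *: a] is [1 - d] with [d] in [m], and the partial sums of the [d ^+ i]
    converge to its inverse. *)
Lemma unit_of_red a : red a != 0 -> exists b, a * b = 1.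
Proof.
move=> a0; pose c := (red a)^-1; pose d := 1 - c *: a.
have md : m d.
  rewrite /m /d /= rmorphB rmorph1 -mulr_algl rmorphM red_alg.
  by rewrite mulVf // subrr.
have Id n : I n (d ^+ n).
  by elim: n => // n IHn; rewrite exprS; apply: I_mul.
have [n|b bP] := I_lim (u := fun n => \sum_(i < n) d ^+ i).
  by rewrite /= big_ord_recr /= addrAC subrr add0r; apply: Id.
have cab : c *: a * b = 1.
  apply/eqP; rewrite -subr_eq0; apply/eqP; apply: I_sep => n.
  have := bP n; set s := \sum_(i < n) _ => sb.
  have -> : c *: a * b - 1 = - (c *: a * (s - b)) - d ^+ n.
    have -> : d ^+ n = 1 - c *: a * s.
      rewrite -[LHS](subrK 1) subrX1 -/s (_ : d - 1 = - (c *: a)).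
        by rewrite mulNr addrC.
      by rewrite /d addrAC subrr add0r.
    by ring.
  by apply: ID; apply: IN => //; apply: IM.
by exists (c *: b); rewrite -scalerAr scalerAl.
Qed.

(** The resultant is a combination of [P] and [Q]. It reduces to the resultant of coprime
    polynomials, which is nonzero, so it is a unit. *)
Lemma comaximal (P Q : {poly R}) : P \is monic -> Q \is monic ->
  coprimep (map_poly red P) (map_poly red Q) ->
  exists U V, U * P + V * Q = 1.
Proof.
move=> Pm Qm PQ.
(* [resultant_in_ideal] wants both sizes above 1; a smaller monic polynomial is 1. *)
have [P1|P1] := leqP (size P) 1.
  exists 1, 0; rewrite mul1r mul0r addr0.
  have := Pm; rewrite (size1_polyC P1) monicE lead_coefC => /eqP->.
  by [].
have [Q1|Q1] := leqP (size Q) 1.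
  exists 0, 1; rewrite mul1r mul0r add0r.
  have := Qm; rewrite (size1_polyC Q1) monicE lead_coefC => /eqP->.
  by [].
have [[U V] _ /= UV] := resultant_in_ideal P1 Q1.
have : red (resultant P Q) != 0.
  rewrite rmorph_resultant ?(monicP Pm) ?(monicP Qm) ?rmorph1 ?oner_eq0 //.
  rewrite resultant_eq0 -leqNgt.
  by move: PQ; rewrite /coprimep => /eqP->.
move=> /unit_of_red[b rb]; exists (b *: U), (b *: V).
by rewrite -!scalerAl -scalerDr -UV -mul_polyC -polyCM mulrC rb.
Qed.

Let pI n (p : {poly R}) := forall i, I n p`_i.

Let pI0 n : pI n 0. Proof. by move=> i; rewrite coef0. Qed.
Let pID n p q : pI n p -> pI n q -> pI n (p + q).
Proof. by move=> Ip Iq i; rewrite coefD; apply: ID. Qed.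
Let pIN n p : pI n p -> pI n (- p).
Proof. by move=> Ip i; rewrite coefN; apply: IN. Qed.
Let pIM n p q : pI n q -> pI n (p * q).
Proof. by move=> Iq i; rewrite coefM; apply: I_sum => j _; apply: IM. Qed.
Let pI_mul n p q : map_poly red p = 0 -> pI n q -> pI n.+1 (p * q).
Proof.
move=> p0 Iq i; rewrite coefM; apply: I_sum => j _; apply: I_mul => //.
by rewrite /m /= -coef_map p0 coef0.
Qed.
Let pI_decr n p : pI n.+1 p -> pI n p.
Proof. by move=> Ip i; apply: I_decr. Qed.
Let pI1 p : pI 1 p <-> map_poly red p = 0.
Proof.
split=> [Ip|p0 i]; first by apply/polyP=> i; rewrite coef_map coef0; apply/I1.
by apply/I1; rewrite -coef_map p0 coef0.
Qed.
Let pI_le n k p : (k <= n)%N -> pI n p -> pI k p.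
Proof.
move=> kn; rewrite -(subnK kn); elim: (n - k)%N => // j IHj.
by rewrite addSn => /pI_decr.
Qed.

Let pI_sep p : (forall n, pI n p) -> p = 0.
Proof.
by move=> Ip; apply/polyP => i; rewrite coef0; apply: I_sep => n; apply: Ip.
Qed.

Let pI_lim d (u : nat -> {poly R}) : (forall n, size (u n) <= d)%N ->
  (forall n, pI n (u n.+1 - u n)) ->
  exists2 p : {poly R}, (size p <= d)%N & forall n, pI n (u n - p).
Proof.
move=> ud uI.
have /choice[a aP] : forall i, exists a, forall n, I n ((u n)`_i - a).
  by move=> i; apply: I_lim => n; rewrite -coefB; apply: uI.
exists (\poly_(i < d) a i); first exact: size_poly.
move=> n i; rewrite coefB coef_poly; case: ltnP => [//|di].
by rewrite nth_default ?subrr //; apply: leq_trans di.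
Qed.

(** Long division by a monic polynomial only multiplies coefficients of the dividend, so quotient
    and remainder stay in the ideal. *)
Let monic_div n (g D : {poly R}) : g \is monic -> pI n D ->
  exists q r : {poly R}, [/\ D = q * g + r, (size r < size g)%N, pI n q &
    pI n r].
Proof.
move=> gm; have [k] := ubnP (size D); elim: k D => // k IHk D Dk D_I.
have [Dg|gD] := ltnP (size D) (size g).
  by exists 0, D; rewrite mul0r add0r.
have g0 : (0 < size g)%N by rewrite size_poly_gt0 monic_neq0.
pose t := lead_coef D *: 'X^(size D - size g).
have It : pI n t.
  by move=> i; rewrite coefZ mulrC; apply: IM; apply: D_I.
have szt : (size (D - t * g)%R < size D)%N.
  have D0 : (0 < size D)%N by apply: leq_trans gD.
  rewrite -[X in (_ < X)%N]prednK // ltnS; apply/leq_sizeP => j jD.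
  rewrite coefB /t -scalerAl coefZ ['X^_ * g]mulrC coefMXn ifF; last by lia.
  have [jE|jE] := eqVneq j (size D).-1.
    rewrite jE (_ : _ - _ = (size g).-1)%N; last by lia.
    by move: gm; rewrite monicE /lead_coef => /eqP->; rewrite mulr1 subrr.
  have aux (a b : nat) : (b <= a)%N -> (a.-1 <= j)%N -> j != a.-1 ->
    (0 < a)%N -> (b <= j - (a - b))%N /\ (a <= j)%N by lia.
  have [gj Dj] := aux _ _ gD jD jE D0.
  by rewrite !nth_default ?mulr0 ?subrr.
have [||q [r [qr rg Iq Ir]]] := IHk (D - t * g).
- by apply: leq_trans szt _; rewrite -ltnS.
- by apply: pID => //; apply: pIN; rewrite mulrC; apply: pIM.
exists (q + t), r; split=> //; last exact: pID.
by rewrite mulrDl -addrA [t * g + r]addrC addrA -qr subrK.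
Qed.

Let emb (p : {poly C}) : {poly R} := map_poly (in_alg R) p.

Let embK p : map_poly red (emb p) = p.
Proof.
by rewrite /emb -map_poly_comp map_poly_id // => c _ /=; apply: red_alg.
Qed.

Let size_monic_red (p : {poly R}) : p \is monic ->
  size (map_poly red p) = size p.
Proof.
by move=> /monicP p1; rewrite size_map_poly_id0 // p1 rmorph1 oner_neq0.
Qed.

Let hensel_step n (P G H : {poly R}) (g h : {poly C}) : coprimep g h ->
  P \is monic -> G \is monic -> H \is monic ->
  map_poly red G = g -> map_poly red H = h -> map_poly red P = g * h ->
  pI n.+1 (P - G * H) ->
  exists G' H' : {poly R}, [/\ G' \is monic, H' \is monic,
    pI n.+1 (G' - G), pI n.+1 (H' - H) & pI n.+2 (P - G' * H')].
Proof.
move=> gh Pm Gm Hm Gg Hh Pgh PGHI.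
have gm : g \is monic by rewrite -Gg monic_map.
have hm : h \is monic by rewrite -Hh monic_map.
have [[u v] /= uv] := Bezout_eq1_coprimepP _ _ gh.
have egm : emb g \is monic by rewrite /emb monic_map.
have ehm : emb h \is monic by rewrite /emb monic_map.
have euv : emb u * emb g + emb v * emb h = 1.
  by rewrite /emb -!rmorphM -rmorphD uv rmorph1.
set D := P - G * H in PGHI.
have [q [r [qr rg Iq Ir]]] := monic_div egm (pIM (emb v) PGHI).
(* With [u g + v h = 1] and [r] the remainder of [v D] by [g], this gives [D = s g + r h]. The
   degree of [D] bounds that of [s], so [G + r] and [H + s] stay monic. *)
pose s := emb u * D + q * emb h.
have Is : pI n.+1 s.
  by apply: pID; [apply: pIM|rewrite mulrC; apply: pIM].
have sE : s * emb g + r * emb h = D.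
  transitivity (emb u * emb g * D + (q * emb g + r) * emb h).
    by rewrite /s; ring.
  by rewrite -qr -[RHS]mul1r -euv; ring.
have sg : size (emb g) = size G.
  by rewrite -(size_monic_red egm) embK -Gg size_monic_red.
have sh : size (emb h) = size H.
  by rewrite -(size_monic_red ehm) embK -Hh size_monic_red.
have sP : size P = (size G + size H).-1.
  by rewrite -(size_monic_red Pm) Pgh size_Mmonic ?monic_neq0 // -Gg -Hh
    !size_monic_red.
have G0 : (0 < size G)%N by rewrite size_poly_gt0 monic_neq0.
have H0 : (0 < size H)%N by rewrite size_poly_gt0 monic_neq0.
have sD : (size D < size P)%N.
  rewrite -[X in (_ < X)%N]prednK ?size_poly_gt0 ?monic_neq0 // ltnS.
  apply/leq_sizeP => j jP; rewrite /D coefB.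
  have sGH : size (G * H) = size P by rewrite size_monicM ?monic_neq0.
  have [jE|jE] := eqVneq j (size P).-1.
    have : G * H \is monic by rewrite monicMl.
    move: Pm; rewrite jE !monicE /lead_coef sGH => /eqP-> /eqP->.
    by rewrite subrr.
  have {jE}jP : (size P <= j)%N.
    have : ((size P).-1 < j)%N by rewrite ltn_neqAle eq_sym jE jP.
    by case: (size P).
  by rewrite !nth_default ?subrr ?sGH.
have ss : (size s < size H)%N.
  have [->|s0] := eqVneq s 0; first by rewrite size_poly0.
  have : (size (s * emb g)%R < size P)%N.
    rewrite -[s * _](addrK (r * emb h)) sE;
      apply: leq_ltn_trans (size_polyD _ _) _.
    rewrite gtn_max sD size_polyN /=.
    apply: leq_ltn_trans (size_polyMleq _ _) _.
    by rewrite sP sh ltn_pred_add2r // -sg.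
  by rewrite size_Mmonic // sP sg [(size G + _)%N]addnC ltn_pred_add2r.
exists (G + r), (H + s); split.
- by move: Gm; rewrite !monicE lead_coefDl // -sg.
- by move: Hm; rewrite !monicE lead_coefDl.
- by rewrite addrAC subrr add0r.
- by rewrite addrAC subrr add0r.
(* In each product of the new error one factor reduces to 0 and the other is in [I n.+1]. *)
have -> : P - (G + r) * (H + s) =
    - (r * s) - (G - emb g) * s - (H - emb h) * r.
  have -> : P = D + G * H by rewrite /D subrK.
  by rewrite -sE; ring.
have red_emb0 K k : map_poly red K = k -> map_poly red (K - emb k) = 0.
  by move=> Kk; rewrite rmorphB /= Kk embK subrr.
apply: pID; [apply: pID|]; apply: pIN.
- by apply: pI_mul => //; apply/pI1/(pI_le _ Ir).
- by apply: pI_mul => //; apply: red_emb0.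
- by apply: pI_mul => //; apply: red_emb0.
Qed.

(** Limit of [hensel_step] started at the constant lifts of [g] and [h]. The iterates keep the
    degrees of [g] and [h]; hence the limits are polynomials, and monic. *)
Lemma hensel (P : {poly R}) (g h : {poly C}) : P \is monic ->
  g \is monic -> h \is monic -> coprimep g h -> map_poly red P = g * h ->
  exists G H : {poly R}, [/\ G \is monic, H \is monic,
    map_poly red G = g, map_poly red H = h & P = G * H].
Proof.
move=> Pm gm hm gh Pgh.
pose good n (X : {poly R} * {poly R}) := [/\ X.1 \is monic, X.2 \is monic,
  map_poly red X.1 = g, map_poly red X.2 = h & pI n.+1 (P - X.1 * X.2)].
have pI_red n K K' : pI n.+1 (K' - K) -> map_poly red K' = map_poly red K.
  move=> Ik; apply/eqP; rewrite -subr_eq0 -rmorphB; apply/eqP/pI1.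
  exact: pI_le Ik.
have /choice[F FP] : forall nX, exists Y, good nX.1 nX.2 ->
    [/\ good nX.1.+1 Y, pI nX.1.+1 (Y.1 - nX.2.1) &
        pI nX.1.+1 (Y.2 - nX.2.2)].
  case=> n [G H] /=; have [[/= Gm Hm Gg Hh I_n]|ng] := pselect (good n (G, H)).
    have [G' [H' [G'm H'm IG IH IGH]]] := hensel_step gh Pm Gm Hm Gg Hh Pgh I_n.
    exists (G', H') => _; split=> //; split=> //=.
      by rewrite (pI_red _ _ _ IG).
    by rewrite (pI_red _ _ _ IH).
  by exists 0.
pose u := fix u n := if n is k.+1 then F (k, u k) else (emb g, emb h).
have u_good n : good n (u n).
  elim: n => [|n IHn] /=; last by have [] := FP (n, u n) IHn.
  split; rewrite /= ?embK ?/emb ?monic_map //.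
  by apply/pI1; rewrite rmorphB rmorphM /= !embK Pgh subrr.
have uS n : pI n.+1 ((u n.+1).1 - (u n).1) /\ pI n.+1 ((u n.+1).2 - (u n).2).
  by have [] := FP (n, u n) (u_good n).
have [|n|G sG GP] := @pI_lim (size g) (fun n => (u n).1).
- by move=> n; have [um _ <- _ _] := u_good n; rewrite size_monic_red.
- by apply: pI_decr; have [] := uS n.
have [|n|H sH HP] := @pI_lim (size h) (fun n => (u n).2).
- by move=> n; have [_ um _ <- _] := u_good n; rewrite size_monic_red.
- by apply: pI_decr; have [] := uS n.
have lim_red (K : {poly R}) (v : nat ->
  {poly R}) (k : {poly C}) : k \is monic ->
    (size K <= size k)%N -> (forall n, pI n (v n - K)) ->
    (forall n, v n \is monic) -> (forall n, map_poly red (v n) = k) ->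
    K \is monic /\ map_poly red K = k.
  move=> km sK vK vm vk.
  have Kk : map_poly red K = k by rewrite -(vk 1) (pI_red 0 _ _ (vK 1)).
  have sKk : size K = size k.
    by apply/eqP; rewrite eqn_leq sK -Kk size_poly.
  split=> //; rewrite monicE; apply/eqP/subr0_eq/I_sep => n.
  have := vm n; rewrite monicE => /eqP vn1.
  have svn : size (v n) = size K by rewrite sKk -(vk n) size_monic_red.
  rewrite -opprB -[X in X - _]vn1 /lead_coef svn -coefB.
  by apply: IN; apply: vK.
have [Gm Gg] : G \is monic /\ map_poly red G = g.
  by apply: (lim_red _ (fun n => (u n).1)) => // n; have [] := u_good n.
have [Hm Hh] : H \is monic /\ map_poly red H = h.
  by apply: (lim_red _ (fun n => (u n).2)) => // n; have [] := u_good n.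
exists G, H; split=> //; apply/subr0_eq/pI_sep => n.
have [_ _ _ _ /pI_decr IPn] := u_good n.
have -> : P - G * H = (P - (u n).1 * (u n).2) + (u n).2 * ((u n).1 - G)
    + G * ((u n).2 - H) by ring.
by apply: pID; [apply: pID => //|]; apply: pIM.
Qed.

End CompleteLocal.

Lemma monic_comp_XaddC (R : comNzRingType) (P : {poly R}) c :
  P \is monic -> P \Po ('X + c%:P) \is monic.
Proof.
elim/poly_ind: P => [|p d IHp];
  first by rewrite monicE lead_coef0 eq_sym oner_eq0.
have [->|p0] := eqVneq p 0.
  by rewrite mul0r add0r comp_polyC.
have sp : (size d%:P < size (p * 'X)%R)%N.
  by rewrite size_mulX // ltnS (leq_trans (size_polyC_leq1 d)) // size_poly_gt0.
rewrite monicE lead_coefDl // lead_coefMX -monicE => /IHp pm.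
have cm : ('X + c%:P : {poly R}) \is monic by rewrite -[c]opprK polyCN
  monicXsubC.
rewrite comp_poly_MXaddC monicE lead_coefDl -?monicE ?monicMl //.
rewrite size_monicM ?monic_neq0 // size_XaddC addn2 ltnS.
rewrite (leq_trans (size_polyC_leq1 d)) // size_poly_gt0 monic_neq0 //.
Qed.

Arguments nabla {R A M} m : rename.

(** * Polynomials in nabla and generalized eigenvectors *)

Section Action.
Variables (R : comNzRingType) (A : diff_alg R) (M : conn A).
Implicit Types (P Q : {poly R}) (v : M).

Lemma nabla_sum (I : Type) (r : seq I) (p : pred I) (F : I -> M) :
  nabla (\sum_(i <- r | p i) F i) = \sum_(i <- r | p i) nabla (F i).
Proof. exact: (big_morph _ (@nablaD _ _ M) (conn_nabla0 M)). Qed.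

Lemma iter_nablaD n u v :
  iter n nabla (u + v) = iter n nabla u + iter n nabla v :> M.
Proof. by elim: n => //= n ->; rewrite nablaD. Qed.

Definition act P v : M := \sum_(i < size P) (P`_i)%:A *: iter i nabla v.

Lemma act_bound n P v : (size P <= n)%N ->
  act P v = \sum_(i < n) (P`_i)%:A *: iter i nabla v.
Proof.
move=> Pn; rewrite /act (big_ord_widen n (fun i =>
  (P`_i)%:A *: iter i nabla v)) //.
rewrite big_mkcond; apply: eq_bigr => i _; case: ltnP => // Pi.
by rewrite nth_default // scale0r scale0r.
Qed.

Lemma actDr P : {morph act P : u v / u + v}.
Proof.
move=> u v; rewrite /act -big_split; apply: eq_bigr => i _.
by rewrite iter_nablaD scalerDr.
Qed.

Lemma act0r P : act P 0 = 0.
Proof. by apply: (addrI (act P 0)); rewrite -actDr !addr0. Qed.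

Lemma actNr P v : act P (- v) = - act P v.
Proof. by apply: (addrI (act P v)); rewrite -actDr !subrr act0r. Qed.

Lemma act_sumr P (I : Type) (r : seq I) (p : pred I) (F : I -> M) :
  act P (\sum_(i <- r | p i) F i) = \sum_(i <- r | p i) act P (F i).
Proof. exact: (big_morph _ (actDr P) (act0r P)). Qed.

Lemma actDl P Q v : act (P + Q) v = act P v + act Q v.
Proof.
pose n := maxn (size P) (size Q).
rewrite !(@act_bound n) ?leq_maxl ?leq_maxr ?size_polyD // -big_split.
by apply: eq_bigr => i _; rewrite coefD !scalerDl.
Qed.

Lemma act0l v : act 0 v = 0.
Proof. by rewrite /act size_poly0 big_ord0. Qed.

Lemma actNl P v : act (- P) v = - act P v.
Proof. by apply: (addrI (act P v)); rewrite -actDl !subrr act0l. Qed.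

Lemma act_suml (I : Type) (r : seq I) (p : pred I) (F : I -> {poly R}) v :
  act (\sum_(i <- r | p i) F i) v = \sum_(i <- r | p i) act (F i) v.
Proof. by apply: (big_morph (act^~ v) _ (act0l v)) => P Q; apply: actDl. Qed.

Lemma actZl c P v : act (c *: P) v = c%:A *: act P v.
Proof.
rewrite (@act_bound (size P)) ?size_scale_leq // scaler_sumr.
by apply: eq_bigr => i _; rewrite coefZ !scalerA -scalerAl mul1r scalerA.
Qed.

Lemma actC c v : act c%:P v = c%:A *: v.
Proof.
by rewrite (@act_bound 1) ?size_polyC_leq1 // big_ord1 coefC.
Qed.

Lemma act1 v : act 1 v = v.
Proof. by rewrite -[1]/(1%:P) actC !scale1r. Qed.

Lemma actXn n v : act 'X^n v = iter n nabla v.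
Proof.
rewrite (@act_bound n.+1) ?size_polyXn // big_ord_recr /= coefXn eqxx !scale1r.
by rewrite big1 ?add0r // => i _; rewrite coefXn ltn_eqF // scale0r scale0r.
Qed.

Lemma actX v : act 'X v = nabla v.
Proof. by rewrite -['X]expr1 actXn. Qed.

Lemma act_MX P v : act (P * 'X) v = act P (nabla v).
Proof.
rewrite (@act_bound (size P).+1); last first.
  by rewrite (leq_trans (size_polyMleq _ _)) // size_polyX addn2.
rewrite big_ord_recl coefMX /= scale0r scale0r add0r; apply: eq_bigr => i _.
by rewrite coefMX /= -iterSr.
Qed.

Lemma act_nabla P v : act P (nabla v) = nabla (act P v).
Proof.
rewrite /act nabla_sum; apply: eq_bigr => i _.
by rewrite -iterSr nablaZ.
Qed.

Lemma actZr P c v : act P (c%:A *: v) = c%:A *: act P v.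
Proof.
rewrite /act scaler_sumr; apply: eq_bigr => i _.
have -> : iter i nabla (c%:A *: v) = c%:A *: iter i nabla v.
  by elim: (nat_of_ord i) => //= n ->; rewrite nablaZ.
by rewrite !scalerA mulrC.
Qed.

Lemma actM P Q v : act (P * Q) v = act P (act Q v).
Proof.
elim/poly_ind: P v => [|P c IHP] v; first by rewrite mul0r !act0l.
rewrite mulrDl !actDl mulrAC !act_MX IHP mul_polyC actZl actC.
by rewrite act_nabla.
Qed.

Lemma act_comm P Q v : act P (act Q v) = act Q (act P v).
Proof. by rewrite -!actM mulrC. Qed.

(** By Leibniz, nabla on [u *: v] is nabla + n on [v]. With [u = x ^ n] this is the shift of
    exponents. *)
Lemma act_shift (u : A) n P v : der u = u *~ n ->
  act P (u *: v) = u *: act (P \Po ('X + n%:~R%:P)) v.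
Proof.
move=> du; elim/poly_ind: P v => [|P c IHP] v.
  by rewrite comp_poly0 !act0l scaler0.
rewrite comp_poly_MXaddC !actDl act_MX nabla_leibniz du actM !actC.
have -> : u *~ n *: v + u *: nabla v = u *: act ('X + n%:~R%:P) v.
  rewrite actDl actX actC scalerDr addrC scaler_int.
  by rewrite scalerA mulrzAr mulr1.
by rewrite IHP scalerDr; congr (_ + _); rewrite !scalerA mulrC.
Qed.

End Action.

Lemma chom0 (R : comNzRingType) (A : diff_alg R) (M N : conn A)
  (f : conn_hom M N) : f 0 = 0.
Proof. by apply: (addrI (f 0)); rewrite -chomD !addr0. Qed.

Lemma chom_sum (R : comNzRingType) (A : diff_alg R) (M N : conn A)
    (f : conn_hom M N) (I : Type) (r : seq I) (p : pred I) (F : I -> M) :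
  f (\sum_(i <- r | p i) F i) = \sum_(i <- r | p i) f (F i).
Proof. exact: (big_morph _ (chomD f) (chom0 f)). Qed.

Lemma act_hom (R : comNzRingType) (A : diff_alg R) (M N : conn A)
  (f : conn_hom M N) P v : f (act P v) = act P (f v).
Proof.
rewrite /act chom_sum; apply: eq_bigr => i _.
rewrite chomZ; congr (_ *: _).
by elim: (nat_of_ord i) => //= n <-; rewrite chom_nabla.
Qed.

Lemma sum_by_value (V : zmodType) (T J : eqType) (a : J -> T) (r : seq J)
    (F : J -> V) :
  \sum_(i <- r) F i =
  \sum_(t <- undup (map a r)) \sum_(i <- r | a i == t) F i.
Proof.
rewrite (exchange_big_dep xpredT) //=; apply: eq_big_seq => i ir.
rewrite (eq_bigl (pred1 (a i))) => [|t]; last by rewrite /= eq_sym.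
by rewrite -big_filter filter_pred1_uniq ?undup_uniq ?mem_undup ?map_f
  ?big_seq1.
Qed.

Section NablaStable.
Variables (R : comNzRingType) (A : diff_alg R) (M : conn A).
Implicit Types (P Q : {poly R}) (v w : M) (Z : set M).

(** Scalars from [R] only: the x-adic steps of a lattice are not stable under R((x)). *)
Definition nabla_stable Z : Prop :=
  [/\ Z 0, forall u v, Z u -> Z v -> Z (u + v),
      forall c u, Z u -> Z (c%:A *: u) & forall u, Z u -> Z (nabla u)].

Lemma nabla_stable0 : nabla_stable [set 0].
Proof.
split=> //= [u v -> ->|c u ->|u ->]; first by rewrite addr0.
  by rewrite scaler0.
by rewrite conn_nabla0.
Qed.

Lemma nabla_stableN Z u : nabla_stable Z -> Z u -> Z (- u).
Proof.
move=> [_ _ ZZ _] Zu; have := ZZ (-1) u Zu.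
by rewrite scaleN1r scaleN1r.
Qed.

Lemma nabla_stable_sum Z (I : Type) (r : seq I) (p : pred I) (F : I -> M) :
  nabla_stable Z -> (forall i, p i -> Z (F i)) -> Z (\sum_(i <- r | p i) F i).
Proof. by move=> [Z0 ZD _ _] ZF; apply: (big_ind Z). Qed.

Lemma nabla_stable_act Z P v : nabla_stable Z -> Z v -> Z (act P v).
Proof.
move=> Zs Zv; have [_ _ ZZ ZN] := Zs.
apply: nabla_stable_sum => // i _; apply: ZZ.
by elim: (nat_of_ord i) => //= n; apply: ZN.
Qed.

Definition nabla_integral v := exists2 P, P \is monic & act P v = 0.

Lemma nabla_integral0 : nabla_integral 0.
Proof. by exists 1; rewrite ?monic1 ?act0r. Qed.

Lemma nabla_integralD u v : nabla_integral u -> nabla_integral v ->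
  nabla_integral (u + v).
Proof.
move=> [P Pm Pu] [Q Qm Qv]; exists (P * Q); first by rewrite monicMl.
by rewrite actDr actM act_comm Pu act0r actM Qv act0r addr0.
Qed.

Lemma nabla_integralZ c v : nabla_integral v -> nabla_integral (c%:A *: v).
Proof. by move=> [P Pm Pv]; exists P => //; rewrite actZr Pv scaler0. Qed.

Lemma nabla_integral_nabla v : nabla_integral v -> nabla_integral (nabla v).
Proof. by move=> [P Pm Pv]; exists P => //;
  rewrite act_nabla Pv conn_nabla0. Qed.

Lemma comp_XsubX (P : {poly R}) c :
  (P \Po ('X - c%:P)) \Po ('X + c%:P) = P.
Proof. by have := comp_polyXaddC_K P (- c); rewrite polyCN opprK. Qed.

Lemma nabla_integral_shift (u : A) n v : der u = u *~ n -> nabla_integral v ->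
  nabla_integral (u *: v).
Proof.
move=> du [P Pm Pv]; exists (P \Po ('X - n%:~R%:P)).
  by rewrite -polyCN monic_comp_XaddC.
by rewrite (act_shift _ _ du) comp_XsubX Pv scaler0.
Qed.

(* The submodule of the combinations of the [w i] that lie in R[nabla] v is
   finitely generated, so a power of nabla is a combination of smaller ones. *)
Lemma monic_act_of_span Z p (w : 'I_p -> M) v : noetherian R ->
  nabla_stable Z ->
  (forall k, exists c : 'I_p -> R,
    Z (iter k nabla v - \sum_i (c i)%:A *: w i)) ->
  exists2 P, P \is monic & Z (act P v).
Proof.
move=> R_noetherian Zs vw; have [Z0 ZD ZZ ZN] := Zs.
have ZB u u' : Z u -> Z u' -> Z (u - u').
  by move=> Zu /(nabla_stableN Zs); apply: ZD.
pose comb (c : 'rV[R]_p) := \sum_i (c 0 i)%:A *: w i.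
have combD c d : comb (c + d) = comb c + comb d.
  by rewrite -big_split; apply: eq_bigr => i _; rewrite mxE !scalerDl.
have combZ r c : comb (r *: c) = r%:A *: comb c.
  rewrite scaler_sumr; apply: eq_bigr => i _.
  by rewrite mxE scalerA -scalerAl mul1r scalerA.
have comb0 : comb 0 = 0.
  by rewrite /comb big1 // => i _; rewrite mxE !scale0r.
pose U : set 'rV[R]_p := [set c | exists d, Z (act d v - comb c)].
have [|q [g [gU gP]]] := rV_submodule_fg R_noetherian (U := U).
  split=> [|c c' [d dc] [d' dc']|r c [d dc]].
  - by exists 0; rewrite act0l comb0 subr0.
  - by exists (d + d'); rewrite actDl combD opprD addrACA; apply: ZD.
  - by exists (r *: d); rewrite actZl combZ -scalerBr; apply: ZZ.
have /choice[d dP] := gU.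
(* [k] exceeds the degree of every [d j], so that subtracting combinations of them from ['X^k]
   leaves it monic. *)
pose k := \max_(j < q) size (d j).
have [c kc] := vw k.
have cU : U (\row_i c i).
  exists 'X^k; rewrite actXn.
  by rewrite /comb; under eq_bigr do rewrite mxE.
have [r cr] := gP _ cU.
have sdr : (size (\sum_j r j *: d j)%R <= k)%N.
  apply: leq_trans (size_sum _ _ _) _; apply/bigmax_leqP => j _.
  apply: leq_trans (size_scale_leq _ _) _.
  exact: (leq_bigmax j).
exists ('X^k - \sum_j r j *: d j).
  by rewrite monicE lead_coefDl ?lead_coefXn // size_polyN size_polyXn ltnS.
rewrite actDl actNl actXn act_suml.
have -> : iter k nabla v - \sum_i act (r i *: d i) v =
    (iter k nabla v - \sum_i (c i)%:A *: w i) -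
    \sum_j (r j)%:A *: (act (d j) v - comb (g j)).
  have -> : \sum_i (c i)%:A *: w i = \sum_j (r j)%:A *: comb (g j).
    transitivity (comb (\row_i c i)).
      by apply: eq_bigr => i _; rewrite mxE.
    rewrite cr (big_morph _ combD comb0).
    by apply: eq_bigr => j _; rewrite combZ.
  have -> : \sum_j (r j)%:A *: (act (d j) v - comb (g j)) =
      \sum_j act (r j *: d j) v - \sum_j (r j)%:A *: comb (g j).
    by rewrite -sumrB; apply: eq_bigr => j _; rewrite actZl scalerBr.
  by rewrite opprB addrA subrK.
apply: (ZB); first exact: kc.
apply: nabla_stable_sum => [//|j _]; apply: ZZ; exact: dP.
Qed.

End NablaStable.

(** * Homogeneous vectors and their independence *)

Section Homogeneous.
Variables (C : closedFieldType) (R : comAlgType C) (red : {rmorphism R -> C}).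
Hypothesis red_alg : forall c, red c%:A = c.
Hypothesis R_complete : adic_complete [set a | red a = 0].
Variables (A : diff_alg R) (M : conn A).
Implicit Types (P Q : {poly R}) (v w : M) (a b : C) (Z : set M).

(** Only the reduction of [P] is a power of ['X - a%:P]: over [R] the eigenvalues may be
    nonconstant, and [P] need not split. *)
Definition homog a v := exists k P,
  [/\ P \is monic, map_poly red P = ('X - a%:P) ^+ k & act P v = 0].

(* [a] does not occur among the exponents of [v] modulo [Z]. *)
Definition away a Z v := exists P,
  [/\ P \is monic, (map_poly red P).[a] != 0 & Z (act P v)].

Lemma homog_integral a v : homog a v -> nabla_integral v.
Proof. by move=> [k [P [Pm _ Pv]]]; exists P. Qed.

Lemma homog0 a : homog a 0.
Proof. by exists 0%N, 1; rewrite monic1 rmorph1 expr0 act0r. Qed.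

Lemma homogD a u v : homog a u -> homog a v -> homog a (u + v).
Proof.
move=> [k [P [Pm Pa Pu]]] [l [Q [Qm Qa Qv]]]; exists (k + l)%N, (P * Q); split.
- by rewrite monicMl.
- by rewrite rmorphM /= Pa Qa exprD.
- by rewrite actDr actM act_comm Pu act0r actM Qv act0r addr0.
Qed.

Lemma homogZ a c v : homog a v -> homog a (c%:A *: v).
Proof.
by move=> [k [P [Pm Pa Pv]]]; exists k, P; rewrite actZr Pv scaler0.
Qed.

Lemma homogN a v : homog a v -> homog a (- v).
Proof. by move=> /(homogZ (- 1)); rewrite scaleN1r scaleN1r. Qed.

Lemma homog_sum a (I : Type) (r : seq I) (p : pred I) (F : I -> M) :
  (forall i, p i -> homog a (F i)) -> homog a (\sum_(i <- r | p i) F i).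
Proof. by move=> IF; apply: big_ind => //; [exact: homog0|exact: homogD]. Qed.

Lemma homog_shift (u : A) n a v : der u = u *~ n -> homog a v ->
  homog (a + n%:~R) (u *: v).
Proof.
move=> du [k [P [Pm Pa Pv]]]; exists k, (P \Po ('X - n%:~R%:P)); split.
- by rewrite -polyCN monic_comp_XaddC.
- rewrite map_comp_poly Pa rmorphB /= map_polyX map_polyC /= rmorph_int.
  rewrite rmorphXn rmorphB /= comp_polyX comp_polyC.
  by rewrite polyCD opprD addrA addrAC.
- by rewrite (act_shift _ _ du) comp_XsubX Pv scaler0.
Qed.

Lemma away_sub a Z v : nabla_stable Z -> Z v -> away a Z v.
Proof. by move=> Zs Zv; exists 1;
  rewrite monic1 rmorph1 hornerC oner_eq0 act1. Qed.

Lemma awayD a Z u v : nabla_stable Z ->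
  away a Z u -> away a Z v -> away a Z (u + v).
Proof.
move=> Zs [P [Pm Pa Pu]] [Q [Qm Qa Qv]]; exists (P * Q); split.
- by rewrite monicMl.
- by rewrite rmorphM hornerM mulf_neq0.
- rewrite actDr actM act_comm [act (P * Q) v]actM.
  by case: (Zs) => _ ZD _ _; apply: ZD; apply: nabla_stable_act.
Qed.

Lemma awayZ a Z c v : nabla_stable Z -> away a Z v -> away a Z (c%:A *: v).
Proof.
move=> [_ _ ZZ _] [P [Pm Pa Pv]]; exists P; split=> //.
by rewrite actZr; apply: ZZ.
Qed.

Lemma away_sum a Z (I : Type) (r : seq I) (p : pred I) (F : I -> M) :
  nabla_stable Z -> (forall i, p i -> away a Z (F i)) ->
  away a Z (\sum_(i <- r | p i) F i).
Proof.
move=> Zs; apply: (big_ind (away a Z)); last by move=> u v; apply: awayD.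
by apply: away_sub => //; case: Zs.
Qed.

Lemma homog_away a b Z v : nabla_stable Z -> a != b -> homog b v -> away a Z v.
Proof.
move=> [Z0 _ _ _] ab [k [P [Pm Pb Pv]]]; exists P; split; rewrite ?Pv //.
by rewrite Pb horner_exp !hornerE expf_neq0 // subr_eq0.
Qed.

(** The two polynomials have coprime reductions, so [1 = U P + V Q] over [R]; applied to [v], only
    [V Q v] remains, and it is in [Z]. *)
Lemma homog_away_sub a Z v : nabla_stable Z -> homog a v -> away a Z v -> Z v.
Proof.
move=> Zs [k [P [Pm Pa Pv]]] [Q [Qm Qa Qv]].
have [|U [V UV]] := comaximal red_alg R_complete Pm Qm.
  rewrite Pa coprimep_sym coprimep_expr // coprimep_XsubC.
  by rewrite /root.
rewrite -[v]act1 -UV actDl actM Pv act0r add0r actM.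
exact: nabla_stable_act.
Qed.

Lemma homog_away0 a v : homog a v -> away a [set 0] v -> v = 0.
Proof. by move=> va /(homog_away_sub (nabla_stable0 M) va). Qed.

(** Induction on the number of roots of the reduced polynomial. Hensel separates the factor with
    sole root [a] from the rest, and [1 = U G + V H] writes [v] as a vector killed by [H] plus a
    homogeneous one. *)
Lemma homog_ind (X : set M) : X 0 -> (forall u v, X u -> X v -> X (u + v)) ->
  (forall a v, homog a v -> X v) -> forall v, nabla_integral v -> X v.
Proof.
move=> X0 XD Xh v [P Pm Pv].
have [rs] := closed_field_poly_normal (map_poly red P).
rewrite (monicP _) ?monic_map // scale1r.
have [n] := ubnP (size rs); elim: n rs P v Pm Pv => // n IHn [|a rs] P v Pm Pv.
  move=> _; rewrite big_nil => P1.
  have : size P = 1%N.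
    have := congr1 (fun p : {poly C} => size p) P1; rewrite size_poly1.
    by rewrite size_map_poly_id0 // (monicP Pm) rmorph1 oner_neq0.
  move=> sP; have := Pm; rewrite (size1_polyC (eq_leq sP)) monicE lead_coefC.
  move=> /eqP P01; move: Pv.
  by rewrite (size1_polyC (eq_leq sP)) P01 act1 => ->.
rewrite ltnS => sn Prs.
pose g : {poly C} := \prod_(z <- a :: rs | z == a) ('X - z%:P).
pose h : {poly C} := \prod_(z <- a :: rs | z != a) ('X - z%:P).
have gE : exists k, g = ('X - a%:P) ^+ k.
  exists (count (pred1 a) (a :: rs)); rewrite /g.
  rewrite (eq_bigr (fun=> 'X - a%:P)) => [|z /eqP->//].
  by rewrite big_const_seq -Monoid.iteropE.
have gm : g \is monic by apply: monic_prod => z _; apply: monicXsubC.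
have hm : h \is monic by apply: monic_prod => z _; apply: monicXsubC.
have gh : coprimep g h.
  have [k ->] := gE; rewrite coprimep_sym coprimep_expr // coprimep_XsubC.
  rewrite /h -big_filter root_prod_XsubC mem_filter eqxx.
  by [].
have Pgh : map_poly red P = g * h by rewrite Prs (bigID (pred1 a)).
have [G [H [Gm Hm Gg Hh PGH]]] := hensel red_alg R_complete Pm gm hm gh Pgh.
have [|U [V UV]] := comaximal red_alg R_complete Gm Hm.
  by rewrite Gg Hh.
rewrite -[v]act1 -UV actDl; apply: (XD).
  apply: (IHn [seq z <- a :: rs | z != a] H); rewrite ?Hh //.
  - have HUG : H * (U * G) = U * P by rewrite PGH; ring.
    by rewrite -actM HUG actM Pv act0r.
  - rewrite /= eqxx /= (leq_ltn_trans _ sn) // size_filter.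
    exact: count_size.
  - by rewrite /h -big_filter.
apply: (Xh a); have [k gk] := gE; exists k, G; split; rewrite ?Gg //.
by rewrite -actM mulrCA -PGH actM Pv act0r.
Qed.

Lemma homog_decomp v : nabla_integral v -> exists d : seq (C * M),
  (forall p, p \in d -> homog p.1 p.2) /\ v = \sum_(p <- d) p.2.
Proof.
move: v; apply: homog_ind => [|_ _ [d [dh ->]] [d' [dh' ->]]|a v av].
- by exists [::]; rewrite big_nil.
- exists (d ++ d'); rewrite big_cat; split=> // p.
  by rewrite mem_cat => /orP[/dh|/dh'].
- by exists [:: (a, v)]; rewrite big_seq1; split=> // p; rewrite inE => /eqP->.
Qed.

(** The part of exponent [b] is minus the sum of the others, hence homogeneous of exponent [b] and
    away from [b] at once. *)
Lemma homog_indep (J : eqType) (r : seq J) (a : J -> C) (w : J -> M) :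
  (forall i, i \in r -> homog (a i) (w i)) -> \sum_(i <- r) w i = 0 ->
  forall b, \sum_(i <- r | a i == b) w i = 0.
Proof.
move=> aw w0 b; have Z0 := nabla_stable0 M; set y := \sum_(i <- r | _) _.
apply: (@homog_away0 b).
  by rewrite /y big_seq_cond; apply: homog_sum => i /andP[/aw + /eqP <-].
have -> : y = - \sum_(i <- r | a i != b) w i.
  by apply/eqP; rewrite -addr_eq0; move: w0;
    rewrite (bigID (fun i => a i == b)) => /eqP.
rewrite -sumrN big_seq_cond; apply: away_sum => // i /andP[/aw wi ai].
by apply: homog_away (homogN wi) => //; rewrite eq_sym.
Qed.

(** This is what makes an operator defined through a homogeneous decomposition independent of the
    decomposition. *)
Lemma homog_indep_scale (J : eqType) (r : seq J) (a : J -> C) (w : J -> M)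
    (F : C -> A) :
  (forall i, i \in r -> homog (a i) (w i)) -> \sum_(i <- r) w i = 0 ->
  \sum_(i <- r) F (a i) *: w i = 0.
Proof.
move=> aw w0; rewrite (sum_by_value a) big1 // => t _.
rewrite (eq_bigr (fun i => F t *: w i)) => [|i /eqP->//].
by rewrite -scaler_sumr homog_indep // scaler0.
Qed.

End Homogeneous.

Lemma nabla_integral_hom (R : comNzRingType) (A : diff_alg R) (M N : conn A)
    (f : conn_hom M N) v : nabla_integral v -> nabla_integral (f v).
Proof. by move=> [P Pm Pv]; exists P => //; rewrite -act_hom Pv chom0. Qed.

(** * Laurent series and lattices *)

Section LaurentCoefficients.
Variable R : comNzRingType.
Implicit Types (f g : laurent R) (c : R) (d N : int).

Definition lge N f := forall n, n < N -> f n = 0.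
Definition lle N f := forall n, N < n -> f n = 0.

Lemma lcoefN f n : (- f) n = - f n. Proof. by []. Qed.
Lemma lcoefB f g n : (f - g) n = f n - g n. Proof. by []. Qed.

Lemma lcoef_sum (I : Type) (r : seq I) (P : pred I) (F : I -> laurent R) n :
  (\sum_(i <- r | P i) F i) n = \sum_(i <- r | P i) F i n.
Proof. by apply: (big_morph (fun f : laurent R => f n)). Qed.

Lemma lmonomE d n : lmonom R d n = (n == d)%:R.
Proof. by rewrite /=; case: eqP. Qed.

Lemma lge0 N : lge N 0. Proof. by []. Qed.
Lemma lgeD N f g : lge N f -> lge N g -> lge N (f + g).
Proof. by move=> fN gN n nN; rewrite lcoefD fN // gN // addr0. Qed.
Lemma lgeN N f : lge N f -> lge N (- f).
Proof. by move=> fN n nN; rewrite lcoefN fN // oppr0. Qed.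
Lemma lgeZ N c f : lge N f -> lge N (c *: f).
Proof. by move=> fN n nN; rewrite lcoefZ fN // mulr0. Qed.
Lemma lgeM a b f g : lge a f -> lge b g -> lge (a + b) (f * g).
Proof. by move=> fa gb n; apply: laurent_mul_fun0. Qed.
Lemma lge_sum N (I : Type) (r : seq I) (P : pred I) (F : I -> laurent R) :
  (forall i, P i -> lge N (F i)) -> lge N (\sum_(i <- r | P i) F i).
Proof. by move=> FN; apply: (big_ind (lge N)) => //; apply: lgeD. Qed.
Lemma lge_monom d : lge d (lmonom R d).
Proof. by move=> n nd; rewrite lmonomE lt_eqF. Qed.
Lemma lge_le N N' f : N' <= N -> lge N f -> lge N' f.
Proof. by move=> NN fN n nN; apply: fN; apply: lt_le_trans NN. Qed.
Lemma lge_theta N f : lge N f -> lge N (laurent_theta f).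
Proof. by move=> fN n nN; rewrite laurent_thetaE fN // mul0rz. Qed.
Lemma lle0 N : lle N 0. Proof. by []. Qed.
Lemma lleD N f g : lle N f -> lle N g -> lle N (f + g).
Proof. by move=> fN gN n nN; rewrite lcoefD fN // gN // addr0. Qed.
Lemma lleN N f : lle N f -> lle N (- f).
Proof. by move=> fN n nN; rewrite lcoefN fN // oppr0. Qed.
Lemma lleZ N c f : lle N f -> lle N (c *: f).
Proof. by move=> fN n nN; rewrite lcoefZ fN // mulr0. Qed.
Lemma lleM a b f g : lle a f -> lle b g -> lle (a + b) (f * g).
Proof.
move=> fa gb n nab; rewrite lcoefM; apply: fsbig1 => i _.
have [/fa->|ia] := ltP a i; first by rewrite mul0r.
by rewrite gb ?mulr0 //; lia.
Qed.
Lemma lle_sum N (I : Type) (r : seq I) (P : pred I) (F : I -> laurent R) :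
  (forall i, P i -> lle N (F i)) -> lle N (\sum_(i <- r | P i) F i).
Proof. by move=> FN; apply: (big_ind (lle N)) => //; apply: lleD. Qed.
Lemma lle_monom d : lle d (lmonom R d).
Proof. by move=> n nd; rewrite lmonomE gt_eqF. Qed.
Lemma lle_le N N' f : N <= N' -> lle N f -> lle N' f.
Proof. by move=> NN fN n nN; apply: fN; apply: le_lt_trans nN. Qed.
Lemma lle_theta N f : lle N f -> lle N (laurent_theta f).
Proof. by move=> fN n nN; rewrite laurent_thetaE fN // mul0rz. Qed.
Lemma lmonomK d f : lmonom R d * (lmonom R (- d) * f) = f.
Proof. by rewrite mulrA lmonomM subrr mul1r. Qed.
Lemma lmonomNK d f : lmonom R (- d) * (lmonom R d * f) = f.
Proof. by rewrite mulrA lmonomM addNr mul1r. Qed.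

Lemma lge_common n (f : 'I_n -> laurent R) :
  exists N : nat, forall i, lge (- N%:Z) (f i).
Proof.
have /choice[N NP] : forall i, exists N, lge N (f i).
  by move=> i; apply: Defs.lbound.
exists (\max_i `|N i|%N) => i; apply: lge_le (NP i).
by have := leq_bigmax (F := fun i => `|N i|%N) i; lia.
Qed.

Lemma lle_common n (f : 'I_n -> lpoly R) :
  exists N : nat, forall i, lle N%:Z (f i).
Proof.
have /choice[N NP] : forall i, exists N, lle N (f i).
  by move=> i; case: (f i) => g /= /lpoly_predP.
exists (\max_i `|N i|%N) => i; apply: lle_le (NP i).
by have := leq_bigmax (F := fun i => `|N i|%N) i; lia.
Qed.

(** A series is finitely many monomials plus a tail of order at least [N]. Only monomials carrying
    the coefficients of [f] itself are tested, so that known vanishing of coefficients can be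
    used. *)
Lemma laurent_trunc_ind (X : laurent R -> Prop) N f :
  (forall g h, X g -> X h -> X (g + h)) -> (forall g, lge N g -> X g) ->
  (forall d, X (f d *: lmonom R d)) -> X f.
Proof.
move=> XD XN Xf; have [a fa] := Defs.lbound f.
have [k] : exists k : nat, N <= a + k%:Z by exists `|N - a|%N; lia.
elim: k a f fa Xf => [|k IHk] a f fa Xf ak.
  by apply: XN; apply: lge_le fa; lia.
rewrite -[f](subrK (f a *: lmonom R a)); apply: XD => //.
apply: (IHk (a + 1)); last by lia.
  move=> n na; rewrite lcoefB lcoefZ lmonomE; case: eqP => [->|/eqP an].
    by rewrite mulr1 subrr.
  by rewrite mulr0 subr0 fa //; lia.
move=> d; rewrite lcoefB lcoefZ lmonomE; case: eqP => [->|_].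
  by rewrite mulr1 subrr scale0r; apply: XN.
by rewrite mulr0 subr0.
Qed.

Fact lseries_subproof (F : nat -> R) :
  (fun n : int => if n is Posz k then F k else 0) \in @laurent_pred R.
Proof. by apply/laurent_predP; exists 0 => -[]. Qed.
Definition lseries F := Laurent (lseries_subproof F).

Lemma lge_series F : lge 0 (lseries F). Proof. by case. Qed.

Lemma lseries_recl F :
  lseries F = F 0%N *: 1 + lmonom R 1 * lseries (F \o succn).
Proof.
apply: lcoefP => n; rewrite lcoefD lcoefZ lmonomME lmonomE.
case: n => [[|n]|n]; first by rewrite mulr1 addr0.
  by rewrite mulr0 add0r /= subn1.
by rewrite mulr0 add0r; case: n.
Qed.

Lemma lge_all f : (forall k : nat, lge k%:Z f) -> f = 0.
Proof. by move=> fk; apply: lcoefP => n; apply: (fk `|n|%N.+1); lia. Qed.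

End LaurentCoefficients.

(** * Separation at 0 and bounded degrees, from relations *)

Section Separated.
Variable R : comNzRingType.
Hypothesis R_noetherian : noetherian R.
Variables (M : lmodType (laurent R)) (n : nat) (e : 'I_n -> M).
Local Notation x d := (lmonom R d).

(* The relations among the [e i] are saturated for [x], hence generated over
   R[[x]] by lifts [h] of generators of their constant terms; so a vector that
   is a relation modulo every power of [x] is a relation. *)
Lemma lattice_separated (u : M) :
  (forall k : nat, exists g : 'I_n -> laurent R,
    (forall i, lge k%:Z (g i)) /\ u = \sum_i g i *: e i) -> u = 0.
Proof.
move=> u_small.
pose ev (f : 'I_n -> laurent R) := \sum_i f i *: e i.
pose K0 : set 'rV[R]_n := [set c | exists h : 'I_n -> laurent R,
  [/\ forall i, lge 0 (h i), ev h = 0 & forall i, h i 0 = c 0 i]].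
have evD f g : ev (fun i => f i + g i) = ev f + ev g.
  by rewrite -big_split; apply: eq_bigr => i _; rewrite scalerDl.
have evM c f : ev (fun i => c * f i) = c *: ev f.
  by rewrite scaler_sumr; apply: eq_bigr => i _; rewrite scalerA.
have [|q [c [cK cP]]] := rV_submodule_fg R_noetherian (U := K0).
  split=> [|a b [f [f0 fe fa]] [g [g0 ge gb]]|r a [f [f0 fe fa]]].
  - exists (fun=> 0); split=> // [|i]; last by rewrite mxE.
    by rewrite /ev big1 // => i _; rewrite scale0r.
  - exists (fun i => f i + g i); split=> [i||i]; first exact: lgeD.
      by rewrite evD fe ge addr0.
    by rewrite lcoefD mxE fa gb.
  - exists (fun i => r%:A * f i); split=> [i||i].
    + by rewrite mulr_algl; apply: lgeZ.
    + by rewrite evM fe scaler0.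
    + by rewrite mulr_algl lcoefZ mxE fa.
have /choice[h hP] := cK.
have /choice[r rP] : forall a, exists r : 'I_q -> R,
    K0 a -> a = \sum_j r j *: c j.
  move=> a; have [/cP[r rE]|nKa] := pselect (K0 a); first by exists r.
  by exists (fun=> 0).
pose rr (f : 'I_n -> laurent R) := r (\row_i f i 0).
(* When the constant term of [f] is in [K0], [next] subtracts a relation with that constant term and
   divides by x. [S f j] collects the coefficients used along the iteration, and [D] is the
   remainder, to be shown zero. *)
pose next (f : 'I_n -> laurent R) i := x (- 1) * (f i - \sum_j rr f j *: h j i).
pose S f j := lseries (fun l => rr (iter l next f) j).
pose D f i := f i - \sum_j S f j * h j i.
have SE f j : S f j = rr f j *: 1 + x 1 * S (next f) j.
  rewrite /S lseries_recl /=; congr (_ *: _ + _ * lseries _).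
  by apply/funext => l; rewrite /= -iterSr.
have DE f i : D f i = x 1 * D (next f) i.
  rewrite /D mulrBr [x 1 * next f i]lmonomK -addrA -opprD; congr (_ - _).
  rewrite mulr_sumr -big_split; apply: eq_bigr => j _.
  by rewrite SE mulrDl -scalerAl mul1r mulrA.
have [f [f0 fu]] := u_small 0%N.
have next_ok k : (forall i, lge 0 (iter k next f i)) /\
    ev (iter k next f) = x (- k%:Z) *: u.
  elim: k => [|k [IH0 IHu]]; first by rewrite oppr0 scale1r fu.
  set fk := iter k next f in IH0 IHu.
  have fkK : K0 (\row_i fk i 0).
    have [g [gk gu]] := u_small k.+1.
    (* [u] also has coefficients [g] of order [k.+1], so subtracting x^(-k) times [g] from [fk]
       gives a relation with the constant terms of [fk]. *)
    exists (fun i => fk i + (- x (- k%:Z)) * g i); split=> [i||i].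
    - rewrite mulNr; apply: lgeD => //; apply: lgeN.
      have -> : 0 = - k%:Z + k%:Z by lia.
      by apply: lgeM; [apply: lge_monom|apply: lge_le (gk i); lia].
    - by rewrite evD IHu evM scaleNr gu subrr.
    - rewrite lcoefD mulNr lcoefN lmonomME gk ?subr0 ?mxE //; lia.
  have evnext : ev (next fk) = x (- 1) *: ev fk.
    rewrite /next evM evD; congr (_ *: _).
    rewrite [X in _ + X](_ : _ = 0) ?addr0 //.
    rewrite /ev; under eq_bigr do rewrite scaleNr scaler_suml.
    rewrite sumrN exchange_big big1 ?oppr0 // => j _.
    have [_ hj _] := hP j.
    under eq_bigr do rewrite -mulr_algl -scalerA.
    by rewrite -scaler_sumr [X in _ *: X]hj scaler0.
  split; last first.
    by rewrite iterS evnext IHu scalerA lmonomM; congr (lmonom _ _ *: _); lia.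
  move=> i m m0; rewrite iterS -/fk /next lmonomME lcoefB lcoef_sum.
  have [m1|m1] := ltP (m + 1) 0.
    rewrite opprK IH0 // big1 ?subrr // => j _.
    by have [h0 _ _] := hP j; rewrite lcoefZ h0 // mulr0.
  have -> : m - (- 1) = 0 by lia.
  have := congr1 (fun a : 'rV[R]_n => a 0 i) (rP _ fkK).
  rewrite mxE => ->; rewrite summxE -sumrB big1 // => j _.
  by have [_ _ hc] := hP j; rewrite mxE lcoefZ hc subrr.
have D0 i : D f i = 0.
  apply: lge_all => k.
  have -> : D f i = x k%:Z * D (iter k next f) i.
    elim: k => [|k IHk]; first by rewrite mul1r.
    by rewrite IHk iterS DE mulrA lmonomM; congr (lmonom _ _ * _); lia.
  suff Dk : lge 0 (D (iter k next f) i).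
    by have := lgeM (@lge_monom R k%:Z) Dk; rewrite addr0.
  apply: lgeD; first by have [] := next_ok k.
  apply/lgeN/lge_sum => j _; have [h0 _ _] := hP j.
  by have := lgeM (lge_series (fun l =>
    rr (iter l next (iter k next f)) j)) (h0 i);
    rewrite addr0.
rewrite fu; under eq_bigr => i _.
  have -> : f i = \sum_j S f j * h j i by apply/subr0_eq/D0.
  rewrite scaler_suml; under eq_bigr do rewrite -scalerA.
  over.
rewrite exchange_big big1 // => j _; rewrite -scaler_sumr.
by have [_ hj _] := hP j; rewrite [X in _ *: X]hj scaler0.
Qed.

End Separated.

Section Bounded.
Variable R : comNzRingType.
Hypothesis R_noetherian : noetherian R.
Variables (N : lmodType (lpoly R)) (n : nat) (e : 'I_n -> N).
Local Notation x d := (lpXn R d).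

(* Finiteness of H^0 on the projective line: the top-degree coefficients of the
   relations among the [e i] are finitely generated, and subtracting shifts of
   finitely many relations lowers the degree as long as it is large. *)
Lemma lpoly_bounded (a b : int) : exists D : int,
  forall u (f g : 'I_n -> lpoly R),
    (forall i, lge a (f i)) -> u = \sum_i f i *: e i ->
    (forall i, lle b (g i)) -> u = \sum_i g i *: e i ->
  exists f' : 'I_n -> lpoly R,
    [/\ forall i, lge a (f' i), forall i, lle D (f' i) &
      u = \sum_i f' i *: e i].
Proof.
pose ev (f : 'I_n -> lpoly R) := \sum_i f i *: e i.
have evD f g : ev (fun i => f i + g i) = ev f + ev g.
  by rewrite -big_split; apply: eq_bigr => i _; rewrite scalerDl.
have evM c f : ev (fun i => c * f i) = c *: ev f.
  by rewrite scaler_sumr; apply: eq_bigr => i _; rewrite scalerA.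
have evB f g : ev (fun i => f i - g i) = ev f - ev g.
  by rewrite -sumrB; apply: eq_bigr => i _; rewrite scalerBl.
pose K0 : set 'rV[R]_n := [set c | exists h : 'I_n -> lpoly R,
  [/\ forall i, lle 0 (h i), ev h = 0 & forall i, (h i : laurent R) 0 = c 0 i]].
have [|q [c [cK cP]]] := rV_submodule_fg R_noetherian (U := K0).
  split=> [|u v [f [f0 fe fa]] [g [g0 ge gb]]|r u [f [f0 fe fa]]].
  - exists (fun=> 0); split=> [i||i]; first exact: lle0.
      by rewrite /ev big1 // => i _; rewrite scale0r.
    by rewrite mxE.
  - exists (fun i => f i + g i); split=> [i||i];
    first exact: (lleD (f0 i) (g0 i)).
      by rewrite evD fe ge addr0.
    by rewrite [LHS]lcoefD mxE fa gb.
  - exists (fun i => r%:A * f i); split=> [i||i].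
    + by rewrite mulr_algl; exact: (lleZ _ (f0 i)).
    + by rewrite evM fe scaler0.
    + by rewrite mulr_algl [LHS]lcoefZ mxE fa.
have /choice[h hP] := cK.
have /choice[d dP] : forall j, exists d : nat, forall i, lge (- d%:Z) (h j i).
  by move=> j; apply: lge_common.
pose dmax := \max_j d j.
have hd j i : lge (- dmax%:Z) (h j i).
  by apply: lge_le (dP j i); have := leq_bigmax (F := d) j; rewrite -/dmax; lia.
(* Above [b], the leading coefficients of [f] are those of the relation [f - g]; above [a + dmax],
   subtracting x^t times the [h j] keeps the order at least [a]. *)
pose D := Num.max b (a + dmax%:Z); exists D => u f g fa fu gb gu.
have [t ft] := lle_common f.
have [k] : exists k : nat, t%:Z <= D + k%:Z by exists `|t - D|%N; lia.
elim: k t%:Z f fa fu ft => [|k IHk] {}t f fa fu ft tk.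
  by exists f; split=> // i; apply: lle_le (ft i); lia.
have [tD|Dt] := lerP t D.
  by exists f; split=> // i; apply: lle_le (ft i).
have tb : b < t by apply: le_lt_trans Dt; rewrite le_max lexx.
have ta : a + dmax%:Z < t by apply: le_lt_trans Dt; rewrite le_max lexx orbT.
have [|r rE] := cP (\row_i (f i : laurent R) t).
  exists (fun i => x (- t) * (f i - g i)); split=> [i||i].
  - have := lleM (@lle_monom R (- t)) (lleD (ft i) (lleN (lle_le (ltW tb) (gb
    i)))).
    by rewrite addNr.
  - by rewrite evM evB /ev -fu -gu subrr scaler0.
  - rewrite [LHS]lmonomME opprK add0r [LHS]lcoefD mxE.
    by rewrite [X in _ + X]lcoefN gb // subr0.
have rcoef i : (f i : laurent R) t = \sum_j r j * (h j i : laurent R) 0.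
  have := congr1 (fun a : 'rV[R]_n => a 0 i) rE.
  rewrite mxE => ->; rewrite summxE; apply: eq_bigr => j _.
  by have [_ _ hc] := hP j; rewrite mxE hc.
pose f' i := f i - x t * \sum_j (r j)%:A * h j i.
have f'E i m : (f' i : laurent R) m =
    (f i : laurent R) m - \sum_j r j * (h j i : laurent R) (m - t).
  rewrite [LHS]lcoefD [X in _ + X]lcoefN [X in - X]lmonomME.
  rewrite rmorph_sum lcoef_sum; congr (_ - _); apply: eq_bigr => j _.
  by rewrite mulr_algl.
apply: (IHk (t - 1) f'); last by lia.
- move=> i m ma; rewrite f'E fa // big1 ?subr0 // => j _.
  by rewrite hd ?mulr0 //; lia.
- rewrite -/(ev f') /f' evB evM [ev f]/ev -fu.
  rewrite [X in _ *: X](_ : _ = 0) ?scaler0 ?subr0 //.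
  rewrite /ev; under eq_bigr do rewrite scaler_suml.
  rewrite exchange_big big1 // => j _; have [_ hj _] := hP j.
  under eq_bigr do rewrite -scalerA.
  by rewrite -scaler_sumr [X in _ *: X]hj scaler0.
- move=> i m mt; rewrite f'E; have [->|mt'] := eqVneq m t.
    by rewrite subrr rcoef subrr.
  rewrite ft ?big1 ?subr0 //; last by lia.
  move=> j _; have [h0 _ _] := hP j.
  by rewrite h0 ?mulr0 //; lia.
Qed.

End Bounded.

(** * Lattices of regular singular connections *)

Section Frames.
Variables (R : comNzRingType) (A B : diff_alg R) (phi : diff_mor A B).

Lemma tens_span (L : lmodType A) n (e : 'I_n -> L) :
  (forall l, exists c : 'I_n -> A, l = \sum_i c i *: e i) ->
  forall t : tensor phi L, exists f : 'I_n -> B,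
    t = \sum_i f i *: tens phi 1 (e i).
Proof.
move=> eL; apply: tens_ind => [|b m|x y [c ->] [d ->]].
- by exists (fun=> 0); rewrite big1 // => i _; rewrite scale0r.
- have [c ->] := eL m; exists (fun i => b * phi (c i)).
  rewrite (big_morph _ (tensDr phi b) (tens0r phi L b)).
  by apply: eq_bigr => i _; rewrite scale_tens mulr1 tensZ.
- exists (fun i => c i + d i); rewrite -big_split.
  by apply: eq_bigr => i _; rewrite scalerDl.
Qed.

End Frames.

(** The [e i] correspond to [tens phi 1 (eps i)] for generators [eps] of [L]; horizontality carries
    over the coefficients of nabla. *)
Lemma base_change_frame (R : comNzRingType) (A B : diff_alg R)
    (phi : diff_mor A B) (N : conn B) (L : conn A) :
  isomorphic (N : MC B) (base_change phi L) ->
  exists n (e : 'I_n -> N) (c : 'I_n -> 'I_n -> A),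
    (forall u, exists f : 'I_n -> B, u = \sum_i f i *: e i) /\
    forall i, nabla (e i) = \sum_j phi (c i j) *: e j.
Proof.
move=> [[F G GF _]]; have [n [eps epsL]] := conn_fg L.
have /choice[c cP] := fun i => epsL (nabla (eps i)).
exists n, (fun i => (G : conn_hom _ _) (tens phi 1 (eps i))), c; split.
  move=> u; have [f fE] := tens_span epsL ((F : conn_hom _ _) u).
  exists f; have <- : (G : conn_hom _ _) ((F : conn_hom _ _) u) = u.
    exact: (congr1 (fun h : conn_hom N N => h u) GF).
  by rewrite fE chom_sum; apply: eq_bigr => i _; rewrite chomZ.
move=> i; rewrite -chom_nabla nabla_bcE der1 tens0l add0r cP.
rewrite (big_morph _ (tensDr phi 1) (tens0r phi L 1)) chom_sum.
apply: eq_bigr => j _; rewrite tensZ mul1r -[phi _]mulr1 -scale_tens mulr1.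
by rewrite chomZ.
Qed.

Section Lattice.
Variable R : comNzRingType.

(** The R[[x]]-span of [e] is a logarithmic lattice. The [e i] generate without being independent,
    since [M] need not be free. *)
Definition is_lattice (M : conn (diff_laurent R)) n (e : 'I_n -> M) : Prop :=
  (forall u, exists f : 'I_n -> laurent R, u = \sum_i f i *: e i) /\
  exists c : 'I_n -> 'I_n -> laurent R, (forall i j, lge 0 (c i j)) /\
    forall i, nabla (e i) = \sum_j c i j *: e j.

Lemma rs_laurent_lattice (M : conn (diff_laurent R)) : rs_laurent M ->
  exists n (e : 'I_n -> M), is_lattice e.
Proof.
move=> [L /base_change_frame[n [e [c [eM eN]]]]]; exists n, e; split=> //.
exists (fun i j => val (c i j)); split=> // i j.
by case: (c i j) => f /= /pseries_predP.
Qed.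

Section LatticeFiltration.
Variables (M : conn (diff_laurent R)) (n : nat) (e : 'I_n -> M).
Hypothesis e_lattice : is_lattice e.

(** x^k times the R[[x]]-span of [e]. *)
Definition lfilt (k : int) : set M := [set u | exists g : 'I_n -> laurent R,
  (forall i, lge k (g i)) /\ u = \sum_i g i *: e i].

Lemma lfilt_stable k : nabla_stable (lfilt k).
Proof.
have [_ [c [c0 cE]]] := e_lattice; split.
- exists (fun=> 0); split=> // ; rewrite big1 // => i _.
  by rewrite scale0r.
- move=> _ _ [f [fk ->]] [g [gk ->]]; exists (fun i => f i + g i); split.
    by move=> i; apply: lgeD.
  by rewrite -big_split; apply: eq_bigr => i _; rewrite scalerDl.
- move=> r _ [f [fk ->]]; exists (fun i => r *: f i); split.
    by move=> i; apply: lgeZ.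
  rewrite scaler_sumr; apply: eq_bigr => i _.
  by rewrite scalerA mulr_algl.
- move=> _ [f [fk ->]].
  exists (fun j => laurent_theta (f j) + \sum_i f i * c i j); split.
    move=> j; apply: lgeD; first exact: lge_theta.
    by apply: lge_sum => i _; rewrite -[k]addr0; apply: lgeM.
  rewrite nabla_sum; under eq_bigr do rewrite nabla_leibniz cE scaler_sumr.
  rewrite big_split exchange_big -big_split; apply: eq_bigr => j _.
  rewrite scalerDl scaler_suml; congr (_ + _).
  by apply: eq_bigr => i _; rewrite scalerA.
Qed.

Lemma lfilt_scale k l (f : laurent R) u :
  lge k f -> lfilt l u -> lfilt (k + l) (f *: u).
Proof.
move=> fk [g [gl ->]]; exists (fun i => f * g i); split.
  by move=> i; apply: lgeM.
by rewrite scaler_sumr; apply: eq_bigr => i _; rewrite scalerA.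
Qed.

Lemma lfilt_exhausted u : exists k : nat, lfilt (- k%:Z) u.
Proof.
have [eM _] := e_lattice; have [f ->] := eM u.
by have [N fN] := lge_common f; exists N, f.
Qed.

Lemma lfilt_separated (R_noetherian : noetherian R) u :
  (forall k : nat, lfilt k%:Z u) -> u = 0.
Proof. exact: lattice_separated. Qed.

End LatticeFiltration.
End Lattice.

(** * Homogeneous components of Laurent combinations *)

Section Components.
Variables (C : closedFieldType) (R : comAlgType C) (red : {rmorphism R -> C}).
Hypothesis red_alg : forall c, red c%:A = c.
Hypothesis R_complete : adic_complete [set a | red a = 0].
Hypothesis R_noetherian : noetherian R.
Hypothesis charC : [pchar C] =i pred0.

Lemma intr_inj_pchar0 : injective (intr : int -> C).
Proof.
suff C0 (n : int) : n%:~R = 0 :> C -> n = 0.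
  by move=> i j ij; apply/eqP; rewrite -subr_eq0; apply/eqP/C0;
    rewrite rmorphB /= ij subrr.
have /pcharf0P charC0 := charC.
case: n => n; first by move/eqP; rewrite -pmulrn charC0 => /eqP->.
by move/eqP; rewrite NegzE mulrNz oppr_eq0 -pmulrn charC0.
Qed.

(* The component of exponent [a] of a Laurent series, exponents being viewed in
   [C]; it is zero unless [a] is an integer. *)
Definition lcomp (a : C) (f : laurent R) : lpoly R :=
  if pselect (exists n : int, a = n%:~R) is left h
  then f (sval (cid h)) *: lpXn R (sval (cid h)) else 0.

Lemma lcomp_int n f : lcomp n%:~R f = f n *: lpXn R n.
Proof.
rewrite /lcomp; case: pselect => [h|[]]; last by exists n.
by case: cid => m /= /intr_inj_pchar0 <-.
Qed.

Lemma lcompP a f : (exists n : int, a = n%:~R /\ lcomp a f = f n *: lpXn R n)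
  \/ (forall n : int, a != n%:~R) /\ lcomp a f = 0.
Proof.
have [[n an]|na] := pselect (exists n : int, a = n%:~R).
  by left; exists n; rewrite an lcomp_int.
right; split; first by move=> n; apply/eqP => an; apply: na; exists n.
by rewrite /lcomp; case: pselect.
Qed.

Lemma lcomp_coef a f n :
  (lcomp a f : laurent R) n = if a == n%:~R then f n else 0.
Proof.
have [[m [-> ->]]|[na ->]] := lcompP a f; last by rewrite (negPf (na n)).
rewrite [LHS]lcoefZ [lmonom R m n]lmonomE (inj_eq intr_inj_pchar0) eq_sym.
by case: eqP => [->|_]; rewrite ?mulr1 ?mulr0.
Qed.

Lemma laurent_theta_monom n :
  laurent_theta (lmonom R n) = lmonom R n *~ n.
Proof.
by have := congr1 val (lpoly_theta_X R n); rewrite rmorphMz.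
Qed.

Section Conn.
Variable M : conn (diff_laurent R).

Lemma homog_monom n a (v : M) : homog red a v ->
  homog red (a + n%:~R) (lmonom R n *: v).
Proof. exact/homog_shift/laurent_theta_monom. Qed.

Lemma homog_lcomp a s (f : laurent R) (v : M) : homog red s v ->
  homog red a ((lcomp (a - s) f : laurent R) *: v).
Proof.
move=> sv; have [[n [an ->]]|[_ ->]] := lcompP (a - s) f; last first.
  by rewrite scale0r; apply: homog0.
rewrite -[val _]mulr_algl -scalerA; apply: homogZ.
by rewrite -[a](subrK s) an addrC; apply: homog_monom.
Qed.

(** Modulo x^k times the lattice, each [f i] minus its component is a finite sum of monomials moving
    [v i] to exponents other than [a]. The difference of the two sides is thus both homogeneous of
    exponent [a] and away from [a] modulo every x^k, hence 0. *)
Lemma homog_component n (e : 'I_n -> M) r (v : 'I_r -> M) (s : 'I_r -> C) f a :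
  is_lattice e -> (forall i, homog red (s i) (v i)) ->
  homog red a (\sum_i f i *: v i) ->
  \sum_i f i *: v i = \sum_i (lcomp (a - s i) (f i) : laurent R) *: v i.
Proof.
move=> eM sv au; apply: subr0_eq; set w := _ - _.
apply: (lfilt_separated (e := e) R_noetherian) => k.
have Zk := lfilt_stable eM k%:Z.
apply: (homog_away_sub red_alg R_complete (a := a)) => //.
  apply: homogD => //; apply: homogN; apply: homog_sum => i _.
  exact: homog_lcomp.
rewrite /w -sumrB; apply: away_sum => // i _; rewrite -scalerBl.
have [c vc] := lfilt_exhausted eM (v i).
pose X (h : laurent R) := away red a (lfilt e k%:Z) (h *: v i).
(* [v i] lies in x^(-c) times the lattice, so tails of order [k + c] land in x^k times it. *)
apply: (@laurent_trunc_ind _ X (k%:Z + c%:Z)).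
- by move=> g h; rewrite /X scalerDl; apply: awayD.
- move=> g gk; apply: away_sub => //.
  by have := lfilt_scale gk vc; rewrite addrK.
- move=> d; rewrite /X lcoefB lcomp_coef -[_ *: lmonom R d]mulr_algl -scalerA.
  case: eqP => [_|/eqP ad].
    by rewrite subrr !scale0r; apply: away_sub => //; case: Zk.
  apply: awayZ => //; apply: (homog_away (b := s i + d%:~R)) => //.
    by rewrite addrC -subr_eq.
  exact: homog_monom.
Qed.

End Conn.
End Components.

(** * Completeness of lattices *)

Section SeriesSum.
Variable R : comNzRingType.

Fact lsum_subproof (g : nat -> laurent R) :
  (fun n : int => if n is Posz k then \sum_(j < k.+1) g j n else 0)
    \in @laurent_pred R.
Proof. by apply/laurent_predP; exists 0 => -[]. Qed.
(* The sum of a sequence whose term of rank [k] is divisible by [x ^ k]. *)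
Definition lsum g := Laurent (lsum_subproof g).

Lemma lsum_tail g : (forall k : nat, lge k%:Z (g k)) ->
  forall k : nat, lge k%:Z (lsum g - \sum_(j < k) g j).
Proof.
move=> gk k [n|n] nk; rewrite lcoefB lcoef_sum /=; last first.
  by rewrite big1 ?subrr // => j _; apply: gk; lia.
rewrite -(subnKC (_ : n.+1 <= k)%N); last by lia.
rewrite big_split_ord /= [X in _ - (_ + X)]big1 ?addr0 ?subrr // => j _.
by apply: gk; lia.
Qed.

End SeriesSum.

Section LatticeComplete.
Variables (R : comNzRingType) (M : conn (diff_laurent R)) (n : nat).
Variable e : 'I_n -> M.
Hypothesis e_lattice : is_lattice e.

Lemma lfilt_le k l u : l <= k -> lfilt e k u -> lfilt e l u.
Proof.
by move=> lk [f [fk ->]]; exists f; split=> // i; apply: lge_le (fk i).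
Qed.

Lemma lfilt_basis i : lfilt e 0 (e i).
Proof.
exists (fun j => (j == i)%:R); split.
  move=> j; case: eqP => _; [exact: lge_monom|exact: lge0].
by rewrite (bigD1 i) //= eqxx scale1r big1 ?addr0 // => j /negPf->;
  rewrite scale0r.
Qed.

Lemma lfilt_complete (u : nat -> M) : (forall k, lfilt e k%:Z (u k.+1 - u k)) ->
  exists v, forall k, lfilt e k%:Z (u k - v).
Proof.
move=> /choice[g gP].
pose h i := lsum (fun k => g k i).
exists (u 0%N + \sum_i h i *: e i) => k.
have uE : u k = u 0%N + \sum_i (\sum_(j < k) g j i) *: e i.
  elim: k => [|k IHk].
    by rewrite big1 ?addr0 // => i _; rewrite big_ord0 scale0r.
  have [_ uk] := gP k; rewrite -[LHS](subrK (u k)) uk {1}IHk addrC -addrA.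
  congr (_ + _); rewrite -big_split; apply: eq_bigr => i _.
  by rewrite big_ord_recr /= scalerDl.
rewrite uE opprD addrACA subrr add0r -sumrB.
exists (fun i => - (h i - \sum_(j < k) g j i)); split.
  move=> i; apply: lgeN; apply: lsum_tail => j.
  by have [] := gP j.
by apply: eq_bigr => i _; rewrite opprB scalerBl.
Qed.

Lemma lfilt_const u : lfilt e 0 u ->
  exists c : 'I_n -> R, lfilt e 1 (u - \sum_i (c i)%:A *: e i).
Proof.
move=> [f [f0 ->]]; exists (fun i => f i 0).
exists (fun i => f i - (f i 0)%:A); split; last first.
  by rewrite -sumrB; apply: eq_bigr => i _; rewrite scalerBl.
move=> i m m1; rewrite lcoefB lcoefZ lmonomE.
have [->|m0] := eqVneq m 0; first by rewrite mulr1 subrr.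
by rewrite mulr0 subr0 f0 //; lia.
Qed.

(** Nakayama by iteration: in [e = v + g e] the matrix [g] is divisible by x. Substituting
    repeatedly expresses [f e] through [v], up to remainders [F k] of order [k] that separation
    removes. *)
Lemma lattice_approx_span (R_noetherian : noetherian R) (v : 'I_n -> M) :
  (forall i, lfilt e 1 (e i - v i)) ->
  forall u, exists f : 'I_n -> laurent R, u = \sum_i f i *: v i.
Proof.
move=> /choice[g gP]; have ge i := proj1 (gP i).
have v0 i : lfilt e 0 (v i).
  rewrite -[v i](subKr (e i)).
  have [_ ZD _ _] := lfilt_stable e_lattice 0.
  apply: ZD; first exact: lfilt_basis.
  apply: nabla_stableN; first exact: lfilt_stable.
  by apply: (@lfilt_le 1) => //; exists (g i); apply: gP.
suff span0 f : (forall i, lge 0 (f i)) ->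
    exists h : 'I_n -> laurent R, \sum_i f i *: e i = \sum_i h i *: v i.
  move=> u; have [f ->] := e_lattice.1 u; have [N fN] := lge_common f.
  have [|h hE] := span0 (fun i => lmonom R N%:Z * f i).
    by move=> i; have := lgeM (@lge_monom R N%:Z) (fN i); rewrite subrr.
  exists (fun i => lmonom R (- N%:Z) * h i).
  under [RHS]eq_bigr do rewrite -scalerA.
  rewrite -scaler_sumr -hE scaler_sumr; apply: eq_bigr => i _.
  by rewrite scalerA lmonomNK.
move=> f0; pose T (f : 'I_n -> laurent R) j := \sum_i f i * g i j.
pose F k := iter k T f.
have FS k i : F k.+1 i = \sum_j F k j * g j i by [].
have Fk k i : lge k%:Z (F k i).
  elim: k i => [|k IHk] i; first exact: f0.
  rewrite FS; apply: lge_sum => j _.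
  have -> : k.+1%:Z = k%:Z + 1 by lia.
  by apply: lgeM; [apply: IHk|apply: ge].
pose h i := lsum (fun k => F k i).
exists h; apply: subr0_eq; apply: (lfilt_separated (e := e)) => // k.
have FE : \sum_i f i *: e i =
    \sum_i F k i *: e i + \sum_i (\sum_(j < k) F j i) *: v i.
  elim: k => [|k IHk].
    by rewrite [X in _ + X]big1 ?addr0 // => i _; rewrite big_ord0 scale0r.
  rewrite IHk; under [X in _ = _ + X]eq_bigr do rewrite big_ord_recr scalerDl.
  rewrite [X in _ = _ + X]big_split /= addrCA [RHS]addrC; congr (_ + _).
  under [X in _ = X + _]eq_bigr do rewrite /T scaler_suml.
  rewrite exchange_big -big_split; apply: eq_bigr => i _ /=.
  under eq_bigr do rewrite -scalerA.
  rewrite -scaler_sumr -scalerDr; have [_ <-] := gP i.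
  by rewrite subrK.
have Zk := lfilt_stable e_lattice k%:Z; have [_ ZD _ _] := Zk.
rewrite FE -addrA; apply: ZD; first by exists (F k).
rewrite -sumrB; apply: nabla_stable_sum => // i _.
rewrite -scalerBl -opprB scaleNr; apply: nabla_stableN => //.
rewrite -[k%:Z]addr0; apply: lfilt_scale => //.
by apply: lsum_tail => j; apply: Fk.
Qed.

End LatticeComplete.

(** * Lifting lattice generators to integral vectors *)

Section IntegralLift.
Variables (C : closedFieldType) (R : comAlgType C) (red : {rmorphism R -> C}).
Hypothesis red_alg : forall c, red c%:A = c.
Hypothesis R_complete : adic_complete [set a | red a = 0].
Hypothesis R_noetherian : noetherian R.
Hypothesis charC : [pchar C] =i pred0.
Variables (M : conn (diff_laurent R)) (n : nat) (e : 'I_n -> M).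
Hypothesis e_lattice : is_lattice e.

Let Zs k : nabla_stable (lfilt e k). Proof. exact: lfilt_stable. Qed.
Let ZD k u v : lfilt e k u -> lfilt e k v -> lfilt e k (u + v).
Proof. by case: (Zs k) => _ h _ _; apply: h. Qed.
Let Zact k P u : lfilt e k u -> lfilt e k (act P u).
Proof. exact: nabla_stable_act. Qed.

(** Stands in for the characteristic polynomial of the residue: the lattice modulo x is finitely
    generated over [R], so nabla is integral on each generator, and the product serves them all. *)
Lemma residue_annihilator : exists2 P : {poly R}, P \is monic &
  forall u, lfilt e 0 u -> lfilt e 1 (act P u).
Proof.
have /choice[P PP] : forall i, exists P : {poly R},
    P \is monic /\ lfilt e 1 (act P (e i)).
  move=> i; have [|P Pm Pi] := monic_act_of_span (w := e) (v :=
    e i) R_noetherian (Zs 1).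
    move=> k; apply: lfilt_const; case: (Zs 0) => _ _ _ ZN.
    by elim: k => [|k IHk]; [exact: lfilt_basis|rewrite iterS; apply: ZN].
  by exists P.
exists (\prod_i P i); first by apply: monic_prod => i _; have [] := PP i.
move=> u /lfilt_const[c uc].
rewrite -[u](subrK (\sum_i (c i)%:A *: e i)) actDr; apply: ZD;
  first exact: Zact.
rewrite act_sumr; apply: nabla_stable_sum => // i _.
rewrite actZr; case: (Zs 1) => _ _ ZZ _; apply: ZZ.
by rewrite (bigD1 i) //= mulrC actM; apply: Zact; have [] := PP i.
Qed.

Definition shift_poly (P : {poly R}) (k : nat) : {poly R} :=
  P \Po ('X - (k%:Z)%:~R%:P).

(** Conjugation by x^k turns [P(X - k)] into [P], which moves the annihilator of the lattice modulo
    x to the graded piece of degree [k]. *)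
Lemma lfilt_shift_poly P k u :
  (forall w, lfilt e 0 w -> lfilt e 1 (act P w)) ->
  lfilt e k%:Z u -> lfilt e k.+1%:Z (act (shift_poly P k) u).
Proof.
move=> P0 uk; pose w := lmonom R (- k%:Z) *: u.
have w0 : lfilt e 0 w.
  by have := lfilt_scale (@lge_monom R (- k%:Z)) uk; rewrite addNr.
have -> : u = lmonom R k%:Z *: w by rewrite scalerA lmonomM subrr scale1r.
have dx : der (lmonom R k%:Z : diff_laurent R) = lmonom R k%:Z *~ k%:Z.
  exact: laurent_theta_monom.
rewrite (act_shift _ _ dx) comp_XsubX.
have -> : k.+1%:Z = k%:Z + 1 by lia.
by apply: lfilt_scale; [exact: lge_monom|exact: P0].
Qed.

Lemma shift_poly_monic P k : P \is monic -> shift_poly P k \is monic.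
Proof. by move=> Pm; rewrite /shift_poly -polyCN monic_comp_XaddC. Qed.

Lemma root_shift_poly P k z :
  root (map_poly red (shift_poly P k)) z = root (map_poly red P) (z - k%:R).
Proof.
rewrite /root /shift_poly map_comp_poly rmorphB /= map_polyX map_polyC /=.
by rewrite rmorph_int horner_comp !hornerE.
Qed.

(** In characteristic 0 each element of [s] is at most one natural number. *)
Lemma natr_eventually_avoids (s : seq C) : exists k0 : nat,
  forall k t, (k0 <= k)%N -> t \in s -> t != k%:R.
Proof.
have /pcharf0P charC0 := charC.
elim: s => [|t s [k0 IHs]]; first by exists 0%N.
have [[k tk]|nt] := pselect (exists k : nat, t = k%:R); last first.
  exists k0 => k t' k0k; rewrite inE => /orP[/eqP->|/IHs->//].
  by apply/eqP => tk; apply: nt; exists k.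
exists (maxn k0 k.+1) => l t'; rewrite geq_max => /andP[k0l kl].
rewrite inE => /orP[/eqP->|/IHs->//]; rewrite tk.
apply/eqP => /eqP; rewrite -(subnK (ltnW kl)) natrD -subr_eq0 opprD addrCA.
by rewrite subrr addr0 oppr_eq0 charC0 subn_eq0 leqNgt kl.
Qed.

(* [P] annihilates the residue, so the product [Q] of the shifts of [P] by
   j < k1 maps the lattice into its multiple by x ^ k1.  [G] collects the roots
   of [Q] that are roots of [P]: it is coprime to the further shifts of [P], so
   the part of [e i] killed by [G] modulo x ^ k1 lifts to all orders. *)
Lemma lattice_integral_lift i :
  exists v, nabla_integral v /\ lfilt e 1 (e i - v).
Proof.
have [P Pm P01] := residue_annihilator.
pose p := map_poly red P.
have [rs prs] : {rs | p = \prod_(z <- rs) ('X - z%:P)}.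
  have [rs] := closed_field_poly_normal p.
  by rewrite (monicP _) ?monic_map // scale1r; exists rs.
have rootp z : root p z = (z \in rs) by rewrite prs root_prod_XsubC.
(* Applied to the differences of roots: for [k] at least [k0], no two roots of [p] differ by [k]. *)
have [k0 k0P] := natr_eventually_avoids [seq z - z' | z <- rs, z' <- rs].
have shifts_disjoint k z : (k0 <= k)%N -> root p z ->
    ~~ root (map_poly red (shift_poly P k)) z.
  move=> k0k pz; rewrite root_shift_poly; apply/negP => pzk.
  have tk : z - (z - k%:R) \in [seq z - z' | z <- rs, z' <- rs].
    by apply: allpairs_f; rewrite -rootp.
  by have := k0P k _ k0k tk; rewrite subKr eqxx.
(* The successor makes [k1] positive, so that x^k1 times the lattice is inside x times it. *)
pose k1 := k0.+1.
pose Q := \prod_(j < k1) shift_poly P j.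
have Qm : Q \is monic by apply: monic_prod => j _; apply: shift_poly_monic.
have Qk1 u : lfilt e 0 u -> lfilt e k1%:Z (act Q u).
  move=> u0; rewrite /Q; move: (k1) => k.
  elim: k => [|k IHk]; first by rewrite big_ord0 act1.
  by rewrite big_ord_recr /= mulrC actM; apply: lfilt_shift_poly.
have [qs qqs] : {qs | map_poly red Q = \prod_(z <- qs) ('X - z%:P)}.
  have [qs] := closed_field_poly_normal (map_poly red Q).
  by rewrite (monicP _) ?monic_map // scale1r; exists qs.
pose g : {poly C} := \prod_(z <- qs | root p z) ('X - z%:P).
pose h : {poly C} := \prod_(z <- qs | ~~ root p z) ('X - z%:P).
have gm : g \is monic by apply: monic_prod => z _; apply: monicXsubC.
have hm : h \is monic by apply: monic_prod => z _; apply: monicXsubC.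
have rootg z : root g z -> root p z.
  by rewrite /g -big_filter root_prod_XsubC mem_filter => /andP[].
have rooth z : root h z -> ~~ root p z.
  by rewrite /h -big_filter root_prod_XsubC mem_filter => /andP[].
have coprime_roots (a b : {poly C}) :
    (forall z, root a z -> ~~ root b z) -> coprimep a b.
  by move=> ab; apply/Pdiv.ClosedField.coprimepP => z /ab.
have gh : coprimep g h.
  by apply: coprime_roots => z /rootg pz; apply/negP => /rooth; rewrite pz.
have qgh : map_poly red Q = g * h by rewrite qqs (bigID (root p)).
have [G [H [Gm Hm Gg Hh QGH]]] := hensel red_alg R_complete Qm gm hm gh qgh.
have [|U [V UV]] := comaximal red_alg R_complete Gm Hm.
  by rewrite Gg Hh.
have [|U' [V' UV']] := comaximal red_alg R_complete Pm Hm.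
  rewrite Hh coprimep_sym; apply: coprime_roots => z /rooth.
  by [].
have /choice[W WP] : forall k, exists W, exists W', (k1 <= k)%N ->
    W * G + W' * shift_poly P k = 1.
  move=> k; have [k1k|_] := leqP k1 k; last by exists 0, 0.
  have [|W [W' WW']] := comaximal red_alg R_complete Gm (shift_poly_monic k Pm).
    rewrite Gg; apply: coprime_roots => z /rootg; apply: shifts_disjoint.
    exact: ltnW.
  by exists W, W'.
(* [H] has no root of [p], so it is comaximal with [P]; as [P] and [Q = G H] both kill the lattice
   modulo x, so does [G]. *)
have Qe1 w : lfilt e 0 w -> lfilt e 1 (act G w).
  move=> w0; rewrite -[act G w]act1 -UV' actDl; apply: ZD.
    by rewrite -actM mulrAC actM; apply/Zact/P01.
  rewrite -actM -mulrA [H * G]mulrC -QGH actM; apply: Zact.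
  by apply: lfilt_le (Qk1 _ w0); lia.
(* Congruent to [e i] modulo x, since the other part [U G (e i)] vanishes there by [Qe1]. *)
pose w0 := act (V * H) (e i).
(* As [W G + W' P(X - k) = 1], each correction replaces [G u] by [W' P(X - k) (G u)], which is one
   order higher. *)
pose u := fix u t := if t is t'.+1
  then u t' - act (W (k1 + t')%N * G) (u t') else w0.
have uG t : lfilt e (k1 + t)%:Z (act G (u t)).
  elim: t => [|t IHt].
    rewrite addn0 /= /w0 -actM mulrCA -QGH actM; apply: Zact.
    exact/Qk1/lfilt_basis.
  have [W' WW'] := WP (k1 + t)%N.
  rewrite /= addnS actDr actNr act_comm; set y := act G (u t) in IHt *.
  have {1}-> : y = act (W (k1 + t)%N * G) y + act (W' * shift_poly P (k1 + t))
    y.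
    by rewrite -actDl WW' ?leq_addr // act1.
  by rewrite addrAC subrr add0r actM; apply/Zact/lfilt_shift_poly.
have uS t : lfilt e (k1 + t)%:Z (u t.+1 - u t).
  rewrite /= addrAC subrr add0r; apply: nabla_stableN => //.
  by rewrite actM; apply: Zact.
have [|v uv] := @lfilt_complete _ _ _ e u.
  by move=> t; apply: lfilt_le (uS t); lia.
exists v; split.
  exists G => //; apply: (lfilt_separated (e := e) R_noetherian) => t.
  rewrite -[v](subKr (u t)) actDr actNr; apply: ZD.
    by apply: lfilt_le (uG t); lia.
  by apply: nabla_stableN => //; apply: Zact.
rewrite -(subrK (u 1%N) (e i)) -addrA; apply: ZD; last exact: (uv 1%N).
rewrite -(subrK (u 0%N) (e i)) -addrA; apply: ZD; last first.
  rewrite -opprB; apply: nabla_stableN => //.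
  by apply: lfilt_le (uS 0%N); lia.
rewrite /= /w0 -[X in X - _]act1 -UV actDl addrK actM; apply/Zact/Qe1.
exact: lfilt_basis.
Qed.

End IntegralLift.

(** * Subconnections and base change *)

Section BijectiveHom.
Variables (R : comNzRingType) (A : diff_alg R) (M N : conn A).
Variable f : conn_hom M N.
Hypotheses (f_inj : forall u, f u = 0 -> u = 0).
Hypotheses (f_surj : forall v, exists u, f u = v).

Let g v : M := sval (cid (f_surj v)).
Let gK v : f (g v) = v. Proof. by rewrite /g; case: cid. Qed.
Let f_injective u v : f u = f v -> u = v.
Proof.
move=> fuv; apply: subr0_eq; apply: f_inj.
by apply: (addIr (f v)); rewrite -chomD subrK add0r.
Qed.

Fact chom_inv_linear : linear g.
Proof. by move=> a u v; apply: f_injective; rewrite chom_linear !gK. Qed.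
Fact chom_inv_nabla v : g (nabla v) = nabla (g v).
Proof. by apply: f_injective; rewrite chom_nabla !gK. Qed.
Definition chom_inv : conn_hom N M := ConnHom chom_inv_linear chom_inv_nabla.

Lemma chom_invK : chom_comp chom_inv f = chom_id M.
Proof. by apply: chom_ext => u; apply: f_injective; apply: gK. Qed.
Lemma chom_invKV : chom_comp f chom_inv = chom_id N.
Proof. by apply: chom_ext => u; apply: gK. Qed.

Definition chom_iso : iso (M : MC A) N :=
  @Iso (MC A) M N f chom_inv chom_invK chom_invKV.
End BijectiveHom.

Section SubConnection.
Variables (R : comNzRingType) (A B : diff_alg R) (phi : diff_mor A B).
Variable N : conn B.

(** Serves twice: for the integral part, over R[x, 1/x] inside R((x)), and for the two charts, over
    R[x] and R[y] inside R[x, 1/x]. *)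
Record subconn := Subconn {
  sub_set :> N -> Prop;
  sub0 : sub_set 0;
  subD : forall u v, sub_set u -> sub_set v -> sub_set (u + v);
  subZ : forall a u, sub_set u -> sub_set (phi a *: u);
  sub_nabla : forall u, sub_set u -> sub_set (nabla u);
  sub_fg : exists n (e : 'I_n -> N), (forall i, sub_set (e i)) /\
    forall u, sub_set u -> exists c : 'I_n -> A, u = \sum_i phi (c i) *: e i }.

Variable X : subconn.

Lemma subN u : X u -> X (- u).
Proof. by rewrite -scaleN1r -(rmorphN1 phi); apply: subZ. Qed.

Definition subconn_type := {u | X u}.
HB.instance Definition _ := gen_eqMixin subconn_type.
HB.instance Definition _ := gen_choiceMixin subconn_type.

Definition sub_val (u : subconn_type) : N := sval u.

Lemma sub_valP u : X (sub_val u). Proof. exact: svalP. Qed.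
Lemma sub_val_inj : injective sub_val.
Proof.
by case=> [u Xu] [v Xv]; rewrite /sub_val /= => uv; apply: eq_exist.
Qed.

Definition sub_mk u (Xu : X u) : subconn_type := exist _ u Xu.
Lemma sub_mkE u (Xu : X u) : sub_val (sub_mk Xu) = u. Proof. by []. Qed.

Let add (u v : subconn_type) := sub_mk (subD (sub_valP u) (sub_valP v)).
Let opp (u : subconn_type) := sub_mk (subN (sub_valP u)).
Let zero : subconn_type := sub_mk (sub0 X).
Let scale a (u : subconn_type) := sub_mk (subZ a (sub_valP u)).

Fact sub_addA : associative add.
Proof. by move=> u v w; apply: sub_val_inj; apply: addrA. Qed.
Fact sub_addC : commutative add.
Proof. by move=> u v; apply: sub_val_inj; apply: addrC. Qed.
Fact sub_add0 : left_id zero add.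
Proof. by move=> u; apply: sub_val_inj; apply: add0r. Qed.
Fact sub_addN : left_inverse zero opp add.
Proof. by move=> u; apply: sub_val_inj; apply: addNr. Qed.
HB.instance Definition _ := GRing.isZmodule.Build subconn_type
  sub_addA sub_addC sub_add0 sub_addN.

Fact sub_scaleA a b u : scale a (scale b u) = scale (a * b) u.
Proof.
apply: sub_val_inj; transitivity ((phi a * phi b) *: sub_val u).
  exact: scalerA.
by rewrite -rmorphM.
Qed.
Fact sub_scale1 : left_id 1 scale.
Proof.
move=> u; apply: sub_val_inj; transitivity (phi 1 *: sub_val u) => //.
by rewrite rmorph1 scale1r.
Qed.
Fact sub_scaleDr : right_distributive scale +%R.
Proof. by move=> a u v; apply: sub_val_inj; apply: scalerDr. Qed.
Fact sub_scaleDl u : {morph scale^~ u : a b / a + b}.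
Proof.
move=> a b; apply: sub_val_inj.
transitivity (phi (a + b) *: sub_val u) => //.
by rewrite rmorphD scalerDl.
Qed.
HB.instance Definition _ := GRing.Zmodule_isLmodule.Build A subconn_type
  sub_scaleA sub_scale1 sub_scaleDr sub_scaleDl.

Lemma sub_valD u v : sub_val (u + v) = sub_val u + sub_val v. Proof. by []. Qed.
Lemma sub_val0 : sub_val 0 = 0. Proof. by []. Qed.
Lemma sub_valZ a u : sub_val (a *: u) = phi a *: sub_val u. Proof. by []. Qed.
Lemma sub_val_sum (I : Type) (r : seq I) (P : pred I) (F : I -> subconn_type) :
  sub_val (\sum_(i <- r | P i) F i) = \sum_(i <- r | P i) sub_val (F i).
Proof. exact: (big_morph _ sub_valD sub_val0). Qed.

Fact sub_type_fg : fg_module subconn_type.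
Proof.
have [n [e [Xe eX]]] := sub_fg X; exists n, (fun i => sub_mk (Xe i)) => u.
have [c uE] := eX _ (sub_valP u); exists c; apply: sub_val_inj.
by rewrite sub_val_sum uE.
Qed.

Let snabla (u : subconn_type) := sub_mk (sub_nabla (sub_valP u)).
Fact snablaD : {morph snabla : u v / u + v}.
Proof. by move=> u v; apply: sub_val_inj; apply: nablaD. Qed.
Fact snablaZ (c : R) u : snabla (c%:A *: u) = c%:A *: snabla u.
Proof.
apply: sub_val_inj; transitivity (nabla (phi c%:A *: sub_val u)) => //.
by rewrite dm_alg nablaZ -(dm_alg phi).
Qed.
Fact snabla_leibniz (f : A) u : snabla (f *: u) = der f *: u + f *: snabla u.
Proof.
apply: sub_val_inj; transitivity (nabla (phi f *: sub_val u)) => //.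
by rewrite nabla_leibniz -dm_der.
Qed.

Definition sub_conn : conn A :=
  @Conn R A subconn_type sub_type_fg snabla snablaD snablaZ snabla_leibniz.

Lemma sub_val_nabla (u : sub_conn) : sub_val (nabla u) = nabla (sub_val u).
Proof. by []. Qed.

Fact counit_bal : balanced phi (fun (b : B) (u : sub_conn) => b *: sub_val u).
Proof.
split=> [b b' u|b u v|b a u]; first by rewrite scalerDl.
  by rewrite scalerDr.
by rewrite sub_valZ scalerA.
Qed.
Definition counit_fun : bc_ob phi sub_conn -> N :=
  tens_lift (fun b (u : sub_conn) => b *: sub_val u).
Lemma counitE b (u : sub_conn) : counit_fun (tens phi b u) = b *: sub_val u.
Proof. exact: tens_liftE counit_bal _ _. Qed.
Lemma counitD : {morph counit_fun : x y / x + y}.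
Proof. exact: tens_liftD counit_bal. Qed.
Fact counit_linear : linear counit_fun.
Proof.
move=> c x y; rewrite counitD; congr (_ + _); move: x.
apply: tens_ext => [x x'|x x'|b u].
- by rewrite scalerDr counitD.
- by rewrite counitD scalerDr.
- by rewrite scale_tens !counitE scalerA.
Qed.
Fact counit_nabla x : counit_fun (nabla x) = nabla (counit_fun x).
Proof.
move: x; apply: tens_ext => [x y|x y|b u].
- by rewrite nablaD counitD.
- by rewrite counitD nablaD.
- by rewrite nabla_bcE counitD !counitE nabla_leibniz sub_val_nabla.
Qed.
Definition counit : conn_hom (bc_ob phi sub_conn) N :=
  ConnHom counit_linear counit_nabla.

End SubConnection.

Lemma sum_enum_val (V : zmodType) (I : finType) (F : I -> V) :
  \sum_i F i = \sum_(k < #|I|) F (enum_val k).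
Proof. by rewrite (reindex _ (onW_bij _ (enum_val_bij I))). Qed.

(** * Counits along a localisation *)

Section Localisation.
Variables (R : comNzRingType) (A B : diff_alg R) (phi : diff_mor A B).
(** Common denominators for finite families. *)
Hypothesis phi_loc : forall n (b : 'I_n ->
  B), exists (u u' : B) (a : 'I_n -> A),
  u' * u = 1 /\ forall i, u * b i = phi (a i).
Variables (N : conn B) (X : subconn phi N).

(** Up to a unit, [t] is a pure tensor [tens phi 1 l], and [l] is determined by its image in [N]. *)
Lemma counit_loc_inj t : counit X t = 0 -> t = 0.
Proof.
move=> t0; have [n [e eX]] := sub_type_fg X.
have [f tE] := tens_span (phi := phi) eX t.
have [u [u' [a [uu ua]]]] := phi_loc f.
pose l : sub_conn X := \sum_i a i *: e i.
have ut : u *: t = tens phi 1 l.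
  rewrite tE scaler_sumr (big_morph _ (tensDr phi 1) (tens0r phi (sub_conn X)
    1)).
  apply: eq_bigr => i _; rewrite tensZ mul1r scalerA ua.
  by rewrite scale_tens mulr1.
have : counit X (tens phi 1 l) = 0 by rewrite -ut chomZ t0 scaler0.
rewrite [LHS]counitE scale1r => l0.
have {}l0 : l = 0 by apply: sub_val_inj.
by rewrite -[t]scale1r -uu -scalerA ut l0 tens0r scaler0.
Qed.

Lemma counit_loc_iso (X_gen : forall v, exists n (b : 'I_n ->
  B) (u : 'I_n -> N),
    (forall i, X (u i)) /\ v = \sum_i b i *: u i) :
  isomorphic (base_change phi (sub_conn X)) (N : MC B).
Proof.
split; apply: (chom_iso (f := counit X)) counit_loc_inj _ => v.
have [n [b [u [Xu ->]]]] := X_gen v.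
exists (\sum_i tens phi (b i) (sub_mk (Xu i) : sub_conn X)).
by rewrite chom_sum; apply: eq_bigr => i _; apply: counitE.
Qed.

End Localisation.

Section SpanSubconnection.
Variables (R : comNzRingType) (A B : diff_alg R) (phi : diff_mor A B).
Variables (N : conn B) (I : finType) (w : I -> N) (c : I -> I -> A).
Hypothesis w_nabla : forall i, nabla (w i) = \sum_j phi (c i j) *: w j.

Let S (u : N) := exists a : I -> A, u = \sum_i phi (a i) *: w i.

Fact span_sub0 : S 0.
Proof.
by exists (fun=> 0); rewrite big1 // => i _; rewrite rmorph0 scale0r.
Qed.
Fact span_subD u v : S u -> S v -> S (u + v).
Proof.
move=> [a ->] [b ->]; exists (fun i => a i + b i); rewrite -big_split.
by apply: eq_bigr => i _; rewrite rmorphD scalerDl.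
Qed.
Fact span_subZ a u : S u -> S (phi a *: u).
Proof.
move=> [b ->]; exists (fun i => a * b i); rewrite scaler_sumr.
by apply: eq_bigr => i _; rewrite scalerA rmorphM.
Qed.
Fact span_sub_nabla u : S u -> S (nabla u).
Proof.
move=> [a ->]; rewrite nabla_sum.
exists (fun j => der (a j) + \sum_i a i * c i j).
under eq_bigr do rewrite nabla_leibniz w_nabla scaler_sumr.
rewrite big_split exchange_big -big_split; apply: eq_bigr => j _ /=.
rewrite rmorphD scalerDl dm_der rmorph_sum scaler_suml; congr (_ + _).
by apply: eq_bigr => i _; rewrite scalerA rmorphM.
Qed.
Fact span_sub_fg : exists n (e : 'I_n -> N), (forall i, S (e i)) /\
  forall u, S u -> exists a : 'I_n -> A, u = \sum_i phi (a i) *: e i.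
Proof.
exists #|I|, (fun k => w (enum_val k)); split.
  move=> k; exists (fun i => (i == enum_val k)%:R).
  rewrite (bigD1 (enum_val k)) //= eqxx rmorph1 scale1r big1 ?addr0 // => i.
  by move=> /negPf->; rewrite rmorph0 scale0r.
move=> _ [a ->]; exists (fun k => a (enum_val k)).
exact: sum_enum_val.
Qed.
Definition span_subconn : subconn phi N :=
  Subconn span_sub0 span_subD span_subZ span_sub_nabla span_sub_fg.

Lemma span_subconn_mem i : span_subconn (w i).
Proof.
exists (fun j => (j == i)%:R).
rewrite (bigD1 i) //= eqxx rmorph1 scale1r big1 ?addr0 // => j.
by move=> /negPf->; rewrite rmorph0 scale0r.
Qed.
End SpanSubconnection.

(** * Regular singular connections on the projective line *)

Section Charts.
Variable R : comNzRingType.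

Lemma lpXnM (d d' : int) : lpXn R d * lpXn R d' = lpXn R (d + d').
Proof. by apply: val_inj; apply: lmonomM. Qed.

Lemma lpXnX (d : int) (k : nat) : lpXn R d ^+ k = lpXn R (d * k%:Z).
Proof.
elim: k => [|k IHk]; first by rewrite expr0 mulr0; apply: val_inj.
by rewrite exprS IHk lpXnM; congr lpXn; lia.
Qed.

Lemma horner_alg_lpXn d n (E : nat -> R) :
  horner_alg (lpXn R d) (\poly_(i < n) E i) =
  \sum_(i < n) E i *: lpXn R (d * i%:Z).
Proof.
rewrite poly_def raddf_sum; apply: eq_bigr => i _.
by rewrite /= linearZ /= rmorphXn /= horner_algX lpXnX mulr_algl.
Qed.

Lemma lpoly_val_sum (I : Type) (r : seq I) (P : pred I) (F : I -> lpoly R) :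
  (\sum_(i <- r | P i) F i : laurent R) =
  \sum_(i <- r | P i) (F i : laurent R).
Proof. exact: (big_morph (@lpoly_val R)). Qed.

Lemma lpoly_coef_sum (I : Type) (r : seq I) (P : pred I) (F : I -> lpoly R) n :
  (\sum_(i <- r | P i) F i : laurent R) n =
  \sum_(i <- r | P i) (F i : laurent R) n.
Proof. by rewrite lpoly_val_sum lcoef_sum. Qed.

Lemma poly0_lpoly_lge p : lge 0 (poly0_lpoly R p : laurent R).
Proof.
rewrite /= -[p]coefK horner_alg_lpXn lpoly_val_sum; apply: lge_sum => i _.
by apply: lgeZ; apply: lge_le (@lge_monom R _); lia.
Qed.

Lemma polyinf_lpoly_lle p : lle 0 (polyinf_lpoly R p : laurent R).
Proof.
rewrite /= -[p]coefK horner_alg_lpXn lpoly_val_sum; apply: lle_sum => i _.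
by apply: lleZ; apply: lle_le (@lle_monom R _); lia.
Qed.

Lemma lpoly_sumE a n (f : lpoly R) : lge a f -> lle (a + n%:Z) f ->
  f = \sum_(i < n.+1) (f : laurent R) (a + i%:Z) *: lpXn R (a + i%:Z).
Proof.
move=> fa fb; apply/val_inj/lcoefP => k; rewrite lpoly_coef_sum.
have [ka|ak] := ltP k a.
  rewrite fa // big1 // => i _; rewrite [LHS]lcoefZ [lmonom _ _ _]lmonomE.
  by rewrite lt_eqF ?mulr0 //; lia.
have [bk|kb] := ltP (a + n%:Z) k.
  rewrite fb // big1 // => i _; rewrite [LHS]lcoefZ [lmonom _ _ _]lmonomE.
  by rewrite gt_eqF ?mulr0 //; have := ltn_ord i; lia.
have kn : (`|k - a| < n.+1)%N by lia.
rewrite (bigD1 (Ordinal kn)) //= big1 ?addr0 => [|i ik].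
  by rewrite (_ : a + `|k - a|%N%:Z = k) ?eqxx ?mulr1 //; lia.
case: eqP => [kE|_]; last first.
  by rewrite mulr0.
case/negP: ik; apply/eqP/val_inj; rewrite /=; lia.
Qed.

Lemma poly0_loc n (b : 'I_n -> lpoly R) :
  exists (u u' : lpoly R) (a : 'I_n -> {poly R}),
  u' * u = 1 /\ forall i, u * b i = poly0_lpoly R (a i).
Proof.
have [N bN] := lge_common b; have [m bm] := lle_common b.
exists (lpXn R N%:Z), (lpXn R (- N%:Z)).
exists (fun i => \poly_(k < (N + m).+1) (lpXn R N%:Z * b i : laurent R) k%:Z).
split; first by rewrite lpXnM addNr; apply: val_inj.
move=> i; rewrite [RHS]horner_alg_lpXn.
have lo := lgeM (@lge_monom R N%:Z) (bN i); rewrite subrr in lo.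
have hi : lle (0 + (N + m)%N%:Z) (lpXn R N%:Z * b i).
  by have := lleM (@lle_monom R N%:Z) (bm i); rewrite add0r PoszD.
rewrite [LHS](lpoly_sumE (f := lpXn R N%:Z * b i) lo hi); apply: eq_bigr => k _.
by rewrite add0r mul1r.
Qed.

Lemma polyinf_loc n (b : 'I_n -> lpoly R) :
  exists (u u' : lpoly R) (a : 'I_n -> {poly R}),
  u' * u = 1 /\ forall i, u * b i = polyinf_lpoly R (a i).
Proof.
have [N bN] := lge_common b; have [m bm] := lle_common b.
exists (lpXn R (- m%:Z)), (lpXn R m%:Z).
exists (fun i => \poly_(k < (N + m).+1) (lpXn R (- m%:Z) * b i :
  laurent R) (- k%:Z)).
split; first by rewrite lpXnM subrr; apply: val_inj.
move=> i; rewrite [RHS]horner_alg_lpXn.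
have lo := lgeM (@lge_monom R (- m%:Z)) (bN i).
have hi : lle (- m%:Z - N%:Z + (N + m)%N%:Z) (lpXn R (- m%:Z) * b i).
  have := lleM (@lle_monom R (- m%:Z)) (bm i).
  by rewrite (_ : - m%:Z + m%:Z = - m%:Z - N%:Z + (N + m)%N%:Z) //; lia.
rewrite [LHS](lpoly_sumE (f :=
  lpXn R (- m%:Z) * b i) lo hi) (reindex_inj rev_ord_inj) /=.
apply: eq_bigr => k _.
have -> : - m%:Z - N%:Z + ((N + m).+1 - k.+1)%N%:Z = - k%:Z.
  by have := ltn_ord k; lia.
by rewrite mulN1r.
Qed.

End Charts.

(** * Regular singularity as integrality *)

Section RegularSingularIntegral.
Variables (C : closedFieldType) (R : comAlgType C).
Hypothesis R_noetherian : noetherian R.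
Variable N : conn (diff_lpoly R).

(** The iterates of nabla of order below [D] on the generators span a nabla-stable [R]-module
    generating [N]. Its spans over R[x] and R[y] are the two charts; they glue because both localise
    to [N]. *)
Lemma integral_rs_lpoly : (forall u : N, nabla_integral u) -> rs_lpoly N.
Proof.
move=> N_int; have [n [e eN]] := conn_fg N.
have /choice[P PP] : forall i, exists P, P \is monic /\ act P (e i) = 0.
  by move=> i; have [P Pm Pe] := N_int (e i); exists P.
pose Q := \prod_i P i; pose D := (size Q).-1.
have Qm : Q \is monic by apply: monic_prod => i _; have [] := PP i.
have sQ : size Q = D.+1 by rewrite prednK // size_poly_gt0 monic_neq0.
have Qe i : act Q (e i) = 0.
  rewrite /Q (bigD1 i) //= mulrC actM; have [_ ->] := PP i.
  by rewrite act0r.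
have QD i : iter D nabla (e i) = \sum_(j < D) (- Q`_j)%:A *: iter j nabla (e i).
  have := Qe i; rewrite /act sQ big_ord_recr /=.
  have -> : Q`_D = 1 by have := monicP Qm; rewrite /lead_coef.
  rewrite !scale1r addrC => /eqP; rewrite addr_eq0 => /eqP->.
  by rewrite -sumrN; apply: eq_bigr => j _; rewrite !scaleNr.
pose I := ('I_n * 'I_D)%type.
pose w (p : I) : N := iter p.2 nabla (e p.1).
(* Companion matrix of [Q], one block per generator. *)
pose c (p q : I) : R := if q.1 == p.1 then
   if (p.2.+1 < D)%N then (q.2 == p.2.+1 :> nat)%:R else - Q`_q.2 else 0.
have w_nabla p : nabla (w p) = \sum_q (c p q)%:A *: w q.
  case: p => i j; rewrite /w -iterS /=.
  rewrite -(pair_bigA _ (fun i' j' => (c (i, j) (i', j'))%:A *: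
    iter j' nabla (e i'))) /= (bigD1 i) //= [X in _ + X]big1 ?addr0; last first.
    move=> i' /negPf i'i; rewrite big1 // => j' _.
    by rewrite /c /= i'i !scale0r.
  rewrite /c /= eqxx; case: ltnP => [jD|Dj].
    rewrite (bigD1 (Ordinal jD)) //= eqxx !scale1r big1 ?addr0 // => j' jj.
    by rewrite (_ : (_ == _) = false) ?scale0r // ; apply/negbTE.
  transitivity (iter D nabla (e i)); last by rewrite QD.
  have jD : j.+1 = D by apply/eqP; rewrite eqn_leq Dj ltn_ord.
  exact: (congr1 (fun k => iter k nabla (e i)) jD).
have chart (A : diff_alg R) (phi : diff_mor A (diff_lpoly R)) :
    (forall n (b : 'I_n -> lpoly R), exists (u u' : lpoly R) (a : 'I_n -> A),
      u' * u = 1 /\ forall i, u * b i = phi (a i)) ->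
    exists L : conn A, isomorphic (base_change phi L) (N : MC (diff_lpoly R)).
  move=> loc.
  have wA p : nabla (w p) = \sum_q phi (c p q)%:A *: w q.
    by rewrite w_nabla; apply: eq_bigr => q _; rewrite dm_alg.
  exists (sub_conn (span_subconn wA)); apply: counit_loc_iso => // v.
  have [f ->] := eN v; exists n, f, e; split=> // i.
  (* For [D = 0] the family [w] is empty, but then [Q = 1] and the [e i] are 0. *)
  have [D0|D0] := posnP D.
    suff -> : e i = 0 by apply: span_sub0.
    by have := QD i; rewrite D0 big_ord0.
  exact: (span_subconn_mem wA (i, Ordinal D0)).
have [L0 L0N] := chart _ (poly0_lpoly R) (@poly0_loc R).
have [Li LiN] := chart _ (polyinf_lpoly R) (@polyinf_loc R).
have [glue] := isomorphic_trans L0N (isomorphic_sym LiN).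
by exists (MClogP1 glue); apply: isomorphic_sym.
Qed.

(** The chart at 0 bounds the order of all iterates of nabla on [u] from below, the chart at
    infinity their degree from above: they are sections of one twist of a coherent sheaf, and lie in
    a finitely generated [R]-module. *)
Lemma rs_lpoly_integral : rs_lpoly N -> forall u : N, nabla_integral u.
Proof.
move=> [L NL].
have [n [e [c [eN e_nabla]]]] := base_change_frame NL.
have [n' [e' [c' [eN' e_nabla']]]] :=
  base_change_frame (isomorphic_trans NL (inhabits (log_glue L))).
have /choice[b bE] := fun j => eN (e' j).
have [d bd] : exists d : nat, forall j i, lle d%:Z (b j i).
  have /choice[d dP] : forall j, exists d : nat, forall i, lle d%:Z (b j i).
    by move=> j; apply: lle_common.
  exists (\max_j d j) => j i; apply: lle_le (dP j i).
  by have := leq_bigmax (F := d) j; lia.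
move=> u; have [f fE] := eN u; have [g gE] := eN' u.
have [lo flo] := lge_common f; have [hi ghi] := lle_common g.
pose G (v : N) := (exists f : 'I_n -> lpoly R,
    (forall i, lge (- lo%:Z) (f i)) /\ v = \sum_i f i *: e i) /\
  exists g : 'I_n' -> lpoly R,
    (forall i, lle hi%:Z (g i)) /\ v = \sum_i g i *: e' i.
have G_nabla v : G v -> G (nabla v).
  move=> [[h [hlo vh]] [k [khi vk]]]; split.
    exists (fun j => lpoly_theta (h j) + \sum_i h i * poly0_lpoly R (c i j)).
    split=> [j|].
      apply: (lgeD (lge_theta (hlo j))); rewrite /= lpoly_val_sum;
        apply: lge_sum => i _.
      by have := lgeM (hlo i) (poly0_lpoly_lge (c i j)); rewrite addr0.
    rewrite vh nabla_sum.
    under eq_bigr do rewrite nabla_leibniz e_nabla scaler_sumr.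
    rewrite big_split exchange_big -big_split; apply: eq_bigr => j _ /=.
    rewrite scalerDl scaler_suml; congr (_ + _).
    by apply: eq_bigr => i _; rewrite scalerA.
  exists (fun j => lpoly_theta (k j) + \sum_i k i * polyinf_lpoly R (c' i j)).
  split=> [j|].
    apply: (lleD (lle_theta (khi j))); rewrite /= lpoly_val_sum;
      apply: lle_sum => i _.
    by have := lleM (khi i) (polyinf_lpoly_lle (c' i j)); rewrite addr0.
  rewrite vk nabla_sum.
  under eq_bigr do rewrite nabla_leibniz e_nabla' scaler_sumr.
  rewrite big_split exchange_big -big_split; apply: eq_bigr => j _ /=.
  rewrite scalerDl scaler_suml; congr (_ + _).
  by apply: eq_bigr => i _; rewrite scalerA.
have Gu k : G (iter k nabla u).
  elim: k => [|k IHk]; last by rewrite iterS; apply: G_nabla.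
  by split; [exists f|exists g].
(* Degrees are at most [hi] on [e']; writing [e'] in terms of [e] adds at most [d]. *)
have [D DP] := lpoly_bounded R_noetherian e (- lo%:Z) (hi%:Z + d%:Z).
pose m := `|(D + lo%:Z)%R|%N.
pose w (k : 'I_#|{: 'I_n * 'I_m.+1}|) : N :=
  lpXn R (- lo%:Z + (enum_val k).2%:Z) *: e (enum_val k).1.
have [|P Pm Pu] := monic_act_of_span (w := w) (v :=
  u) R_noetherian (nabla_stable0 N).
  move=> k; have [[h [hlo vh]] [l [lhi vl]]] := Gu k.
  have [||h' [h'lo h'hi h'E]] := DP _ _ (fun i => \sum_j l j * b j i) hlo vh.
  - move=> i; rewrite /= lpoly_val_sum; apply: lle_sum => j _.
    exact: lleM (lhi j) (bd j i).
  - rewrite vl; under eq_bigr do rewrite bE scaler_sumr.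
    rewrite exchange_big; apply: eq_bigr => i _.
    by rewrite scaler_suml; apply: eq_bigr => j _; rewrite scalerA.
  exists (fun k : 'I_#|{: 'I_n * 'I_m.+1}| =>
    (h' (enum_val k).1 : laurent R) (- lo%:Z + (enum_val k).2%:Z)).
  rewrite /= h'E; apply/eqP; rewrite subr_eq0; apply/eqP; rewrite /w.
  rewrite -(sum_enum_val (fun p : 'I_n * 'I_m.+1 =>
    ((h' p.1 : laurent R) (- lo%:Z + p.2%:Z))%:A *:
      (lpXn R (- lo%:Z + p.2%:Z) *: e p.1))) /=.
  rewrite -(pair_bigA _ (fun i j =>
    ((h' i : laurent R) (- lo%:Z + (j : 'I_m.+1)%:Z))%:A *:
      (lpXn R (- lo%:Z + j%:Z) *: e i))) /=.
  apply: eq_bigr => i _.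
  rewrite {1}(@lpoly_sumE R (- lo%:Z) m (h' i)) //; last first.
    by apply: lle_le (h'hi i); rewrite /m; lia.
  by rewrite scaler_suml; apply: eq_bigr => j _; rewrite scalerA mulr_algl.
by exists P.
Qed.

End RegularSingularIntegral.

(** * Homogeneous generators *)

Section Generators.
Variables (C : closedFieldType) (R : comAlgType C) (red : {rmorphism R -> C}).
Hypothesis red_alg : forall c, red c%:A = c.
Hypothesis R_complete : adic_complete [set a | red a = 0].
Variables (A : diff_alg R) (M : conn A).

Lemma homog_generators n (u : 'I_n -> M) : (forall i, nabla_integral (u i)) ->
  exists r (v : 'I_r -> M) (s : 'I_r -> C), (forall j, homog red (s j) (v j)) /\
    forall i, exists c : 'I_r -> A, u i = \sum_j c j *: v j.
Proof.
move=> /(fun h i => homog_decomp red_alg R_complete (h i))/choice[d dP].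
pose D := flatten [seq d i | i <- enum 'I_n].
exists (size D), (fun j => (tnth (in_tuple D) j).2),
  (fun j => (tnth (in_tuple D) j).1).
split=> [j|i].
  have /flattenP[_ /mapP[i _ ->] pd] := mem_tnth j (in_tuple D).
  by have [dh _] := dP i; apply: dh.
have [_ ->] := dP i; rewrite big_seq.
pose S (w : M) := exists c : 'I_(size D) -> A,
  w = \sum_j c j *: (tnth (in_tuple D) j).2.
apply: (big_ind S) => [|_ _ [c ->] [c' ->]|p pd].
- by exists (fun=> 0); rewrite big1 // => j _; rewrite scale0r.
- exists (fun j => c j + c' j); rewrite -big_split.
  by apply: eq_bigr => j _; rewrite scalerDl.
have /(tnthP (in_tuple D))[j ->] : p \in D.
  by apply/flattenP; exists (d i) => //; rewrite map_f // mem_enum.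
exists (fun k => (k == j)%:R).
rewrite (bigD1 j) //= eqxx scale1r big1 ?addr0 // => k /negPf->.
by rewrite scale0r.
Qed.

End Generators.

(** * Frames with normalised exponents *)

Section LaurentFrame.
Variables (C : closedFieldType) (R : comAlgType C) (red : {rmorphism R -> C}).
Hypothesis red_alg : forall c, red c%:A = c.
Hypothesis R_complete : adic_complete [set a | red a = 0].
Hypothesis R_noetherian : noetherian R.
Hypothesis charC : [pchar C] =i pred0.

(* Depends only on the class of [a] modulo the integers, as [xget] depends only
   on the set it is given. *)
Definition int_rep (a : C) : C :=
  xget 0 [set b | exists n : int, b = a + n%:~R]%classic.

Lemma int_repP a : exists n : int, int_rep a = a + n%:~R.
Proof.
rewrite /int_rep; case: xgetP => [b _ []|/(_ a)[]]; first by move=> n ->;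
  exists n.
by exists 0; rewrite addr0.
Qed.

Lemma int_rep_shift a (n : int) : int_rep (a + n%:~R) = int_rep a.
Proof.
congr xget; apply/seteqP; split=> b /= [m ->].
  by exists (n + m); rewrite intrD addrA.
by exists (m - n); rewrite rmorphB /=; ring.
Qed.

(** Then, in characteristic 0, x^m [v i] and x^k [v j] can share an exponent only for [m = k]. *)
Definition normalised r (s : 'I_r -> C) :=
  forall i j (n : int), s i = s j + n%:~R -> s i = s j.

Section Frame.
Variable M : conn (diff_laurent R).

(** Integral vectors congruent to lattice generators modulo x still generate; their homogeneous
    parts are then multiplied by powers of x to normalise the exponents. *)
Lemma laurent_frame : rs_laurent M -> exists r (v : 'I_r -> M) (s : 'I_r -> C),
  [/\ forall i, homog red (s i) (v i), normalised s &
      forall u, exists f : 'I_r -> laurent R, u = \sum_i f i *: v i].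
Proof.
move=> /rs_laurent_lattice[n [e eM]].
have /choice[y yP] := lattice_integral_lift red_alg R_complete R_noetherian
  charC eM.
have [|r [v [s [sv vy]]]] := homog_generators red_alg R_complete (u := y).
  by move=> i; have [] := yP i.
have /choice[k kP] := fun i => int_repP (s i).
exists r, (fun i => lmonom R (k i) *: v i), (fun i => int_rep (s i)); split.
- by move=> i; rewrite kP; apply: homog_monom.
- move=> i j m; have [p pi] := int_repP (s i); have [q qj] := int_repP (s j).
  rewrite {1}pi {1}qj => /eqP; rewrite -subr_eq => /eqP sij.
  rewrite -(int_rep_shift (s i) p) -(int_rep_shift _ (- m)) rmorphN /=.
  have -> : s i + p%:~R - m%:~R = s j + q%:~R by [].
  exact: int_rep_shift.
- have span := lattice_approx_span eM R_noetherian (v := y).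
  move=> u; have [|f ->] := span _ u; first by move=> i; have [] := yP i.
  have /choice[c cE] := vy.
  exists (fun j => \sum_i f i * c i j * lmonom R (- k j)).
  under eq_bigr do rewrite cE scaler_sumr.
  rewrite exchange_big; apply: eq_bigr => j _; rewrite scaler_suml.
  apply: eq_bigr => i _; rewrite !scalerA -[f i * c i j * _ * _]mulrA lmonomM.
  by rewrite addNr mulr1.
Qed.

(** By normalisation, the component of exponent [s i0 + m] of the relation is x^m times the sum of
    the [(f i m)%:A *: v i] with [s i = s i0]. *)
Lemma relation_coef n (e : 'I_n -> M) r (v : 'I_r -> M) (s : 'I_r -> C)
    (f : 'I_r -> laurent R) : is_lattice e ->
  (forall i, homog red (s i) (v i)) -> normalised s ->
  \sum_i f i *: v i = 0 -> forall m : int, \sum_i (f i m)%:A *: v i = 0.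
Proof.
move=> eM sv sn fv m; rewrite (sum_by_value s) big1_seq // => t /andP[_].
rewrite mem_undup => /mapP[i0 _ ->].
have := homog_component red_alg R_complete R_noetherian charC
  (a := s i0 + m%:~R) (f := f) eM sv.
rewrite fv => /(_ (homog0 _ _ _))/esym comp0.
have := congr1 ( *:%R (lmonom R (- m))) comp0.
rewrite scaler0 scaler_sumr; apply: etrans; rewrite big_mkcond.
apply: eq_bigr => i _.
have [si|si] := eqVneq (s i) (s i0).
  rewrite si addrAC subrr add0r lcomp_int // scalerA; congr (_ *: _).
  have -> : (f i m *: lpXn R m : laurent R) = f i m *: lmonom R m by [].
  by rewrite -scalerAr lmonomM addNr.
have [[k [ik _]]|[_ ->]] := lcompP charC (s i0 + m%:~R - s i) (f i); last first.
  by rewrite scale0r scaler0.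
case/eqP: si; apply: (sn i i0 (m - k)); rewrite rmorphB /= -ik.
by ring.
Qed.

End Frame.
End LaurentFrame.

Lemma lpoly_ind (R : comNzRingType) (X : lpoly R -> Prop) :
  (forall f g, X f -> X g -> X (f + g)) ->
  (forall c d, X (c *: lpXn R d)) -> forall f, X f.
Proof.
move=> XD Xm f; have [lo flo] := Defs.lbound f.
have [hi fhi] : exists hi, lle hi (f : laurent R).
  by case: (f) => g /= /lpoly_predP.
rewrite (@lpoly_sumE R lo `|(hi - lo)%R|%N f) //; last first.
  by apply: lle_le fhi; lia.
by apply: (big_ind X) => // ; rewrite -(scale0r (lpXn R 0)).
Qed.

Section SubAct.
Variables (R : comNzRingType) (A B : diff_alg R) (phi : diff_mor A B).

Lemma sub_val_act (N : conn B) (X : subconn phi N) P (u : sub_conn X) :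
  sub_val (act P u) = act P (sub_val u).
Proof.
rewrite /act sub_val_sum; apply: eq_bigr => i _.
rewrite sub_valZ dm_alg; congr (_ *: _).
by elim: (nat_of_ord i) => //= k <-.
Qed.

Lemma tens1_act (M : conn A) P (u : M) :
  act P (tens phi 1 u : bc_ob phi M) = tens phi 1 (act P u).
Proof.
rewrite /act (big_morph _ (tensDr phi 1) (tens0r phi M 1)).
apply: eq_bigr => i _; rewrite tensZ mul1r dm_alg.
have tensE (c : B) (m : M) : tens phi c m = c *: tens phi 1 m.
  by rewrite scale_tens mulr1.
rewrite [RHS]tensE; congr (_ *: _); elim: (nat_of_ord i) => //= k ->.
by rewrite [LHS]nabla_bcE der1 tens0l add0r.
Qed.

End SubAct.

(** * The quasi-inverse *)

Section Equivalence.
Variables (C : closedFieldType) (R : comAlgType C) (red : {rmorphism R -> C}).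
Hypothesis red_alg : forall c, red c%:A = c.
Hypothesis R_complete : adic_complete [set a | red a = 0].
Hypothesis R_noetherian : noetherian R.
Hypothesis charC : [pchar C] =i pred0.
Local Notation phi := (lpoly_laurent R).

Section IntegralPart.
Variable M : conn (diff_laurent R).
Hypothesis M_rs : rs_laurent M.

Let X (u : M) : Prop := nabla_integral u.

Fact integral_lpolyZ a u : X u -> X (phi a *: u).
Proof.
move=> Xu; move: a; apply: lpoly_ind => [f g|c d].
  by rewrite rmorphD scalerDl; apply: nabla_integralD.
have -> : phi (c *: lpXn R d) *: u = c%:A *: (lmonom R d *: u).
  by rewrite scalerA mulr_algl.
by apply/nabla_integralZ/(nabla_integral_shift (n := d)) => //;
  apply: laurent_theta_monom.
Qed.

(** On a homogeneous frame, homogeneous vectors have Laurent polynomial coefficients by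
    [homog_component], and every integral vector is a sum of such vectors. *)
Fact integral_part_fg : exists n (e : 'I_n -> M), (forall i, X (e i)) /\
  forall u, X u -> exists c : 'I_n -> lpoly R, u = \sum_i phi (c i) *: e i.
Proof.
have [n [e eM]] := rs_laurent_lattice M_rs.
have [r [v [s [sv _ vM]]]] :=
  laurent_frame red_alg R_complete R_noetherian charC M_rs.
exists r, v; split; first by move=> i; apply: homog_integral (sv i).
apply: (homog_ind red_alg R_complete) => [|_ _ [c ->] [d ->]|a u au].
- by exists (fun=> 0); rewrite big1 // => i _; rewrite rmorph0 scale0r.
- exists (fun i => c i + d i); rewrite -big_split.
  by apply: eq_bigr => i _; rewrite rmorphD scalerDl.
have [f uE] := vM u; exists (fun i => lcomp (a - s i) (f i)).
rewrite uE in au *.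
exact: (homog_component red_alg R_complete R_noetherian charC eM sv au).
Qed.

Definition integral_part : subconn phi M := @Subconn _ _ _ phi M X
  (@nabla_integral0 _ _ M) (@nabla_integralD _ _ M) integral_lpolyZ
    (@nabla_integral_nabla _ _ M)
  integral_part_fg.

Lemma integral_part_integral (u : sub_conn integral_part) : nabla_integral u.
Proof.
have [P Pm Pu] := sub_valP u; exists P => //.
by apply: sub_val_inj; rewrite sub_val_act Pu.
Qed.

Lemma integral_part_rs : rs_lpoly (sub_conn integral_part).
Proof. exact: integral_rs_lpoly integral_part_integral. Qed.

Lemma integral_part_counit_surj u : exists t, counit integral_part t = u.
Proof.
have [r [v [s [sv _ vM]]]] :=
  laurent_frame red_alg R_complete R_noetherian charC M_rs.
have Xv i : integral_part (v i) by apply: homog_integral (sv i).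
have [f ->] := vM u.
exists (\sum_i tens phi (f i) (sub_mk (Xv i) : sub_conn integral_part)).
by rewrite chom_sum; apply: eq_bigr => i _; apply: counitE.
Qed.

(* The R-linear relations among the homogeneous generators [v i] are finitely
   generated by some [g j]; the coefficients of x ^ m in a relation over R((x))
   form such a relation, hence the relation is an R((x))-combination [h] of the
   [g j], which already vanish in the tensor product. *)
Lemma integral_part_counit_inj t : counit integral_part t = 0 -> t = 0.
Proof.
have [n [e eM]] := rs_laurent_lattice M_rs.
have [r [v [s [sv sn vM]]]] :=
  laurent_frame red_alg R_complete R_noetherian charC M_rs.
have Xv i : integral_part (v i) by apply: homog_integral (sv i).
pose w i : sub_conn integral_part := sub_mk (Xv i).
have wX (u : sub_conn integral_part) : exists c : 'I_r -> lpoly R,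
    u = \sum_i c i *: w i.
  suff [c cE] : exists c : 'I_r -> lpoly R, sub_val u = \sum_i phi (c i) *: v i.
    by exists c; apply: sub_val_inj; rewrite sub_val_sum cE.
  have := sub_valP u; move: (sub_val u).
  apply: (homog_ind red_alg R_complete) => [|_ _ [c ->] [d ->]|a y ay].
  - by exists (fun=> 0); rewrite big1 // => i _; rewrite rmorph0 scale0r.
  - exists (fun i => c i + d i); rewrite -big_split.
    by apply: eq_bigr => i _; rewrite rmorphD scalerDl.
  have [f yE] := vM y; exists (fun i => lcomp (a - s i) (f i)).
  rewrite yE in ay *.
  exact: (homog_component red_alg R_complete R_noetherian charC eM sv ay).
have [f tE] := tens_span (phi := phi) wX t.
move=> t0.
have fv : \sum_i f i *: v i = 0.
  transitivity (counit integral_part t) => //; rewrite tE chom_sum;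
    apply: eq_bigr => i _.
  by rewrite chomZ [counit _ _]counitE scale1r.
have fm := relation_coef red_alg R_complete R_noetherian charC eM sv sn fv.
pose U : set 'rV[R]_r := [set c | \sum_i (c 0 i)%:A *: v i = 0].
have [|q [g [gU gP]]] := rV_submodule_fg R_noetherian (U := U).
  split=> [|c d|a c]; rewrite /U /=.
  - by rewrite big1 // => i _; rewrite mxE !scale0r.
  - move=> c0 d0; transitivity
      (\sum_i (c 0 i)%:A *: v i + \sum_i (d 0 i)%:A *: v i).
      by rewrite -big_split; apply: eq_bigr => i _; rewrite mxE !scalerDl.
    by rewrite c0 d0 addr0.
  - move=> c0; transitivity (a%:A *: \sum_i (c 0 i)%:A *: v i).
      rewrite scaler_sumr; apply: eq_bigr => i _.
      by rewrite mxE scalerA mulr_algl scalerA.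
    by rewrite c0 scaler0.
(* The choice must send 0 to 0, so that the [h1 j m] vanish for very negative [m] and form Laurent
   series. *)
have /choice[h0 h0P] : forall c, exists h : 'I_q -> R,
    (c = 0 -> h = fun=> 0) /\ (U c -> c = \sum_j h j *: g j).
  move=> c; have [->|c0] := eqVneq c 0.
    by exists (fun=> 0); split=> // _; rewrite big1 // => j _; rewrite scale0r.
  have [/gP[h hE]|nU] := pselect (U c); last first.
    by exists (fun=> 0); split=> // c0'; rewrite c0' eqxx in c0.
  by exists h; split=> // c0'; rewrite c0' eqxx in c0.
pose h1 j (m : int) := h0 (\row_i f i m) j.
have [N fN] := lge_common f.
have h1N j m : m < - N%:Z -> h1 j m = 0.
  move=> mN; rewrite /h1 (_ : \row_i f i m = 0).
    by have [-> //] := h0P 0.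
  by apply/rowP => i; rewrite !mxE fN.
have h1_laurent j : h1 j \in @laurent_pred R.
  by apply/laurent_predP; exists (- N%:Z); apply: h1N.
pose h j := Laurent (h1_laurent j).
have fE i : f i = \sum_j g j 0 i *: h j.
  apply: lcoefP => m; rewrite lcoef_sum.
  have [_ /(_ _)hm] := h0P (\row_i f i m).
  have /hm/(congr1 (fun c : 'rV[R]_r => c 0 i)) : U (\row_i f i m).
    by rewrite /U /= -[RHS](fm m); apply: eq_bigr => k _; rewrite mxE.
  rewrite mxE summxE => ->; apply: eq_bigr => j _.
  by rewrite mxE lcoefZ mulrC.
rewrite tE; under eq_bigr do rewrite fE scaler_suml.
rewrite exchange_big big1 // => j _.
transitivity (h j *: tens phi 1 (\sum_i (g j 0 i)%:A *: w i)).
  rewrite (big_morph _ (tensDr phi 1) (tens0r phi (sub_conn integral_part) 1)).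
  rewrite scaler_sumr; apply: eq_bigr => i _.
  rewrite tensZ mul1r !scale_tens mulr1 dm_alg.
  by rewrite mulrC mulr_algl.
rewrite (_ : \sum_i _ = 0) ?tens0r ?scaler0 //.
apply: sub_val_inj; rewrite sub_val_sum -[RHS](gU j).
by apply: eq_bigr => i _; rewrite sub_valZ dm_alg.
Qed.

Definition integral_part_iso :
    iso (base_change phi (sub_conn integral_part)) (M : MC (diff_laurent R)) :=
  chom_iso integral_part_counit_inj integral_part_counit_surj.

End IntegralPart.
End Equivalence.

(** * The unit of the equivalence *)

Section Unit.
Variables (C : closedFieldType) (R : comAlgType C) (red : {rmorphism R -> C}).
Hypothesis red_alg : forall c, red c%:A = c.
Hypothesis R_complete : adic_complete [set a | red a = 0].
Hypothesis R_noetherian : noetherian R.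
Hypothesis charC : [pchar C] =i pred0.
Local Notation phi := (lpoly_laurent R).

Lemma lcompD a f g : lcomp a (f + g) = lcomp a f + lcomp a g :> lpoly R.
Proof.
apply/val_inj/lcoefP => n; rewrite [RHS]lcoefD !(lcomp_coef charC) lcoefD.
by case: ifP; rewrite ?addr0.
Qed.

Lemma lcomp_mul_monom a (f : laurent R) c d :
  lcomp a (f * (c *: lmonom R d)) = (c *: lpXn R d) * lcomp (a - d%:~R) f.
Proof.
apply/val_inj/lcoefP => n.
rewrite (lcomp_coef charC) mulrC -scalerAl lcoefZ lmonomME.
rewrite -[RHS]/((c *: lmonom R d * (lcomp (a - d%:~R) f : laurent R)) n).
rewrite -scalerAl lcoefZ lmonomME (lcomp_coef charC) rmorphB /=.
by rewrite (inj_eq (addIr _)); case: ifP; rewrite ?mulr0.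
Qed.

Lemma lcomp1 a b : lcomp (a - b) 1 = (b == a)%:R :> lpoly R.
Proof.
apply/val_inj/lcoefP => n; rewrite (lcomp_coef charC) lmonomE.
have [->|ba] := eqVneq b a.
  rewrite subrr -[0 in LHS]/(0%:~R : C) (inj_eq (intr_inj_pchar0 charC)) eq_sym.
  by rewrite -[RHS]/(lmonom R 0 n) lmonomE; case: eqP.
have [->|n0] := eqVneq n 0; last by case: ifP.
by rewrite subr_eq0 eq_sym (negPf ba).
Qed.

Section OneModule.
Variable N : conn (diff_lpoly R).
Hypothesis N_int : forall u : N, nabla_integral u.

Let dec (u : N) : seq (C * N) :=
  sval (cid (homog_decomp red_alg R_complete (N_int u))).
Let dec_homog u p : p \in dec u -> homog red p.1 p.2.
Proof. by rewrite /dec; case: cid => d [dh _] /=; apply: dh. Qed.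
Let decE u : u = \sum_(p <- dec u) p.2.
Proof. by rewrite /dec; case: cid => d []. Qed.

(* The operator acting as the scalar [F t] on the vectors of exponent [t]. *)
Let op (F : C -> lpoly R) (u : N) : N := \sum_(p <- dec u) F p.1 *: p.2.

(** The chosen decomposition minus [d] is a homogeneous relation, to which [homog_indep_scale]
    applies. *)
Let opE F (d : seq (C * N)) : (forall p, p \in d -> homog red p.1 p.2) ->
  op F (\sum_(p <- d) p.2) = \sum_(p <- d) F p.1 *: p.2.
Proof.
move=> dh; set u := \sum_(p <- d) p.2.
pose D := dec u ++ [seq (p.1, - p.2) | p <- d].
have Dh p : p \in D -> homog red p.1 p.2.
  rewrite mem_cat => /orP[/dec_homog//|/mapP[q qd ->]] /=.
  exact/homogN/dh.
have D0 : \sum_(p <- D) p.2 = 0.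
  by rewrite big_cat big_map /= -decE sumrN subrr.
have := homog_indep_scale red_alg R_complete (F : C -> diff_lpoly R) Dh D0.
rewrite big_cat big_map /=; under [X in _ + X]eq_bigr do rewrite scalerN.
by rewrite sumrN => /subr0_eq.
Qed.

Let opD F u v : op F (u + v) = op F u + op F v.
Proof.
rewrite {1}[u]decE {1}[v]decE -big_cat opE ?big_cat // => p.
by rewrite mem_cat => /orP[]/dec_homog.
Qed.

Let op_comp a (f : laurent R) (u : N) := op (fun t => lcomp (a - t) f) u.

Let op_comp_bal a : balanced phi (op_comp a).
Proof.
split=> [f g u|f u v|f g u].
- rewrite /op_comp /op -big_split; apply: eq_bigr => p _.
  by rewrite lcompD scalerDl.
- exact: opD.
move: g f; apply: lpoly_ind => [g h IHg IHh f|c d f].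
  rewrite rmorphD mulrDr scalerDl /op_comp opD -!/(op_comp _ _ _) -IHg -IHh.
  rewrite /op_comp /op -big_split; apply: eq_bigr => p _.
  by rewrite lcompD scalerDl.
(* Multiplication by x^d shifts each exponent by [d], and [lcomp_mul_monom] matches this on the
   coefficients. *)
pose dd := [seq (p.1 + d%:~R, (c *: lpXn R d) *: p.2) | p <- dec u].
have cdE (w : N) : (c *: lpXn R d) *: w = c%:A *: (lpXn R d *: w).
  by rewrite scalerA mulr_algl.
have ddh p : p \in dd -> homog red p.1 p.2.
  move=> /mapP[q /dec_homog qh ->] /=; rewrite cdE; apply: homogZ.
  by apply: (homog_shift (n := d)) => //; apply: lpoly_theta_X.
have -> : (c *: lpXn R d) *: u = \sum_(p <- dd) p.2.
  by rewrite big_map /= -scaler_sumr -decE.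
rewrite -[phi _]/(c *: lmonom R d) /op_comp opE // big_map /op.
apply: eq_bigr => p _ /=; rewrite scalerA lcomp_mul_monom mulrC.
by rewrite opprD addrA.
Qed.

(* [f (x) u |-> op_comp a f u] is the component of exponent [a] of [f u]; at
   [f = 1] it recovers the components of [u] from [1 (x) u]. *)
Lemma unit_inj (u : N) : tens phi 1 u = 0 -> u = 0.
Proof.
move=> u0; rewrite [LHS]decE (sum_by_value (fun p : C * N => p.1)).
rewrite big1 // => a _.
transitivity (op_comp a 1 u).
  rewrite /op_comp /op big_mkcond; apply: eq_bigr => p _.
  by rewrite lcomp1; case: eqP => _; rewrite ?scale1r ?scale0r.
rewrite -(tens_liftE (op_comp_bal a)) u0.
exact: tens_lift0 (op_comp_bal a).
Qed.

Lemma unit_integral (u : N) : nabla_integral (tens phi 1 u : bc_ob phi N).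
Proof.
by have [P Pm Pu] := N_int u; exists P => //; rewrite tens1_act Pu tens0r.
Qed.

(** A homogeneous [y] has Laurent polynomial coefficients on the homogeneous vectors
    [tens phi 1 (v i)], and these coefficients can be moved across the tensor sign. *)
Lemma unit_surj (N_rs : rs_laurent (bc_ob phi N)) (y : bc_ob phi N) :
  nabla_integral y -> exists u, tens phi 1 u = y.
Proof.
have [n [e eM]] := rs_laurent_lattice N_rs.
have [k [g gN]] := conn_fg N.
have [r [v [s [sv vg]]]] :=
  homog_generators red_alg R_complete (fun i => N_int (g i)).
have /choice[c cE] := vg.
have vN u : exists f : 'I_r -> lpoly R, u = \sum_i f i *: v i.
  have [f ->] := gN u; exists (fun j => \sum_i f i * c i j).
  under eq_bigr do rewrite cE scaler_sumr.
  rewrite exchange_big; apply: eq_bigr => j _; rewrite scaler_suml.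
  by apply: eq_bigr => i _; rewrite scalerA.
have sv1 i : homog red (s i) (tens phi 1 (v i) : bc_ob phi N).
  have [l [P [Pm Pa Pv]]] := sv i; exists l, P; split=> //.
  by rewrite tens1_act Pv tens0r.
move: y; apply: (homog_ind red_alg R_complete) => [|_ _ [u <-] [w <-]|a y ay].
- by exists 0; rewrite tens0r.
- by exists (u + w); rewrite tensDr.
have [f yE] := tens_span (phi := phi) vN y; rewrite yE in ay *.
rewrite (homog_component red_alg R_complete R_noetherian charC eM sv1 ay).
exists (\sum_i lcomp (a - s i) (f i) *: v i).
rewrite (big_morph _ (tensDr phi 1) (tens0r phi N 1)).
by apply: eq_bigr => i _; rewrite tensZ mul1r scale_tens mulr1.
Qed.

End OneModule.
End Unit.

Lemma naturally_isomorphic_sym (C D : category) (F G : functor C D) :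
  naturally_isomorphic F G -> naturally_isomorphic G F.
Proof.
move=> [u [v [vu uv un]]]; exists v, u; split=> // X Y f.
rewrite -[fmap G f]compm1 -(uv X) [compm (fmap G f) _]compmA -un.
by rewrite -[compm (compm (u Y) _) _]compmA compmA vu comp1m.
Qed.

(** * Functoriality and naturality *)

Section QuasiInverse.
Variables (C : closedFieldType) (R : comAlgType C) (red : {rmorphism R -> C}).
Hypothesis red_alg : forall c, red c%:A = c.
Hypothesis R_complete : adic_complete [set a | red a = 0].
Hypothesis R_noetherian : noetherian R.
Hypothesis charC : [pchar C] =i pred0.
Local Notation phi := (lpoly_laurent R).

Let Int (M : MCrs_laurent R) : subconn phi (sval M) :=
  integral_part red_alg R_complete R_noetherian charC (svalP M).

Let Int_ob (M : MCrs_laurent R) : MCrs_lpoly R :=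
  exist _ (sub_conn (Int M)) (integral_part_rs _ _ _ _ _).

Section IntMorphism.
Variables (M N : MCrs_laurent R) (f : mor M N).
Let F : conn_hom (sval M) (sval N) := f.
Let g (u : sub_conn (Int M)) : sub_conn (Int N) :=
  @sub_mk _ _ _ _ _ (Int N) _ (nabla_integral_hom F (sub_valP u)).
Fact integral_part_hom_linear : linear g.
Proof. by move=> a u v; apply: sub_val_inj; apply: chom_linear. Qed.
Fact integral_part_hom_nabla u : g (nabla u) = nabla (g u).
Proof. by apply: sub_val_inj; apply: chom_nabla. Qed.
Definition integral_part_hom : conn_hom (sub_conn (Int M)) (sub_conn (Int N)) :=
  ConnHom integral_part_hom_linear integral_part_hom_nabla.
End IntMorphism.

Fact integral_part_hom1 (M : MCrs_laurent R) :
  integral_part_hom (idmor M) = chom_id (sub_conn (Int M)).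
Proof. by apply: chom_ext => u; apply: sub_val_inj. Qed.
Fact integral_part_homM (M N P : MCrs_laurent R) (g : mor N P) (f : mor M N) :
  integral_part_hom (compm g f) =
  chom_comp (integral_part_hom g) (integral_part_hom f).
Proof. by apply: chom_ext => u; apply: sub_val_inj. Qed.

Definition integral_functor : functor (MCrs_laurent R) (MCrs_lpoly R) :=
  @Functor (MCrs_laurent R) (MCrs_lpoly R) Int_ob integral_part_hom
    integral_part_hom1 integral_part_homM.

Lemma counit_natural :
  naturally_isomorphic (comp_functor (r0 R) integral_functor)
    (id_functor (MCrs_laurent R)).
Proof.
pose i (M : MCrs_laurent R) :=
  integral_part_iso red_alg R_complete R_noetherian charC (svalP M).
exists (fun M => iso_fwd (i M)), (fun M => iso_bwd (i M)); split.
- by move=> M; exact: (iso_bwdK (i M)).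
- by move=> M; exact: (iso_fwdK (i M)).
move=> M N f; apply: chom_ext; apply: tens_ext => [x y|x y|b u].
- by rewrite !chomD.
- by rewrite !chomD.
rewrite /= bc_funE [LHS]counitE [counit_fun _]counitE.
by rewrite (chomZ (f : conn_hom _ _)).
Qed.

Section UnitMap.
Variable N : MCrs_lpoly R.
Let N_int := rs_lpoly_integral R_noetherian (svalP N).
Let M : MCrs_laurent R := r0 R N.
Let eta (u : sval N) : sub_conn (Int M) :=
  @sub_mk _ _ _ _ _ (Int M) _ (unit_integral N_int u).
Fact unit_linear : linear eta.
Proof.
move=> a u v; apply: sub_val_inj; rewrite sub_valD sub_valZ !sub_mkE tensDr.
by rewrite tensZ mul1r [in RHS]scale_tens mulr1.
Qed.
Fact unit_nabla u : eta (nabla u) = nabla (eta u).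
Proof.
apply: sub_val_inj; rewrite sub_val_nabla !sub_mkE.
by rewrite [RHS]nabla_bcE der1 tens0l add0r.
Qed.
Definition unit_hom : conn_hom (sval N) (sub_conn (Int M)) :=
  ConnHom unit_linear unit_nabla.

Lemma unit_hom_inj u : unit_hom u = 0 -> u = 0.
Proof.
move=> /(congr1 (@sub_val _ _ _ _ _ _)) => u0.
exact: (unit_inj red_alg R_complete charC N_int u0).
Qed.

Lemma unit_hom_surj y : exists u, unit_hom u = y.
Proof.
have [u uy] := unit_surj red_alg R_complete R_noetherian charC N_int (svalP M)
  (sub_valP y).
by exists u; apply: sub_val_inj.
Qed.

Definition unit_iso : iso (sval N : MC (diff_lpoly R)) (sub_conn (Int M)) :=
  chom_iso unit_hom_inj unit_hom_surj.
End UnitMap.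

Lemma unit_natural :
  naturally_isomorphic (id_functor (MCrs_lpoly R))
    (comp_functor integral_functor (r0 R)).
Proof.
exists (fun N => iso_fwd (unit_iso N)), (fun N => iso_bwd (unit_iso N)); split.
- by move=> N; exact: (iso_bwdK (unit_iso N)).
- by move=> N; exact: (iso_fwdK (unit_iso N)).
move=> N N' f; apply: chom_ext => u; apply: sub_val_inj.
exact/esym/(bc_funE phi (f : conn_hom (sval N) (sval N'))).
Qed.

Lemma r0_equivalence : is_equivalence (r0 R).
Proof.
exists integral_functor; split; last exact: counit_natural.
exact: naturally_isomorphic_sym unit_natural.
Qed.

End QuasiInverse.

Theorem theorem10p1 (C : closedFieldType) (R : comAlgType C) (m : set R)
    (charC : [pchar C] =i pred0)
    (R_noetherian : noetherian R)
    (R_local : local_ring m)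
    (R_complete : adic_complete m)
    (R_residue : residue_field_eq m) :
  is_equivalence (r0 R).
Proof.
have [red [red_alg mE]] := residue_morphism R_local R_residue.
rewrite mE in R_complete.
exact: (r0_equivalence red_alg R_complete R_noetherian charC).
Qed.
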